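(* Let $n\ge 1$, let $\Gamma$ be a group of type $F_n$, let $Y$ be a simplicial complex which is a $K(\Gamma,1)$ and has finite $n$-skeleton, let $X$ be the $n$-skeleton of the universal cover of $Y$ with its $\Gamma$-action by deck transformations, and let $\{\Lambda_i\}_i$ be a family of finite index subgroups of $\Gamma$. Then $\{\Lambda_i\backslash X\}_i$ is a family of spectral expanders if and only if $H^j(\Gamma,\hat{\oplus}_i L^2(\Lambda_i\backslash\Gamma))=0$ for all $1\le j\le n-1$ and $H^n(\Gamma,\hat{\oplus}_i L^2(\Lambda_i\backslash\Gamma))$ is reduced.
   Context: A group $\Gamma$ is of type $F_n$ if there is a $K(\Gamma,1)$ CW complex with finite $n$-skeleton. For a finite simplicial complex $Z$ with set $Z^l$ of (oriented) $l$-simplices, $C^l(Z,\mathbb{C})=\mathrm{Hom}_{\mathbb{C}}(\mathbb{C}[Z^l],\mathbb{C})$ is the space of simplicial cochains with the inner product making the basis dual to $Z^l$ orthonormal, and $d_l:C^l\to C^{l+1}$ is the coboundary map. The upper Laplacian is $\Delta_l^+=d_l^*d_l$. Its spectral gap is the minimum eigenvalue of the restriction of $\Delta_l^+$ to the orthogonal complement of $d_{l-1}C^{l-1}(Z,\mathbb{C})$ ($+\infty$ if this complement is zero); for $l=0$ the augmented complex is used, i.e. $d_{-1}C^{-1}(Z,\mathbb{C})$ is the space of constant functions on vertices. Here, $\{\Lambda_i\backslash X\}_i$ is a family of spectral expanders if these finite simplicial complexes have uniformly bounded degree (there is a uniform bound on the number of simplices containing a given vertex) and there is $\epsilon>0$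 such that for every $i$ and every $0\le l\le n-1$ the spectral gap of $\Delta_l^+$ on $C^l(\Lambda_i\backslash X,\mathbb{C})$ is at least $\epsilon$. $L^2(\Lambda_i\backslash\Gamma)$ is the space of complex functions on $\Lambda_i\backslash\Gamma$ with counting measure and the unitary action $(\gamma f)(\Lambda_i x)=f(\Lambda_i x\gamma)$; $\hat{\oplus}$ denotes Hilbert space direct sum. For a unitary representation $(\pi,V_\pi)$ and a free resolution $\{\mathbb{C}\Gamma[Y^l]\}_l$ of $\mathbb{C}$ (with $\mathbb{C}\Gamma[Y^l]$ free on a set $Y^l$), $H^*(\Gamma,\pi)$ is the cohomology of $\{\mathrm{Hom}_{\mathbb{C}\Gamma}(\mathbb{C}\Gamma[Y^l],V_\pi)\}_l$, where $\mathrm{Hom}_{\mathbb{C}\Gamma}(\mathbb{C}\Gamma[Y^l],V_\pi)\cong V_\pi^{Y^l}$ has the product topology. $H^l(\Gamma,\pi)$ is called reduced if the space of $l$-coboundaries is closed in the space of $l$-cocycles; this does not depend on the resolution. *)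

(* Defs.v *)
From HB Require Import structures.
From mathcomp Require Import all_boot all_order all_algebra.
From mathcomp Require Import perm finmap complex ring.
From mathcomp Require Import all_classical all_reals all_analysis.
Import Order.TTheory GRing.Theory Num.Theory numFieldNormedType.Exports.

Set Implicit Arguments.
Unset Strict Implicit.
Unset Printing Implicit Defensive.

Local Open Scope classical_set_scope.
Local Open Scope ring_scope.

Section HilbertSum.
Variables (R : realType) (I : choiceType) (V : I -> normedModType R[i]).

(* Norms over R[i] take their (nonnegative real) values in R[i]. *)
Definition rnorm (W : normedModType R[i]) (x : W) : R := complex.Re `|x|.

Lemma rnormE (W : normedModType R[i]) (x : W) : (rnorm x)%:C%C = `|x|.
Proof. by rewrite /rnorm RRe_real ?normr_real. Qed.

Lemma rnorm_ge0 (W : normedModType R[i]) (x : W) : 0 <= rnorm x.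
Proof. by rewrite -ler0c rnormE. Qed.

Lemma rnorm_eq0 (W : normedModType R[i]) (x : W) : rnorm x = 0 -> x = 0.
Proof. by move=> h; apply/eqP; rewrite -normr_eq0 -rnormE h. Qed.

Lemma rnormD (W : normedModType R[i]) (x y : W) :
  rnorm (x + y) <= rnorm x + rnorm y.
Proof. by rewrite -lecR rmorphD/= !rnormE ler_normD. Qed.

Lemma rnormZ (W : normedModType R[i]) (a : R[i]) (x : W) :
  rnorm (a *: x) = complex.Re `|a| * rnorm x.
Proof.
apply: complexI; rewrite rnormE normrZ -(rnormE x).
by rewrite -{1}(RRe_real (normr_real a)) -rmorphM.
Qed.

Definition sqsum (f : forall i, V i) : \bar R := (\esum_(i in [set: I]) ((rnorm (f i)) ^+ 2)%:E)%E.

Lemma sqsum_ge0 (f : forall i, V i) : (0 <= sqsum f)%E.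
Proof. by apply: esum_ge0 => i _; rewrite lee_fin sqr_ge0. Qed.

Lemma esumZ_le (c : R) (a : I -> R) : 0 <= c -> (forall i, 0 <= a i) ->
  (\esum_(i in [set: I]) (c * a i)%:E <=
   c%:E * \esum_(i in [set: I]) (a i)%:E)%E.
Proof.
move=> c0 a0; apply: ge_ereal_sup => _ [X [finX _] <-].
under eq_fsbigr do rewrite EFinM.
rewrite -ge0_mule_fsumr; last by move=> i; rewrite lee_fin.
apply: lee_wpmul2l; first by rewrite lee_fin.
by apply: esum_ge; exists X.
Qed.

Lemma sqsumD_le (t : R) (f g : forall i, V i) : 0 < t ->
  (sqsum (fun i => (f i + g i)%R) <=
   (1 + t)%:E * sqsum f + (1 + t^-1)%:E * sqsum g)%E.
Proof.
move=> t0; have ti0 : 0 < t^-1 by rewrite invr_gt0.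
apply: (@le_trans _ _ (\esum_(i in [set: I])
  (((1 + t) * rnorm (f i) ^+ 2)%:E + ((1 + t^-1) * rnorm (g i) ^+ 2)%:E))%E).
  apply: le_esum => i _; rewrite -EFinD lee_fin.
  apply: (@le_trans _ _ ((rnorm (f i) + rnorm (g i)) ^+ 2)).
    by rewrite lerXn2r ?nnegrE ?addr_ge0 ?rnorm_ge0 ?rnormD.
  set a := rnorm _; set b := rnorm _.
  have -> : (1 + t) * a ^+ 2 + (1 + t^-1) * b ^+ 2 =
      (a + b) ^+ 2 + t^-1 * (t * a - b) ^+ 2.
    by field; rewrite gt_eqF.
  by rewrite lerDl mulr_ge0 ?sqr_ge0 ?ltW.
rewrite esumD; last 2 first.
  by move=> i _; rewrite lee_fin mulr_ge0 ?sqr_ge0 ?addr_ge0 ?ltW.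
  by move=> i _; rewrite lee_fin mulr_ge0 ?sqr_ge0 ?addr_ge0 ?ltW.
by apply: leeD; apply: esumZ_le => [|i]; rewrite ?sqr_ge0 ?addr_ge0 ?ltW.
Qed.

Lemma sqsumZ_le (a : R[i]) (f : forall i, V i) :
  (sqsum (fun i => (a *: f i)%R) <= (complex.Re `|a| ^+ 2)%:E * sqsum f)%E.
Proof.
rewrite /sqsum; under eq_esum do rewrite rnormZ exprMn.
by apply: esumZ_le => [|i]; rewrite sqr_ge0.
Qed.

(* The direct sum of the V i with norm f |-> sqrt (sum_i |f i|^2): the Hilbert *)
(* space direct sum when the V i are Hilbert spaces                           *)
Record hilbert_sum := HilbertSum {
  hsval :> forall i, V i;
  hsvalP : (sqsum hsval < +oo)%E
}.

HB.instance Definition _ := gen_eqMixin hilbert_sum.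
HB.instance Definition _ := gen_choiceMixin hilbert_sum.

Lemma hilbert_sumP (f g : hilbert_sum) : (forall i, f i = g i) -> f = g.
Proof.
case: f g => [f Pf] [g Pg] /= fg.
have e : f = g by exact: functional_extensionality_dep.
by case: _ / e in Pg *; rewrite (Prop_irrelevance Pf Pg).
Qed.

Implicit Types f g : hilbert_sum.

Lemma hs_fin (f : hilbert_sum) : sqsum f \is a fin_num.
Proof. by rewrite ge0_fin_numE ?sqsum_ge0 ?hsvalP. Qed.

Lemma sqsum_add (f g : hilbert_sum) :
  (sqsum (fun i => (f i + g i)%R) < +oo)%E.
Proof.
apply: le_lt_trans (sqsumD_le f g ltr01) _.
rewrite -(fineK (hs_fin f)) -(fineK (hs_fin g)).
by rewrite -!EFinM -EFinD ltry.
Qed.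

Lemma sqsum_scale (a : R[i]) (f : hilbert_sum) :
  (sqsum (fun i => (a *: f i)%R) < +oo)%E.
Proof.
apply: le_lt_trans (sqsumZ_le a f) _.
by rewrite -(fineK (hs_fin f)) -EFinM ltry.
Qed.

Lemma sqsum_opp (f : hilbert_sum) : (sqsum (fun i => (- f i)%R) < +oo)%E.
Proof.
have := sqsum_scale (-1) f.
by rewrite /sqsum; under eq_esum do rewrite scaleN1r.
Qed.

Lemma sqsum_zero : (sqsum (fun i => 0%R : V i) < +oo)%E.
Proof.
rewrite /sqsum esum1 ?ltry// => i _.
by rewrite /rnorm normr0 expr0n.
Qed.

Definition hs_zero := HilbertSum sqsum_zero.
Definition hs_opp f := HilbertSum (sqsum_opp f).
Definition hs_add f g := HilbertSum (sqsum_add f g).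
Definition hs_scale a f := HilbertSum (sqsum_scale a f).

Lemma hs_addA : associative hs_add.
Proof. by move=> f g h; apply: hilbert_sumP => i /=; rewrite addrA. Qed.
Lemma hs_addC : commutative hs_add.
Proof. by move=> f g; apply: hilbert_sumP => i /=; rewrite addrC. Qed.
Lemma hs_add0 : left_id hs_zero hs_add.
Proof. by move=> f; apply: hilbert_sumP => i /=; rewrite add0r. Qed.
Lemma hs_addN : left_inverse hs_zero hs_opp hs_add.
Proof. by move=> f; apply: hilbert_sumP => i /=; rewrite addNr. Qed.

HB.instance Definition _ := GRing.isZmodule.Build hilbert_sum
  hs_addA hs_addC hs_add0 hs_addN.

Lemma hs_scaleA a b f : hs_scale a (hs_scale b f) = hs_scale (a * b) f.
Proof. by apply: hilbert_sumP => i /=; rewrite scalerA. Qed.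
Lemma hs_scale1 : left_id 1 hs_scale.
Proof. by move=> f; apply: hilbert_sumP => i /=; rewrite scale1r. Qed.
Lemma hs_scaleDr : right_distributive hs_scale +%R.
Proof. by move=> a f g; apply: hilbert_sumP => i /=; rewrite scalerDr. Qed.
Lemma hs_scaleDl f : {morph hs_scale^~ f : a b / a + b}.
Proof. by move=> a b; apply: hilbert_sumP => i /=; rewrite scalerDl. Qed.

HB.instance Definition _ := GRing.Zmodule_isLmodule.Build R[i] hilbert_sum
  hs_scaleA hs_scale1 hs_scaleDr hs_scaleDl.

Definition hs_sq (f : hilbert_sum) : R := fine (sqsum f).

Lemma hs_sq_ge0 f : 0 <= hs_sq f.
Proof. by apply: fine_ge0; exact: sqsum_ge0. Qed.

Lemma hs_sqD_le (t : R) (f g : hilbert_sum) : 0 < t ->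
  hs_sq (f + g) <= (1 + t) * hs_sq f + (1 + t^-1) * hs_sq g.
Proof.
move=> t0; rewrite -lee_fin EFinD !EFinM !fineK ?hs_fin//.
exact: sqsumD_le.
Qed.

Lemma hs_sqZ_le (a : R[i]) (f : hilbert_sum) :
  hs_sq (a *: f) <= complex.Re `|a| ^+ 2 * hs_sq f.
Proof. by rewrite -lee_fin EFinM !fineK ?hs_fin//; exact: sqsumZ_le. Qed.

Lemma hs_sq_coord (f : hilbert_sum) i : rnorm (f i) ^+ 2 <= hs_sq f.
Proof.
rewrite -lee_fin fineK ?hs_fin//; apply: esum_ge; exists [set i].
  by split.
by rewrite fsbig_set1.
Qed.

Lemma hs_sq_eq0 (f : hilbert_sum) : hs_sq f = 0 -> f = 0.
Proof.
move=> f0; apply: hilbert_sumP => i /=; apply/eqP.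
have := hs_sq_coord f i; rewrite f0 => h.
have : rnorm (f i) ^+ 2 == 0 by rewrite eq_le h sqr_ge0.
by rewrite expf_eq0/= => /eqP/rnorm_eq0 ->.
Qed.

Definition hs_norm (f : hilbert_sum) : R[i] := (Num.sqrt (hs_sq f))%:C%C.

Lemma hs_normD (f g : hilbert_sum) : hs_norm (f + g) <= hs_norm f + hs_norm g.
Proof.
rewrite /hs_norm -rmorphD lecR.
have [/hs_sq_eq0 ->|f0] := eqVneq (hs_sq f) 0.
  by rewrite add0r lerDr sqrtr_ge0.
have [/hs_sq_eq0 ->|g0] := eqVneq (hs_sq g) 0.
  by rewrite addr0 lerDl sqrtr_ge0.
set a := Num.sqrt (hs_sq f); set b := Num.sqrt (hs_sq g).
have a0 : 0 < a by rewrite sqrtr_gt0 lt_neqAle eq_sym f0 hs_sq_ge0.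
have b0 : 0 < b by rewrite sqrtr_gt0 lt_neqAle eq_sym g0 hs_sq_ge0.
have ab0 : 0 <= a + b by rewrite addr_ge0// ltW.
rewrite -(ger0_norm ab0) -sqrtr_sqr; apply: ler_wsqrtr.
have t0 : 0 < b / a by rewrite divr_gt0.
apply: le_trans (hs_sqD_le f g t0) _.
rewrite -(sqr_sqrtr (hs_sq_ge0 f)) -(sqr_sqrtr (hs_sq_ge0 g)) -/a -/b.
rewrite le_eqVlt; apply/orP; left; apply/eqP.
by field; rewrite !gt_eqF.
Qed.

Lemma hs_normZ (a : R[i]) (f : hilbert_sum) :
  hs_norm (a *: f) = `|a| * hs_norm f.
Proof.
rewrite /hs_norm -{1}(RRe_real (normr_real a)) -rmorphM; congr (_%:C)%C.
have r0 (c : R[i]) : 0 <= complex.Re `|c| by rewrite -ler0c RRe_real ?normr_real.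
rewrite -{1}(ger0_norm (r0 a)) -sqrtr_sqr -sqrtrM ?sqr_ge0//.
congr Num.sqrt; apply/eqP; rewrite eq_le hs_sqZ_le andTb.
have [->|a0] := eqVneq a 0.
  by rewrite normr0 expr0n mul0r hs_sq_ge0.
have := hs_sqZ_le a^-1 (a *: f); rewrite scalerA mulVf// scale1r normfV.
have ra0 : 0 < complex.Re `|a|.
  rewrite lt_def r0 andbT; apply: contra_neq a0 => ra0.
  by apply/eqP; rewrite -normr_eq0 -(RRe_real (normr_real a)) ra0.
have -> : complex.Re `|a|^-1 = (complex.Re `|a|)^-1.
  by apply: complexI; rewrite fmorphV !RRe_real ?normr_real// rpredV normr_real.
by rewrite exprVn mulrC ler_pdivlMr ?exprn_gt0// mulrC.
Qed.

Lemma hs_norm_eq0 (f : hilbert_sum) : hs_norm f = 0 -> f = 0.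
Proof.
move=> h; have /complexI/eqP : (Num.sqrt (hs_sq f))%:C%C = 0%:C%C := h.
rewrite sqrtr_eq0 => {}h; apply: hs_sq_eq0.
by apply/eqP; rewrite eq_le h hs_sq_ge0.
Qed.

HB.instance Definition _ := Lmodule_isNormed.Build R[i] hilbert_sum
  hs_normD hs_normZ hs_norm_eq0.

End HilbertSum.

Section UnitaryRepresentations.
Variables (R : realType) (Gamma : groupType).

(* On a Hilbert space, these are the unitary representations *)
(* (invertible linear isometries).                           *)
Record unitary_rep (V : normedModType R[i]) := UnitaryRep {
  rep :> Gamma -> V -> V;
  rep_linear : forall g, linear (rep g);
  rep1 : forall v, rep 1%g v = v;
  repM : forall g h v, rep (g * h)%g v = rep g (rep h v);
  rep_norm : forall g v, `|rep g v| = `|v|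
}.

Section HilbertSumRep.
Variables (I : choiceType) (V : I -> normedModType R[i]).
Variable pi : forall i, unitary_rep (V i).

Lemma hs_rep_sqsum g (f : hilbert_sum V) :
  sqsum (fun i => pi i g (f i)) = sqsum f.
Proof. by apply: eq_esum => i _; rewrite /rnorm rep_norm. Qed.

Lemma hs_rep_fin g (f : hilbert_sum V) :
  (sqsum (fun i => pi i g (f i)) < +oo)%E.
Proof. by rewrite hs_rep_sqsum hsvalP. Qed.

Definition hs_rep_fun g f : hilbert_sum V := HilbertSum (hs_rep_fin g f).

Lemma hs_rep_linear g : linear (hs_rep_fun g).
Proof. by move=> a f h; apply: hilbert_sumP => i /=; rewrite rep_linear. Qed.

Lemma hs_rep1 f : hs_rep_fun 1%g f = f.
Proof. by apply: hilbert_sumP => i /=; rewrite rep1. Qed.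

Lemma hs_repM g h f : hs_rep_fun (g * h)%g f = hs_rep_fun g (hs_rep_fun h f).
Proof. by apply: hilbert_sumP => i /=; rewrite repM. Qed.

Lemma hs_rep_norm g f : `|hs_rep_fun g f| = `|f|.
Proof.
by rewrite /Num.norm/= /hs_norm /hs_sq [sqsum (hs_rep_fun g f)]hs_rep_sqsum.
Qed.

Definition hs_rep : unitary_rep (hilbert_sum V) :=
  UnitaryRep hs_rep_linear hs_rep1 hs_repM hs_rep_norm.

End HilbertSumRep.

Section CosetRep.
Variable L : {pred Gamma}.

Definition rcoset (x : Gamma) : set Gamma := [set y | (y / x)%g \in L].

(* The set L \ Gamma of right cosets L x *)
Definition rcosets : choiceType := set_type (range rcoset).

Lemma rcoset_mulP (c : rcosets) (g : Gamma) :
  [set (y * g)%g | y in val c] \in range rcoset.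
Proof.
case: c => c /= /set_mem[x _ <-]; apply/mem_set; exists (x * g)%g => //.
apply/seteqP; split => [y /= yL|_ /= [y yL <-]]; last first.
  by rewrite /rcoset/= invgM mulgA mulgK.
exists (y * g^-1)%g; last by rewrite mulgVK.
by move: yL; rewrite /rcoset/= invgM mulgA.
Qed.

Definition rcoset_mul (c : rcosets) g : rcosets :=
  exist _ [set (y * g)%g | y in val c] (rcoset_mulP c g).

Lemma rcoset_mul1 c : rcoset_mul c 1%g = c.
Proof.
apply: val_inj => /=; rewrite -[RHS]image_id.
by apply: eq_imagel => y _; rewrite mulg1.
Qed.

Lemma rcoset_mulM c g h : rcoset_mul c (g * h)%g = rcoset_mul (rcoset_mul c g) h.
Proof.
apply: val_inj => /=; rewrite [RHS]image_comp.
by apply: eq_imagel => y _ /=; rewrite mulgA.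
Qed.

(* L^2(L \ Gamma) with counting measure *)
Definition L2_cosets := hilbert_sum (fun _ : rcosets => R[i]^o : normedModType R[i]).

Lemma L2_cosets_sqsum g (f : L2_cosets) :
  sqsum (fun c => f (rcoset_mul c g)) = sqsum f.
Proof.
rewrite [RHS](@reindex_esum _ _ _ setT setT (rcoset_mul^~ g))//.
  split=> [//|c d _ _ cd|c _].
    by rewrite -[c]rcoset_mul1 -(mulgV g) rcoset_mulM cd -rcoset_mulM mulgV
      rcoset_mul1.
  by exists (rcoset_mul c g^-1)%g; rewrite // -rcoset_mulM mulVg rcoset_mul1.
Qed.

Lemma L2_cosets_fin g (f : L2_cosets) :
  (sqsum (fun c => f (rcoset_mul c g)) < +oo)%E.
Proof. by rewrite L2_cosets_sqsum hsvalP. Qed.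

Definition coset_rep_fun g f : L2_cosets := HilbertSum (L2_cosets_fin g f).

Lemma coset_rep_linear g : linear (coset_rep_fun g).
Proof. by move=> a f h; apply: hilbert_sumP. Qed.

Lemma coset_rep1 f : coset_rep_fun 1%g f = f.
Proof. by apply: hilbert_sumP => c /=; rewrite rcoset_mul1. Qed.

Lemma coset_repM g h f :
  coset_rep_fun (g * h)%g f = coset_rep_fun g (coset_rep_fun h f).
Proof. by apply: hilbert_sumP => c /=; rewrite rcoset_mulM. Qed.

Lemma coset_rep_norm g f : `|coset_rep_fun g f| = `|f|.
Proof.
by rewrite /Num.norm/= /hs_norm /hs_sq [sqsum (coset_rep_fun g f)]L2_cosets_sqsum.
Qed.

Definition coset_rep : unitary_rep L2_cosets :=
  UnitaryRep coset_rep_linear coset_rep1 coset_repM coset_rep_norm.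

End CosetRep.

End UnitaryRepresentations.

Section FreeModules.
Variables (R : realType) (Gamma : groupType).

Section FreeModule.
Variable Y : choiceType.

Definition fin_supp : {pred Gamma * Y -> R[i]} :=
  fun m => `[< finite_set [set k | m k != 0] >].

Lemma fin_supp_submod : submod_closed fin_supp.
Proof.
split=> [|a m1 m2 /asboolP m1f /asboolP m2f]; apply/asboolP.
  by rewrite (_ : mkset _ = set0)// -subset0 => k /=; rewrite eqxx.
apply: (@sub_finite_set _ _ ([set k | m1 k != 0] `|` [set k | m2 k != 0])).
  move=> k /=; have [m10|//] := eqVneq (m1 k) 0; last by left.
  have [m20|//] := eqVneq (m2 k) 0; last by right.
  have -> : (a *: m1 + m2) k = a * m1 k + m2 k by [].
  by rewrite m10 m20 mulr0 addr0 eqxx.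
by rewrite finite_setU.
Qed.

HB.instance Definition _ := GRing.isSubmodClosed.Build R[i]
  (Gamma * Y -> R[i])%type fin_supp fin_supp_submod.

(* The free C[Gamma]-module C[Gamma][Y] with basis Y, as the finitely       *)
(* supported functions on Gamma * Y: (g, y) is the basis vector g . y over C *)
Record free_mod := FreeMod {
  fmval :> Gamma * Y -> R[i];
  fmvalP : fmval \in fin_supp
}.

HB.instance Definition _ := [isSub for fmval].
HB.instance Definition _ := [Choice of free_mod by <:].
HB.instance Definition _ := [SubChoice_isSubLmodule of free_mod by <:].

Lemma fm_act_fin (g : Gamma) (m : free_mod) :
  (fun k => m ((g^-1 * k.1)%g, k.2)) \in fin_supp.
Proof.
apply/asboolP; case: m => m /= /asboolP mf.
apply: (@sub_finite_set _ _
  ((fun k => ((g * k.1)%g, k.2)) @` [set k | m k != 0])).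
  move=> [h y] /= mh; exists ((g^-1 * h)%g, y) => //=.
  by rewrite mulgA mulgV mul1g.
exact: finite_image.
Qed.

Definition fm_act g m : free_mod := FreeMod (fm_act_fin g m).

Lemma fm_basis_fin (y : Y) :
  (fun k : Gamma * Y => (k == (1%g, y))%:R : R[i]) \in fin_supp.
Proof.
apply/asboolP; apply: (sub_finite_set _ (finite_set1 (1%g, y))).
by move=> k /=; have [//|_] := eqVneq k (1%g, y); rewrite eqxx.
Qed.

Definition fm_basis y : free_mod := FreeMod (fm_basis_fin y).

End FreeModule.

(* Resolution of the trivial module C by free C[Gamma]-modules *)
Record free_resolution := FreeResolution {
  res_basis : nat -> choiceType;
  res_d : forall l, free_mod (res_basis l.+1) -> free_mod (res_basis l);
  res_aug : free_mod (res_basis 0) -> R[i]^o;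
  res_d_linear : forall l, linear (@res_d l);
  res_d_equiv : forall l g m, @res_d l (fm_act g m) = fm_act g (@res_d l m);
  res_aug_linear : linear res_aug;
  res_aug_equiv : forall g m, res_aug (fm_act g m) = res_aug m;
  res_aug_surj : range res_aug = setT;
  res_exact0 : [set m | res_aug m = 0] = range (@res_d 0);
  res_exactS : forall l, [set m | @res_d l m = 0] = range (@res_d l.+1)
}.

End FreeModules.

Arguments res_d {R Gamma} f l m.

Section GroupCohomology.
Variables (R : realType) (Gamma : groupType) (F : free_resolution R Gamma).
Variables (V : normedModType R[i]) (pi : unitary_rep Gamma V).

(* Hom_(C[Gamma])(C[Gamma][Y^l], V) *)
Definition equiv_hom l : set (free_mod R Gamma (res_basis F l) -> V) :=
  [set f | linear f /\ forall g m, f (fm_act g m) = pi g (f m)].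
Arguments equiv_hom : clear implicits.

Definition cocycles l : set (free_mod R Gamma (res_basis F l) -> V) :=
  [set f | equiv_hom l f /\ f \o res_d F l = cst 0].
Arguments cocycles : clear implicits.

Definition coboundaries l : set (free_mod R Gamma (res_basis F l) -> V) :=
  match l with
  | 0 => [set cst 0]
  | l'.+1 => [set f \o res_d F l' | f in equiv_hom l']
  end.
Arguments coboundaries : clear implicits.

Definition cohomology_eq0 l := cocycles l = coboundaries l.

(* The identification of Hom_(C[Gamma])(C[Gamma][Y^l], V) with V^(Y^l), *)
(* which carries the product topology                                   *)
Definition on_basis l (f : free_mod R Gamma (res_basis F l) -> V) :
  {ptws res_basis F l -> V} := fun y => f (fm_basis R Gamma y).

Definition cohomology_reduced l :=
  closure (@on_basis l @` coboundaries l) `&` @on_basis l @` cocycles l `<=`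
  @on_basis l @` coboundaries l.

End GroupCohomology.

Section Topology.
Variables (R : realType) (T : topologicalType).

Definition is_path (x y : T) (p : R -> T) :=
  [/\ {within `[0, 1], continuous p}, p 0 = x & p 1 = y].

Definition path_connected := exists x : T, forall y : T, exists p, is_path x y p.

Definition path_homotopic (x y : T) (p q : R -> T) :=
  exists h : R * R -> T,
    [/\ {within `[0, 1] `*` `[0, 1], continuous h},
        {in `[0, 1], forall t, h (0, t) = p t /\ h (1, t) = q t} &
        {in `[0, 1], forall s, h (s, 0) = x /\ h (s, 1) = y}].

Definition path_concat (p q : R -> T) (t : R) : T :=
  if t <= 2^-1 then p (2 * t) else q (2 * t - 1).

Definition simply_connected :=
  path_connected /\
  forall (x : T) p, is_path x x p -> path_homotopic x x p (cst x).

(* phi represents an isomorphism from Gamma onto the group of homotopy  *)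
(* classes of loops at x0                                               *)
Definition pi1_isomorphic (Gamma : groupType) (x0 : T) :=
  exists phi : Gamma -> R -> T,
    [/\ forall g, is_path x0 x0 (phi g),
        forall g h, path_homotopic x0 x0 (phi (g * h)%g)
                      (path_concat (phi g) (phi h)),
        forall g h, path_homotopic x0 x0 (phi g) (phi h) -> g = h &
        forall p, is_path x0 x0 p -> exists g, path_homotopic x0 x0 p (phi g)].

Definition contractible :=
  exists (x0 : T) (h : T * R -> T),
    [/\ {within [set: T] `*` `[0, 1], continuous h},
        forall x, h (x, 0) = x & forall x, h (x, 1) = x0].

End Topology.

Section SimplicialComplexes.

Record scomplex (V : choiceType) := SComplex {
  simplices :> {fset V} -> Prop;
  sc_neq0 : forall s, simplices s -> s != fset0;
  sc_sub : forall s t, simplices s -> (t `<=` s)%fset -> t != fset0 ->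
    simplices t;
  sc_vertex : forall v, simplices [fset v]%fset
}.

Section Skeleton.
Variables (V : choiceType) (n : nat) (K : scomplex V).

Definition skel_simplices : set {fset V} := [set s | K s /\ (#|` s| <= n.+1)%N].

Lemma skel_neq0 s : skel_simplices s -> s != fset0.
Proof. by case=> /sc_neq0. Qed.

Lemma skel_sub s t : skel_simplices s -> (t `<=` s)%fset -> t != fset0 -> skel_simplices t.
Proof.
move=> [Ks sn] ts t0; split; first exact: sc_sub Ks ts t0.
exact: leq_trans (fsubset_leq_card ts) sn.
Qed.

Lemma skel_vertex v : skel_simplices [fset v]%fset.
Proof. by split; [exact: sc_vertex|rewrite cardfs1]. Qed.

Definition skeleton := SComplex skel_neq0 skel_sub skel_vertex.

End Skeleton.

Section Realization.
Variables (R : realType) (V : choiceType) (K : scomplex V).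

(* Points of |K|, in barycentric coordinates *)
Record realization := Realization {
  bary :> V -> R;
  bary_ge0 : forall v, 0 <= bary v;
  bary_supp : exists2 s, K s &
    (forall v, (v \in s) = (bary v != 0)) /\ \sum_(v <- s) bary v = 1
}.

HB.instance Definition _ := gen_eqMixin realization.
HB.instance Definition _ := gen_choiceMixin realization.

(* The weak topology: U is open when its trace on each closed simplex |s| *)
(* is open in |s|, where |s| has the topology of a subspace of R^V.       *)
Definition weak_open (U : set realization) :=
  forall s, K s -> exists2 O : set {ptws V -> R}, open O &
    forall x : realization, (forall v, x v != 0 -> v \in s) ->
      (U x <-> O (x : V -> R)).

Lemma weak_openT : weak_open setT.
Proof. by move=> s _; exists setT; [exact: openT|]. Qed.

Lemma weak_openI : setI_closed weak_open.
Proof.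
move=> A B Ao Bo s Ks.
have [OA oOA hA] := Ao s Ks; have [OB oOB hB] := Bo s Ks.
exists (OA `&` OB); first exact: openI.
move=> x xs; split=> -[xA xB].
  by split; [apply/(hA x xs)|apply/(hB x xs)].
by split; [apply/(hA x xs)|apply/(hB x xs)].
Qed.

Lemma weak_open_bigU (I : Type) (f : I -> set realization) :
  (forall i, weak_open (f i)) -> weak_open (\bigcup_i f i).
Proof.
move=> fo s Ks.
have /choice [B hO] : forall i, exists B : set {ptws V -> R}, open B /\
    forall x : realization, (forall v, x v != 0 -> v \in s) ->
      (f i x <-> B (x : V -> R)).
  by move=> i; have [B oO h] := fo i s Ks; exists B.
exists (\bigcup_i B i); first by apply: bigcup_open => i _; exact: (hO i).1.
move=> x xs; split=> -[i _ fx]; exists i => //; exact/((hO i).2 x xs).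
Qed.

HB.instance Definition _ := isOpenTopological.Build realization
  weak_openT weak_openI weak_open_bigU.

End Realization.

Section Coverings.
Variables (V W : choiceType) (K : scomplex V) (L : scomplex W) (p : W -> V).

(* p maps each simplex of L bijectively onto a simplex of K, and each *)
(* simplex of K containing p w has a unique lift containing w.        *)
Definition simplicial_covering :=
  [/\ forall v, exists w, p w = v,
      forall t, L t -> K [fset p w | w in t]%fset /\
                       {in t &, injective p} &
      forall w s, K s -> p w \in s ->
        exists! t, [/\ L t, w \in t & [fset p u | u in t]%fset = s]].

Definition deck_transformation (h : W -> W) :=
  [/\ bijective h, forall t, L t <-> L [fset h w | w in t]%fset &
      forall w, p (h w) = p w].

End Coverings.

Section Actions.
Variables (Gamma : groupType) (W : choiceType) (act : Gamma -> W -> W).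

(* act is an isomorphism from Gamma onto the group of deck transformations *)
Definition acts_by_deck (V : choiceType) (L : scomplex W) (p : W -> V) :=
  [/\ forall w, act 1%g w = w,
      forall g h w, act (g * h)%g w = act g (act h w),
      forall g, deck_transformation L p (act g),
      forall g h, act g =1 act h -> g = h &
      forall f, deck_transformation L p f -> exists g, f =1 act g].

Variable L : {pred Gamma}.

Definition orbit (w : W) : set W := [set act g w | g in [set g | g \in L]].

Definition orbits : choiceType := set_type (range orbit).

Definition to_orbit (w : W) : orbits := exist _ (orbit w) (mem_set (imageT orbit w)).

Variable X : scomplex W.

Definition orbit_simplices : set {fset orbits} :=
  [set [fset to_orbit w | w in s]%fset | s in simplices X].

Lemma quot_neq0 s : orbit_simplices s -> s != fset0.
Proof.
case=> t /sc_neq0/fset0Pn[w wt] <-; apply/fset0Pn.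
by exists (to_orbit w); apply/imfsetP; exists w.
Qed.

Lemma quot_sub s t : orbit_simplices s -> (t `<=` s)%fset -> t != fset0 -> orbit_simplices t.
Proof.
move=> [u Xu <-] /fsubsetP tu /fset0Pn[c ct].
pose u' := [fset w in u | to_orbit w \in t]%fset.
have tE : [fset to_orbit w | w in u']%fset = t.
  apply/fsetP => d; apply/imfsetP/idP => [[w /= + ->]|dt].
    by rewrite !inE => /andP[].
  have /imfsetP[w /= wu dE] := tu d dt.
  by exists w => //=; rewrite !inE wu -dE.
exists u' => //; apply: sc_sub Xu _ _.
  by apply/fsubsetP => w; rewrite !inE => /andP[].
have /imfsetP[w /= wu cE] := tu c ct.
by apply/fset0Pn; exists w; rewrite !inE wu -cE.
Qed.

Lemma quot_vertex c : orbit_simplices [fset c]%fset.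
Proof.
case: c => c cP; have [w _ wc] := set_mem cP.
exists [fset w]%fset; first exact: sc_vertex.
have -> : exist _ c cP = to_orbit w by apply: val_inj.
by rewrite imfset_fset1.
Qed.

(* For a free action through deck transformations, this is the quotient *)
(* complex L \ X.                                                       *)
Definition quotient_complex := SComplex quot_neq0 quot_sub quot_vertex.

End Actions.

(* p : Yt -> Y is a universal cover *)
Definition universal_cover (R : realType) (V W : choiceType)
    (Y : scomplex V) (Yt : scomplex W) (p : W -> V) :=
  simplicial_covering Y Yt p /\ simply_connected R (realization R Yt).

(* Y, with universal cover Yt, is a K(Gamma, 1) *)
Definition is_KGamma1 (R : realType) (Gamma : groupType) (V W : choiceType)
    (Y : scomplex V) (Yt : scomplex W) :=
  [/\ path_connected R (realization R Y),
      exists y0 : realization R Y, pi1_isomorphic R Gamma y0 &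
      contractible R (realization R Yt)].

End SimplicialComplexes.

Section SpectralGap.
Variables (R : realType) (V : choiceType) (Z : scomplex V).

(* (k-1)-simplices with an ordering of their vertices; for k = 0 this is *)
(* the empty simplex, so that the complex below is the augmented one     *)
Definition ord_simplex k : set (k.-tuple V) :=
  [set t | uniq t /\ (k = 0%N \/ Z [fset v in (t : seq V)]%fset)].

Definition tuple_perm k (s : 'S_k) (t : k.-tuple V) : k.-tuple V :=
  [tuple tnth t (s i) | i < k].

Definition tuple_face k (i : 'I_k.+1) (t : k.+1.-tuple V) : k.-tuple V :=
  [tuple tnth t (lift i j) | j < k].

(* The space of (k-1)-cochains C^(k-1)(Z, C), as alternating functions of *)
(* ordered simplices: this amounts to functions on Z^(k-1) for any choice *)
(* of an orientation of each simplex                                      *)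
Definition cochain k : set (k.-tuple V -> R[i]) :=
  [set c | (forall t, ~ ord_simplex t -> c t = 0) /\
           forall s t, c (tuple_perm s t) = (-1) ^+ s * c t].

Definition coboundary k (c : k.-tuple V -> R[i]) (t : k.+1.-tuple V) : R[i] :=
  if `[< ord_simplex t >]
  then \sum_(i < k.+1) (-1) ^+ i * c (tuple_face i t) else 0.

(* Each oriented simplex is counted once by dividing by the number of *)
(* orderings                                                          *)
Definition inner k (c e : k.-tuple V -> R[i]) : R[i] :=
  (k`!)%:R^-1 * \sum_(t \in @ord_simplex k) c t * (e t)^*.

Definition is_adjoint_value k (e : k.+1.-tuple V -> R[i])
    (f : k.-tuple V -> R[i]) :=
  cochain f /\ forall c, cochain c -> inner (coboundary c) e = inner c f.

(* The adjoint d^* of the coboundary map, for finite Z *)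
Definition coboundary_adj k (e : k.+1.-tuple V -> R[i]) : k.-tuple V -> R[i] :=
  xget 0 (is_adjoint_value e).

Definition up_laplacian k (c : k.-tuple V -> R[i]) : k.-tuple V -> R[i] :=
  coboundary_adj (coboundary c).

(* lam is an eigenvalue of the restriction of the self-adjoint operator      *)
(* Delta^+ = d^* d on C^l to the orthogonal complement of d C^(l-1)          *)
Definition gap_eigenvalue l (lam : R) :=
  exists c : l.+1.-tuple V -> R[i],
    [/\ cochain c, c != 0,
        forall b, @cochain l b -> inner c (coboundary b) = 0 &
        up_laplacian c = fun t => lam%:C%C * c t].

(* The infimum over the empty set is +oo *)
Definition spectral_gap l : \bar R :=
  ereal_inf [set lam%:E | lam in gap_eigenvalue l].

End SpectralGap.

Definition spectral_expanders (R : realType) (n : nat) (I : Type)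
    (V : I -> choiceType) (Z : forall i, scomplex (V i)) :=
  [/\ forall i, finite_set (simplices (Z i)),
      exists D : nat, forall i v,
        ([set s | Z i s /\ v \in s] #<= `I_D)%card &
      exists eps : R, 0 < eps /\
        forall i l, (l < n)%N -> (eps%:E <= spectral_gap R (Z i) l)%E].

(* Main.v *)
(* A contraction of |Yt|, sampled at finitely many times on finitely many      *)
(* simplices, gives simplicial approximations f 0, ..., f N with f N constant; *)
(* with iterated barycentric subdivision and carrier homotopies this makes the *)
(* complex of ordered simplices of Yt acyclic, and it trivializes the holonomy *)
(* of Yt -> Y, so that Gamma acts simply transitively on each fibre of p.      *)
(* Hence the cohomology of pi is that of the Gamma-equivariant alternating     *)
(* cochains on Yt. For pi = (+)_i L^2(Lambda_i\Gamma) such a cochain is, up to *)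
(* dimension n, a square-summable family of cochains on the finite complexes   *)
(* Z_i = Lambda_i\X, and both sides of the equivalence say that d has a lower  *)
(* bound, uniform in i, on the orthogonal complement of the image of d.        *)
(* A uniform gap bounds the preimages of a square-summable family. Conversely, *)
(* without a uniform gap, choosing c_m on some Z_i with |c_m|^2 = 2^m and      *)
(* |d c_m|^2 <= 2^-m produces a limit of coboundaries which is no coboundary.  *)

Require Import Defs.
From HB Require Import structures.
From mathcomp Require Import all_boot all_order all_algebra.
From mathcomp Require Import perm finmap complex ring lra.
From mathcomp Require Import all_classical all_reals all_analysis.
From mathcomp Require Import spectral.
Import Order.TTheory GRing.Theory Num.Theory numFieldNormedType.Exports.

Set Implicit Arguments.
Unset Strict Implicit.
Unset Printing Implicit Defensive.

Local Open Scope classical_set_scope.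
Local Open Scope ring_scope.

(** * Simplicial approximation of a contraction *)

(** Both sides of the equivalence amount to one estimate on the finite complexes Z_i = Lambda_i\X:
    some e > 0 satisfies e |c|^2 <= |d c|^2 for all i, all degrees l < n and all cochains c of Z_i
    orthogonal to the image of d ([perp_im]). By [gap_ineq] and [ineq_gap] this is the uniform
    spectral gap, up to a factor l + 2 that is harmless because l < n.

    The cohomological side is first moved from an arbitrary free resolution to cochains on Yt.
    Contractibility of |Yt| becomes combinatorial in [discretize], which replaces a contraction by
    finitely many vertex-valued maps, consecutive ones lying in common simplices. Two consequences
    follow: every cycle of ordered simplices bounds ([ordered_acyclic]), and transport of lifts
    along closed edge paths is trivial ([holonomy]), so that Gamma acts simply transitively on the
    fibres of p ([act_free], [act_transitive]). Hence the ordered simplices of Yt form a free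
    resolution [ores]. Comparison maps between resolutions respect pointwise approximation, so
    neither vanishing nor reducedness depends on the resolution. Antisymmetrization is a chain map,
    hence homotopic to the identity, and cohomology is computed by equivariant alternating cochains
    ([cohomology_eq0_cochain], [cohomology_reduced_cochain]).

    For the direct sum of the L^2(Lambda_i\Gamma), evaluation at trivial cosets ([desc]) turns an
    equivariant cochain of degree at most n into a family of cochains on the Z_i with summable
    squared norms, and [mk_ecochain] inverts this. Only finitely many orbits of simplices occur, so
    the norms on both sides are comparable uniformly in i.

    Given a gap, each Z_i-component of a cocycle (or of a limit of coboundaries in degree n) is a
    coboundary; the preimage orthogonal to the image of d has controlled norm, so the preimages
    assemble ([lift_cob], [gap_exact], [gap_closed]). Conversely, vanishing makes d injective on
    [perp_im] ([exact_inj]; in degree 0 connectedness does it, [perp_inj0]), and closedness turns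
    summability of |d x_i|^2 into summability of |x_i|^2 ([cochain_closed_bounded]). Without a
    uniform gap, cochains with |c|^2 = 2^m and |d c|^2 <= 2^-m would violate this ([closed_gap]). *)

Section ContinuousFamilies.
Variables (R : realType) (W : choiceType) (T : topologicalType) (F : W -> T -> R).
Hypothesis F_cont : forall w, continuous (F w).

Lemma nbhs_box x (e : R) (U : seq W) : 0 < e ->
  \forall y \near x, forall w, w \in U -> `|F w y - F w x| < e.
Proof.
move=> e0; elim: U => [|w U IH]; first exact: nearW.
have h : \forall y \near x, `|F w y - F w x| < e.
  by have /cvgr_distC_lt := @F_cont w x; apply.
near=> y => v; rewrite inE => /orP[/eqP->|vU]; first by near: y.
by move: v vU; near: y.
Unshelve. all: by end_near. Qed.

Lemma sum_continuous (U : seq W) : continuous (fun x => \sum_(w <- U) F w x).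
Proof.
elim: U => [|w U IH] x.
  rewrite (_ : (fun _ => _) = fun=> 0); first exact: cvg_cst.
  by apply/funext => y; rewrite big_nil.
rewrite (_ : (fun _ => _) = (fun y => F w y + \sum_(v <- U) F v y)).
  by apply: cvgD; [exact: F_cont|exact: IH].
by apply/funext => y; rewrite big_cons.
Qed.

End ContinuousFamilies.

Section PointwiseTopology.
Variables (R : realType) (W : choiceType).
Implicit Types (x y : {ptws W -> R}).

(** The filter [G] of sup-distance balls around x converges to x coordinate by coordinate, so it is
    finer than the neighbourhood filter of the product topology. *)
Lemma ptws_open_supball (O : set {ptws W -> R}) x : open O -> O x ->
  exists2 e : R, 0 < e & forall y, (forall w, `|y w - x w| < e) -> O y.
Proof.
move=> oO Ox.
pose G := filter_from [set e : R | 0 < e]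
  (fun e => [set y : {ptws W -> R} | forall w, `|y w - x w| < e]).
have FG : Filter G.
  apply: filter_from_filter; first by exists 1 => /=.
  move=> e1 e2 /= e10 e20; exists (Num.min e1 e2).
    by rewrite /= lt_min e10.
  by move=> y /= h; split=> w; have := h w; rewrite lt_min => /andP[].
have Gx : G --> x.
  apply/cvg_sup => w U [V] [[A oA <-] Aw] VU.
  have : nbhs (x w) A by exact: open_nbhs_nbhs.
  move=> /nbhs_ballP[e e0 eA]; exists e => // y /= h.
  by apply: VU; apply: eA; rewrite /ball/= distrC; exact: h.
have : nbhs x O by exact: open_nbhs_nbhs.
by move=> /Gx [e e0 eO]; exists e => // y h; exact: eO.
Qed.

Lemma ptws_nbhs_box x (e : R) (U : seq W) : 0 < e ->
  \forall y \near x, forall w, w \in U -> `|y w - x w| < e.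
Proof.
move=> e0; apply: (@nbhs_box R W {ptws W -> R} (fun w y => y w)) => // w.
exact: (@proj_continuous W (fun=> R) w).
Qed.

Definition in_spx (s : {fset W}) (x : W -> R) :=
  [/\ forall w, 0 <= x w, forall w, w \notin s -> x w = 0 &
      \sum_(w <- s) x w = 1].

Lemma in_spx_le1 (s : {fset W}) (x : W -> R) : in_spx s x -> forall w, x w <= 1.
Proof.
move=> [x0 xs x1] w; have [ws|/xs->//] := boolP (w \in s).
by rewrite -x1 (big_fsetD1 w)//= lerDl sumr_ge0.
Qed.

Lemma in_spx_compact (s : {fset W}) :
  compact ([set x | in_spx s x] : set {ptws W -> R}).
Proof.
pose A w : set R := if w \in s then [set` `[0%R, 1%R]] else [set 0].
have cA : compact ([set x | forall w, A w (x w)] : set {ptws W -> R}).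
  apply: tychonoff => w; rewrite /A; case: ifP => _.
    exact: segment_compact.
  exact: compact_set1.
have -> : [set x | in_spx s x] =
    [set x | forall w, A w (x w)] `&`
    [set x : {ptws W -> R} | \sum_(w <- s) x w = 1].
  apply/seteqP; split=> [x /= xs|x [/= xA x1]].
    split; last by case: xs.
    move=> w; rewrite /A; have x01 := in_spx_le1 xs w; case: xs => x0 xs _.
    case: ifPn => ws; last by rewrite /= xs.
    by rewrite /= in_itv /= x0.
  split=> // [w|w ws].
    have := xA w; rewrite /A; case: ifP => _ /=; last by move->.
    by rewrite in_itv/= => /andP[].
  by have := xA w; rewrite /A (negbTE ws).
apply: compact_closedI => //.
apply: (@closed_comp _ R (fun x : {ptws W -> R} => \sum_(w <- s) x w) [set 1]).
  move=> x _; apply: (@sum_continuous R W {ptws W -> R} (fun w y => y w)) => w.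
  exact: (@proj_continuous W (fun=> R) w).
exact: closed_eq.
Qed.

End PointwiseTopology.

Section Discretization.
Variables (R : realType) (W : choiceType) (K : scomplex W).

Lemma realization_of_spx (s : {fset W}) (x : W -> R) : K s -> in_spx s x ->
  exists r : realization R K, bary r = x.
Proof.
move=> Ks [x0 xs x1]; pose s' := [fset w in s | x w != 0]%fset.
have sE : \sum_(v <- s') x v = 1.
  rewrite -x1; apply: big_fset_incl; first by apply/fsubsetP => w; rewrite !inE => /andP[].
  by move=> w ws; rewrite !inE ws/= negbK => /eqP.
have s'0 : s' != fset0.
  by apply/eqP => s'0; move: sE; rewrite s'0 big_seq_fset0 => /eqP; rewrite eq_sym oner_eq0.
have Ks' : K s'.
  by apply: sc_sub Ks _ s'0; apply/fsubsetP => w; rewrite !inE => /andP[].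
have xP : exists2 s, K s & (forall v, (v \in s) = (x v != 0)) /\ \sum_(v <- s) x v = 1.
  exists s' => //; split=> // v; rewrite !inE; case: (boolP (v \in s)) => //= vs.
  by rewrite xs ?eqxx.
by exists (Realization x0 xP).
Qed.

Lemma realization_inj (r r' : realization R K) : bary r = bary r' -> r = r'.
Proof.
case: r r' => [x x0 xs] [y y0 ys] /= xy; case: _ / xy in y0 ys *.
by rewrite (Prop_irrelevance x0 y0) (Prop_irrelevance xs ys).
Qed.

Lemma realization_supp_neq0 (r : realization R K) : exists v, 0 < r v.
Proof.
case: r => x x0 [s Ks [sx _]] /=; have /fset0Pn[v vs] := sc_neq0 Ks.
by exists v; rewrite lt_def x0 andbT -sx.
Qed.

Lemma realization_supp_simplex (r : realization R K) :
  exists2 s, K s & forall v, 0 < r v -> v \in s.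
Proof.
case: r => x x0 [s Ks [sx _]] /=; exists s => // v; rewrite lt_def => /andP[v0 _].
by rewrite sx.
Qed.

Lemma open_star v : open [set r : realization R K | 0 < r v].
Proof.
move=> s Ks; exists ([set x : {ptws W -> R} | 0 < x v]) => //.
apply: (@open_comp _ _ (fun x : {ptws W -> R} => x v) [set y | 0 < y]).
  by move=> x _; exact: (@proj_continuous W (fun=> R) v).
exact: open_gt.
Qed.

Lemma seq_pos_min (T : eqType) (S : seq T) (Q : T -> R -> Prop) :
  (forall s e e', Q s e -> e' <= e -> Q s e') ->
  (forall s, s \in S -> exists2 e, 0 < e & Q s e) ->
  exists2 e, 0 < e & forall s, s \in S -> Q s e.
Proof.
move=> Qd; elim: S => [|a S IH] h; first by exists 1.
have [|e e0 eP] := IH; first by move=> s sS; apply: h; rewrite inE sS orbT.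
have [e' e'0 e'P] := h a (mem_head _ _).
exists (Num.min e e'); first by rewrite lt_min e0.
move=> s; rewrite inE => /orP[/eqP ->|sS].
  by apply: Qd e'P _; rewrite ge_min lexx orbT.
by apply: Qd (eP s sS) _; rewrite ge_min lexx.
Qed.

Lemma spx_list_compact (S : seq {fset W}) :
  compact ([set x | exists2 s, s \in S & in_spx s x] : set {ptws W -> R}).
Proof.
elim: S => [|s S IH].
  rewrite (_ : [set x | _] = set0); first exact: compact0.
  by apply/seteqP; split=> // x [].
rewrite (_ : [set x | _] = [set x | in_spx s x] `|`
   [set x | exists2 s, s \in S & in_spx s x]).
  by apply: compactU => //; exact: in_spx_compact.
apply/seteqP; split=> x /=.
  move=> [t]; rewrite inE => /orP[/eqP ->|tS] tx; first by left.
  by right; exists t.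
by case=> [sx|[t tS tx]]; [exists s; rewrite ?mem_head|exists t; rewrite // inE tS orbT].
Qed.

(** On a finite union of closed simplices a weak neighbourhood contains a sup-distance one. For each
    s in [S] either x lies in |s|, where the trace of [O] is open in R^W, or x has a positive
    coordinate at some w outside s, and then every point of |s| is at distance at least x w. *)
Lemma spx_nbhs_realization (S : seq {fset W})
    (O : set (realization R K)) (x : W -> R) :
  (forall s, s \in S -> K s) -> (exists2 s, s \in S & in_spx s x) ->
  open O -> (forall r : realization R K, bary r = x -> O r) ->
  exists2 e : R, 0 < e & forall (r : realization R K),
    (exists2 s, s \in S & in_spx s r) -> (forall w, `|r w - x w| < e) -> O r.
Proof.
move=> SK [s0 s0S s0x] oO Ox.
suff [e e0 eP] : exists2 e : R, 0 < e & forall s, s \in S ->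
    forall r : realization R K, in_spx s r -> (forall w, `|r w - x w| < e) -> O r.
  by exists e => // r [s sS sr]; exact: (eP s).
apply: (@seq_pos_min _ S (fun s e => forall r : realization R K,
    in_spx s r -> (forall w, `|r w - x w| < e) -> O r)).
- by move=> s e e' h ee' r sr rx; apply: h => // w; exact: lt_le_trans (rx w) ee'.
- move=> s sS; have [sx|sx] := pselect (in_spx s x).
    have [Q oQ QO] := oO s (SK _ sS).
    have [r rx] := realization_of_spx (SK _ sS) sx.
    have supp_s (r' : realization R K) : in_spx s r' ->
        forall v, r' v != 0 -> v \in s.
      by move=> [_ rs _] v; apply: contra_neqT => /rs.
    have Qx : Q x.
      by rewrite -rx; apply/QO; [apply: supp_s; rewrite rx|exact: Ox].
    have [e e0 eQ] := ptws_open_supball oQ Qx.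
    exists e => // r' sr' r'x; apply/QO; first exact: supp_s.
    exact: eQ.
  have [w ws xw] : exists2 w, w \notin s & 0 < x w.
    apply: contrapT => nw; apply: sx; case: s0x => x0 xs0 x1.
    have xs w : w \notin s -> x w = 0.
      move=> ws; apply/eqP; rewrite eq_le x0 andbT leNgt.
      by apply/negP => xw; apply: nw; exists w.
    split=> //; rewrite -x1.
    transitivity (\sum_(w <- (s `|` s0)%fset) x w).
      by apply: big_fset_incl; [exact: fsubsetUl|move=> w _ /xs].
    by apply/esym/big_fset_incl; [exact: fsubsetUr|move=> w _ /xs0].
  exists (x w) => // r [_ /(_ w ws) rw _] /(_ w).
  by rewrite rw sub0r normrN gtr0_norm ?ltxx.
Qed.

(** A Lebesgue number for the cover of (finite union of simplices) x [0, 1] by the preimages under h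
    of the open stars of vertices. *)
Lemma lebesgue_star (x0 : realization R K) (h : realization R K * R -> realization R K)
    (S : seq {fset W}) :
  {within [set: realization R K] `*` `[0, 1], continuous h} ->
  (forall s, s \in S -> K s) ->
  exists2 d : R, 0 < d & forall (x : W -> R) t,
    (exists2 s, s \in S & in_spx s x) -> 0 <= t <= 1 ->
    exists v, forall (r : realization R K) t',
      (exists2 s, s \in S & in_spx s r) -> 0 <= t' <= 1 ->
      (forall w, `|r w - x w| < d) -> `|t' - t| < d -> 0 < h (r, t') v.
Proof.
move=> hc SK.
pose A : set {ptws W -> R} := [set x | exists2 s, s \in S & in_spx s x].
have cA : compact A by exact: spx_list_compact.
have cAI : compact (A `*` [set` `[0%R, 1%R]] : set ({ptws W -> R} * R)%type).
  by apply: compact_setX => //; exact: segment_compact.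
pose P (d : R) (xt : ({ptws W -> R} * R)%type) := exists v,
  forall (r : realization R K) t',
      (exists2 s, s \in S & in_spx s r) -> 0 <= t' <= 1 ->
      (forall w, `|r w - xt.1 w| < d) -> `|t' - xt.2| < d -> 0 < h (r, t') v.
have /compact_near_coveringP/near_covering_withinP cov := cAI.
(* [F] is the filter of positive radii tending to 0; the near-covering form of compactness then
   produces one radius valid everywhere. *)
pose F := filter_from [set e : R | 0 < e]
  (fun e => [set d : R | 0 < d /\ d <= e]).
have FF : Filter F.
  apply: filter_from_filter; first by exists 1 => /=.
  move=> e1 e2 /= e10 e20; exists (Num.min e1 e2); first by rewrite /= lt_min e10.
  by move=> y /= []; rewrite le_min => y0 /andP[].
suff H : forall x : ({ptws W -> R} * R)%type, (A `*` [set` `[0%R, 1%R]]) x ->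
    \forall x' \near x & i \near F, (A `*` [set` `[0%R, 1%R]]) x' -> P i x'.
  have [d /= d0 dP] := cov R F P FF H.
  exists d => // x t Ax t01; apply: (dP d _ (x, t)); rewrite //= ?lexx//.
move=> [x t] [/= Ax]; rewrite in_itv/= => t01.
have [s sS sx] := Ax; have [rx rxE] := realization_of_spx (SK s sS) sx.
have [v hv] := realization_supp_neq0 (h (rx, t)).
have /subspace_continuousP hc' := hc.
have hn : nbhs (h (rx, t)) [set r : realization R K | 0 < r v].
  by apply: open_nbhs_nbhs; split => //; exact: open_star.
have [|[Q1 Q2] /= [nQ1 nQ2] QQ] := hc' (rx, t) _ _ hn.
  by split; rewrite //= in_itv.
move: nQ1; rewrite nbhsE => -[ O [oO Ox] OQ1].
have [||e1 e10 e1P] := @spx_nbhs_realization S O x SK _ oO.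
- by exists s.
- by move=> r rx'; rewrite -(_ : rx = r)//; apply: realization_inj; rewrite rxE rx'.
have /nbhs_ballP[e2 /= e20 e2P] := nQ2.
(* Halving leaves room for two displacements: from the tested point to x', and from x' to x. *)
pose e := Num.min (e1 / 2) (e2 / 2).
have e0 : 0 < e by rewrite lt_min !divr_gt0.
have ee1 : e + e <= e1 by rewrite (splitr e1) lerD// ge_min lexx.
have ee2 : e + e <= e2 by rewrite (splitr e2) lerD// ge_min lexx orbT.
(* Outside the finite set [U] all points considered have zero coordinates, so a finite box in the
   product topology controls the sup distance. *)
pose U : seq W := flatten [seq enum_fset s | s <- S].
exists ([set xt : ({ptws W -> R} * R)%type |
           (forall w, w \in U -> `|xt.1 w - x w| < e) /\ `|xt.2 - t| < e],
        [set d : R | 0 < d /\ d <= e]); first split => /=.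
- exists ([set y : {ptws W -> R} | forall w, w \in U -> `|y w - x w| < e],
      [set t' : R | `|t' - t| < e]); last by move=> [a b].
  split => /=; first exact: ptws_nbhs_box.
  by apply/nbhs_ballP; exists e => // y; rewrite /ball/= distrC.
- by exists e.
move=> [[x' t'] d] /= [[x'x t't] [d0 de]] [Ax' t'01].
exists v => r t'' Ar t''01 rx' t''t' /=.
have xU y : A y -> forall w, w \notin U -> y w = 0.
  move=> [s' s'S [_ ys _]] w wU; apply: ys; apply: contra wU => ws.
  by apply/flattenP; exists (enum_fset s') => //; exact: map_f.
apply: (QQ (r, t'')); last by split; rewrite //= in_itv.
split => /=.
  apply: OQ1; apply: e1P => // w; apply: lt_le_trans ee1.
  rewrite -(subrKA (x' w)); apply: le_lt_trans (ler_normD _ _) _.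
  apply: ltrD; first exact: lt_le_trans (rx' w) de.
  have [wU|wU] := boolP (w \in U); first exact: x'x.
  by rewrite (xU x')// (xU x)// subrr normr0.
apply: e2P; rewrite /ball/= distrC; apply: lt_le_trans ee2.
rewrite -(subrKA t'); apply: le_lt_trans (ler_normD _ _) _.
by apply: ltrD => //; exact: lt_le_trans t''t' de.
Qed.

(* f j sends x to a vertex whose open star contains h (r, j/N) for all r near x. *)
Lemma discretize (S : seq {fset W}) : contractible R (realization R K) ->
  (forall s, s \in S -> K s) ->
  exists (d : R) (N : nat) (f : nat -> (W -> R) -> W) (v0 : W),
  [/\ 0 < d,
      forall s x, s \in S -> in_spx s x -> 0 < x (f 0%N x),
      forall j s (X : seq (W -> R)), s \in S ->
        (forall x, x \in X -> in_spx s x) ->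
        (forall x y, x \in X -> y \in X -> forall w, `|x w - y w| < d) ->
        exists2 t, K t & forall x, x \in X -> f j x \in t /\ f j.+1 x \in t &
      forall x, f N x = v0].
Proof.
move=> [x0 [h [hc h0 h1]]] SK.
have [d d0 dP] := lebesgue_star x0 hc SK.
have [v0 v0P] := realization_supp_neq0 x0.
have [N [N0 Nd]] : exists N : nat, 0 < N%:R :> R /\ (N%:R)^-1 < d.
  exists (Num.truncn d^-1).+1; split; first by rewrite ltr0n.
  by rewrite -[ltRHS]invrK ltf_pV2 ?posrE ?invr_gt0 ?ltr0n// truncnS_gt.
pose star j x v := forall (r : realization R K) t',
      (exists2 s, s \in S & in_spx s r) -> 0 <= t' <= 1 ->
      (forall w, `|r w - x w| < d) -> `|t' - j%:R / N%:R| < d -> 0 < h (r, t') v.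
(* From time N on the value is [v0], a vertex of the support of the end point of the contraction;
   this keeps the passage from stage N - 1 to stage N inside one simplex. *)
pose f j x := if (j < N)%N then xget v0 (star j x) else v0.
have jN01 j : (j <= N)%N -> 0 <= (j%:R / N%:R : R) <= 1.
  by move=> jN; rewrite divr_ge0//= ler_pdivrMr// mul1r ler_nat.
have fP j x : (j < N)%N -> (exists2 s, s \in S & in_spx s x) -> star j x (f j x).
  move=> jN Ax; rewrite /f jN; apply: xgetPex; apply: dP => //.
  by apply: jN01; exact: ltnW.
exists d, N, f, v0; split=> //.
- move=> s x sS sx; have [r rx] := realization_of_spx (SK s sS) sx.
  have N0' : (0 < N)%N by rewrite -(ltr0n R).
  (* At time 0 the homotopy is the identity, so [f 0] selects a vertex of the support of x
     itself. *)
  have := fP 0%N x N0' (ex_intro2 _ _ s sS sx) r 0.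
  rewrite h0 rx mul0r subrr normr0 => H; apply: H => //.
  + by exists s.
  + by rewrite lexx ler01.
  + by move=> w; rewrite subrr normr0.
- move=> j s [|x X] sS Xs Xd.
    by exists [fset v0]%fset => //; exact: sc_vertex.
  have sx := Xs x (mem_head _ _); have [r rx] := realization_of_spx (SK s sS) sx.
  have rS : exists2 s, s \in S & in_spx s r by rewrite rx; exists s.
  have [jN|jN] := ltnP j N; last first.
    exists [fset v0]%fset; first exact: sc_vertex.
    by move=> y _; rewrite /f !ltnNge jN (leqW jN)/= !inE eqxx.
  (* The single point h (r, (j + 1)/N) lies in all the stars involved, at both stages j and j + 1;
     hence all these vertices belong to its support. *)
  have [t Kt tP] := realization_supp_simplex (h (r, j.+1%:R / N%:R)).
  exists t => // y yX; have Ay : exists2 s, s \in S & in_spx s y by exists s => //; exact: Xs.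
  have ry w : `|r w - y w| < d by rewrite rx; apply: Xd; rewrite ?mem_head.
  split; apply: tP.
    apply: (fP j y jN Ay) => //; first exact: jN01.
    by rewrite -mulrBl -natrB// subSnn mul1r gtr0_norm// invr_gt0.
  have [jN'|jN'] := ltnP j.+1 N.
    by apply: (fP j.+1 y jN' Ay) => //; [exact: jN01|rewrite subrr normr0].
  have -> : j.+1 = N by apply/eqP; rewrite eqn_leq jN' andbT.
  by rewrite divff ?gt_eqF// h1 /f ltnn.
- by move=> x; rewrite /f ltnn.
Qed.

End Discretization.

(** * Acyclicity of ordered simplices *)

Section FormalSums.
Variable C : comNzRingType.

(* Formal sums are compared only through their pairings ev z phi with functions *)
(* phi, so that no quotient is needed.                                         *)
Definition fsum (X : Type) := seq (C * X).

Section Ev.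
Variables (X : Type) (N : lmodType C).
Implicit Types (z : fsum X) (phi : X -> N).

Definition ev z phi : N := \sum_(p <- z) p.1 *: phi p.2.

Lemma ev_nil phi : ev [::] phi = 0.
Proof. exact: big_nil. Qed.

Lemma ev_cons p z phi : ev (p :: z) phi = p.1 *: phi p.2 + ev z phi.
Proof. exact: big_cons. Qed.

Lemma ev_one x phi : ev [:: (1, x)] phi = phi x.
Proof. by rewrite ev_cons ev_nil addr0 scale1r. Qed.

Lemma ev_cat z1 z2 phi : ev (z1 ++ z2) phi = ev z1 phi + ev z2 phi.
Proof. exact: big_cat. Qed.

Lemma evD z phi psi : ev z (fun x => phi x + psi x) = ev z phi + ev z psi.
Proof. by rewrite -big_split; apply: eq_bigr => p _; rewrite scalerDr. Qed.

Lemma evB z phi psi : ev z (fun x => phi x - psi x) = ev z phi - ev z psi.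
Proof.
by rewrite -sumrB; apply: eq_bigr => p _; rewrite scalerBr.
Qed.

End Ev.

Definition fs_scale (X : Type) (a : C) (z : fsum X) : fsum X :=
  [seq (a * p.1, p.2) | p <- z].

Definition fs_map (X Y : Type) (f : X -> Y) (z : fsum X) : fsum Y :=
  [seq (p.1, f p.2) | p <- z].

Definition fs_bind (X Y : Type) (z : fsum X) (s : X -> fsum Y) : fsum Y :=
  flatten [seq fs_scale p.1 (s p.2) | p <- z].

Arguments fs_scale : simpl never.
Arguments fs_map : simpl never.
Arguments fs_bind : simpl never.

Lemma ev_scale (X : Type) (N : lmodType C) a (z : fsum X) (phi : X -> N) : ev (fs_scale a z) phi = a *: ev z phi.
Proof.
rewrite /ev big_map scaler_sumr; apply: eq_bigr => p _ /=.
by rewrite scalerA.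
Qed.

Section EvOps.
Variables (X Y : Type) (N : lmodType C).

Lemma ev_map (f : X -> Y) (z : fsum X) (phi : Y -> N) :
  ev (fs_map f z) phi = ev z (fun x => phi (f x)).
Proof. by rewrite /ev big_map. Qed.

Lemma ev_bind (z : fsum X) (s : X -> fsum Y) (phi : Y -> N) :
  ev (fs_bind z s) phi = ev z (fun x => ev (s x) phi).
Proof.
rewrite /fs_bind; elim: z => [|p z IH]; first by rewrite !ev_nil.
by rewrite /= ev_cat IH ev_cons ev_scale.
Qed.

End EvOps.

Lemma eq_ev (X : eqType) (N : lmodType C) (z : fsum X) (phi psi : X -> N) :
  (forall p, p \in z -> phi p.2 = psi p.2) -> ev z phi = ev z psi.
Proof. by move=> h; apply: eq_big_seq => p pz; rewrite h. Qed.

Lemma mem_fs_bind (X Y : eqType) (z : fsum X) (s : X -> fsum Y) q :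
  q \in fs_bind z s -> exists2 p, p \in z & exists2 q', q' \in s p.2 & q.2 = q'.2.
Proof.
move=> /flattenP[l /mapP[p pz ->]] /mapP[q' q's ->]; exists p => //.
by exists q'.
Qed.

(* D phi (x_0 .. x_q) = sum_i (-1)^i phi (.. omit x_i ..); on singletons this *)
(* is phi [::], so that the resulting complexes are augmented.                *)
Section Differential.
Variables (X : Type) (N : zmodType).

Fixpoint D (phi : seq X -> N) (t : seq X) : N :=
  if t is x :: t' then phi t' - D (fun u => phi (x :: u)) t' else 0.

End Differential.

Fixpoint bd (X : Type) (t : seq X) : fsum (seq X) :=
  if t is x :: t' then (1, t') :: fs_scale (- 1) (fs_map (cons x) (bd t'))
  else [::].

Section D.
Variable (X : Type).

Lemma ev_bd (N : lmodType C) (phi : seq X -> N) t : ev (bd t) phi = D phi t.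
Proof.
elim: t phi => [|x t IH] phi /=; first exact: ev_nil.
by rewrite ev_cons scale1r ev_scale ev_map IH scaleN1r.
Qed.

Variable N : zmodType.
Implicit Types (phi psi : seq X -> N).

Lemma DB phi psi t : D (fun u => phi u - psi u) t = D phi t - D psi t.
Proof.
elim: t phi psi => [|x t IH] phi psi /=; first by rewrite subr0.
rewrite IH !opprB addrACA [RHS]addrACA; congr (_ + _); exact: addrC.
Qed.

Lemma DD phi t : D (D phi) t = 0.
Proof.
elim: t phi => [//|x t IH] phi /=.
by rewrite DB IH subr0 subrr.
Qed.

Lemma D_map (Y : Type) (f : Y -> X) phi t :
  D phi (map f t) = D (fun u => phi (map f u)) t.
Proof. by elim: t phi => [//|y t IH] phi /=; rewrite IH. Qed.

End D.

Lemma D_ext (X : eqType) (N : zmodType) (phi psi : seq X -> N) t :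
  (forall u, subseq u t -> (size u).+1 = size t -> phi u = psi u) ->
  D phi t = D psi t.
Proof.
elim: t phi psi => [//|x t IH] phi psi h /=; congr (_ - _).
  by apply: h => //; exact: subseq_cons.
by apply: IH => u ut su; apply: h; rewrite /= ?eqxx ?su.
Qed.

Lemma D_ev (X : Type) (Y : Type) (N : lmodType C) (s : seq X -> fsum Y)
  (phi : Y -> N) t : D (fun u => ev (s u) phi) t = ev (fs_bind (bd t) s) phi.
Proof. by rewrite ev_bind ev_bd. Qed.

Lemma mem_bd (X : eqType) (t : seq X) p : p \in bd t ->
  subseq p.2 t /\ (size p.2).+1 = size t.
Proof.
elim: t p => [//|x t IH] p /=; rewrite inE => /orP[/eqP ->/=|].
  by split=> //; exact: subseq_cons.
move=> /mapP[q /mapP[q' /IH[q't sq'] ->] ->] /=.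
by rewrite eqxx sq'.
Qed.

Definition fs_good (X : eqType) (n : nat) (P : X -> Prop) (z : fsum (seq X)) :=
  forall p, p \in z -> size p.2 = n /\ forall x, x \in p.2 -> P x.

Section Good.
Variables (X : eqType) (n : nat) (P : X -> Prop).

Lemma fs_good_cat z1 z2 : fs_good n P z1 -> fs_good n P z2 -> fs_good n P (z1 ++ z2).
Proof. by move=> h1 h2 p; rewrite mem_cat => /orP[/h1|/h2]. Qed.

Lemma fs_good_scale a z : fs_good n P z -> fs_good n P (fs_scale a z).
Proof. by move=> h _ /mapP[p /h ph ->]. Qed.

Lemma fs_good_bind (Y : eqType) (z : fsum Y) s :
  (forall p, p \in z -> fs_good n P (s p.2)) -> fs_good n P (fs_bind z s).
Proof.
by move=> h q /mem_fs_bind[p /h pz [q' /pz]] [sq' Pq'] ->.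
Qed.

Lemma fs_good_cone a z : P a -> fs_good n P z -> fs_good n.+1 P (fs_map (cons a) z).
Proof.
move=> Pa h _ /mapP[p /h [sp Pp] ->] /=; rewrite sp; split=> // x.
by rewrite inE => /orP[/eqP->|/Pp].
Qed.

End Good.

Lemma fs_good_sub (X : eqType) n (P P' : X -> Prop) z :
  (forall x, P x -> P' x) -> fs_good n P z -> fs_good n P' z.
Proof. by move=> PP' h p /h[sp Pp]; split=> // x /Pp /PP'. Qed.

(** * Chain homotopies from cone-shaped carriers *)

Section Carrier.
Variables (X Y : eqType).
Variables (Q : seq X -> Prop) (car : seq X -> Y -> Prop) (a : seq X -> Y).
Variables (th th' : seq X -> fsum (seq Y)).
Hypothesis Q_sub : forall u v, subseq u v -> Q v -> Q u.
Hypothesis car_sub : forall u v y, subseq u v -> car u y -> car v y.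
Hypothesis car_a : forall u, u != [::] -> Q u -> car u (a u).
Hypothesis th_good : forall u, Q u -> fs_good (size u) (car u) (th u).
Hypothesis th'_good : forall u, Q u -> fs_good (size u) (car u) (th' u).
Hypothesis th_chain : forall (N : lmodType C) (phi : seq Y -> N) u, Q u ->
  ev (th u) (D phi) = D (fun v => ev (th v) phi) u.
Hypothesis th'_chain : forall (N : lmodType C) (phi : seq Y -> N) u, Q u ->
  ev (th' u) (D phi) = D (fun v => ev (th' v) phi) u.
Hypothesis th_nil : forall (N : lmodType C) (phi : seq Y -> N),
  ev (th' [::]) phi = ev (th [::]) phi.

(* Cones th' u - th u - htpy (bd u) off the apex a u of the carrier of u. *)
Fixpoint carrier_htpy_rec n (u : seq X) : fsum (seq Y) :=
  if n is n'.+1 then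
    fs_map (cons (a u)) (th' u ++ fs_scale (- 1) (th u) ++
      fs_scale (- 1) (fs_bind (bd u) (carrier_htpy_rec n')))
  else [::].

Definition carrier_htpy u := carrier_htpy_rec (size u) u.

(** By induction on size, th' u - th u - htpy (bd u) is a cycle. For a cycle z and apex a, pairing a
    :: z with D phi gives z paired with phi, minus z paired with D (phi (a :: _)), which is zero; so
    the cone bounds z. The carrier contains the apex, so the homotopy stays in it. *)
Lemma carrier_htpyP u : Q u ->
  fs_good (size u).+1 (car u) (carrier_htpy u) /\
  forall (N : lmodType C) (phi : seq Y -> N),
    ev (th' u) phi - ev (th u) phi =
    ev (carrier_htpy u) (D phi) + D (fun v => ev (carrier_htpy v) phi) u.
Proof.
have [n sn] := ubnP (size u); elim: n => // n IH in u sn *; move=> Qu.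
case: u sn Qu => [|x u] sn Qu.
  split=> // N phi; rewrite th_nil subrr /carrier_htpy /= ev_nil addr0.
  by [].
set t := x :: u; have IHf v : subseq v t -> (size v).+1 = size t -> _ :=
  fun vt sv => IH v (leq_trans (eq_leq sv) sn) (Q_sub vt Qu).
have TE : carrier_htpy t = fs_map (cons (a t)) (th' t ++ fs_scale (- 1) (th t) ++
      fs_scale (- 1) (fs_bind (bd t) (carrier_htpy_rec (size u)))) by [].
have DT (N : lmodType C) (phi : seq Y -> N) :
    ev (fs_bind (bd t) (carrier_htpy_rec (size u))) phi =
    D (fun v => ev (carrier_htpy v) phi) t.
  rewrite -D_ev; apply: D_ext => v vt [sv].
  by rewrite /carrier_htpy sv.
split.
  rewrite TE; apply: fs_good_cone; first exact: car_a.
  apply: fs_good_cat; first exact: th'_good.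
  apply: fs_good_cat; apply: fs_good_scale; first exact: th_good.
  apply: fs_good_bind => p /mem_bd[pt sp]; rewrite -[size u](_ : size p.2 = _).
    have := (IHf _ pt sp).1; rewrite sp; apply: fs_good_sub => y.
    exact: car_sub.
  by case: sp.
move=> N phi; set psi := fun v => phi (a t :: v).
(* The boundary of the homotopy on the faces of t: the induction hypothesis on each face, with the
   double boundary killed by [DD]. *)
have E (chi : seq Y -> N) : D (fun v => ev (carrier_htpy v) (D chi)) t =
    D (fun v => ev (th' v) chi) t - D (fun v => ev (th v) chi) t.
  rewrite -DB -[RHS]subr0 -(DD (fun v => ev (carrier_htpy v) chi) t) -DB.
  apply: D_ext => v vt sv.
  by rewrite (IHf v vt sv).2 addrK.
have Z : ev (th' t) (D psi) + (- ev (th t) (D psi) -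
    D (fun v => ev (carrier_htpy v) (D psi)) t) = 0.
  by rewrite E th_chain// th'_chain// opprB addKr subrr.
move: (DT N phi) (DT N (D psi)) Z; set F := D _ t; set G := D _ t => FE GE Z.
rewrite {1}TE ev_map /=.
rewrite (_ : (fun _ => _) = (fun v => phi v - D psi v))//.
rewrite evB !ev_cat !ev_scale FE GE !scaleN1r Z subr0.
by rewrite -addrA subrK.
Qed.

End Carrier.

(** * Barycentric subdivision of ordered simplices and its mesh *)

Section Subdivision.
Variables (R : realType) (W : choiceType).
Implicit Types (t u : seq (W -> R)).

Definition barycenter t : W -> R := fun w => (\sum_(x <- t) x w) / (size t)%:R.

(** Subdivision as the cone from the barycenter over the subdivided boundary, with the size of t as
    fuel. The empty tuple subdivides to itself because the complex is augmented. *)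
Fixpoint sd_rec n t : fsum (seq (W -> R)) :=
  if n is n'.+1 then fs_map (cons (barycenter t)) (fs_bind (bd t) (sd_rec n'))
  else [:: (1, t)].

Definition sd t := sd_rec (size t) t.

Lemma sd_cons x t : sd (x :: t) =
  fs_map (cons (barycenter (x :: t))) (fs_bind (bd (x :: t)) (sd_rec (size t))).
Proof. by []. Qed.

Lemma sd_D (N : lmodType C) (phi : seq (W -> R) -> N) x t :
  ev (sd (x :: t)) phi = D (fun v => ev (sd v) (fun u => phi (barycenter (x :: t) :: u))) (x :: t).
Proof.
rewrite sd_cons ev_map -D_ev; apply: D_ext => v vt [sv].
by rewrite /sd sv.
Qed.

Lemma sd_chain (N : lmodType C) (phi : seq (W -> R) -> N) t :
  ev (sd t) (D phi) = D (fun v => ev (sd v) phi) t.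
Proof.
have [n sn] := ubnP (size t); elim: n => // n IH in t sn phi *.
case: t sn => [|x t] sn; first exact: ev_one.
rewrite sd_D; set b := barycenter _.
transitivity (D (fun v => ev (sd v) phi - ev (sd v) (D (fun u => phi (b :: u)))) (x :: t)).
  by apply: D_ext => v vt sv; rewrite -evB.
rewrite DB -[RHS]subr0; congr (_ - _).
rewrite -[RHS](DD (fun v => ev (sd v) (fun u => phi (b :: u))) (x :: t)).
by apply: D_ext => v vt sv; rewrite IH// -ltnS sv.
Qed.

Definition close (r : R) t := forall x y, x \in t -> y \in t -> forall w, `|x w - y w| <= r.

(** Coordinatewise interval hull of t. It is larger than the convex hull, but it suffices for
    distance estimates and needs no convex combinations. *)
Definition near_hull t (y : W -> R) := forall w (z r : R),
  (forall x, x \in t -> `|x w - z| <= r) -> `|y w - z| <= r.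

Lemma near_hull_mem t y : y \in t -> near_hull t y.
Proof. by move=> yt w z r; apply. Qed.

Lemma near_hull_trans t u y : (forall x, x \in u -> near_hull t x) ->
  near_hull u y -> near_hull t y.
Proof. by move=> tu uy w z r h; apply: uy => x /tu; apply. Qed.

Lemma norm_sum_seq_le (T : eqType) (s : seq T) (F : T -> R) (r : R) :
  (forall x, x \in s -> `|F x| <= r) -> `|\sum_(x <- s) F x| <= (size s)%:R * r.
Proof.
elim: s => [|x s IH] h; first by rewrite big_nil normr0 mul0r.
rewrite big_cons /= -[(size s).+1%:R]nat1r mulrDl mul1r.
apply: le_trans (ler_normD _ _) _; apply: lerD; first exact/h/mem_head.
by apply: IH => y ys; apply: h; rewrite inE ys orbT.
Qed.

Lemma barycenterB x t (z : R) w : barycenter (x :: t) w - z =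
  (\sum_(y <- x :: t) (y w - z)) / (size (x :: t))%:R.
Proof.
rewrite /barycenter sumrB mulrBl big_const_seq count_predT iter_addr_0 -[z *+ _]mulr_natr mulfK//.
by rewrite pnatr_eq0.
Qed.

Lemma barycenter_hull x t : near_hull (x :: t) (barycenter (x :: t)).
Proof.
move=> w z r h; rewrite barycenterB normrM normfV [X in _ / X]ger0_norm ?ler0n//.
rewrite ler_pdivrMr ?ltr0n// mulrC.
exact: (@norm_sum_seq_le _ (x :: t)).
Qed.

(** Among the k differences averaged by the barycenter, the one of x with itself is zero, whence the
    factor (k - 1)/k. *)
Lemma barycenter_dist (r : R) t x w : x \in t -> close r t ->
  `|x w - barycenter t w| <= (1 - (size t)%:R^-1) * r.
Proof.
move=> xt cr; have pxt := perm_to_rem xt; set s := rem x t in pxt.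
have -> : barycenter t = barycenter (x :: s).
  by apply/funext => v; rewrite /barycenter (perm_size pxt) (perm_big _ pxt).
rewrite (perm_size pxt) distrC barycenterB [size (x :: s)]/= big_cons subrr add0r.
rewrite normrM normfV [X in _ / X]ger0_norm ?ler0n// ler_pdivrMr ?ltr0n//.
rewrite mulrAC mulrBl mul1r mulVf ?pnatr_eq0// -natr1 addrK.
apply: norm_sum_seq_le => y ys.
by apply: cr => //; exact: mem_rem ys.
Qed.

Lemma sd_small (r : R) t : close r t ->
  forall p, p \in sd t -> [/\ size p.2 = size t, forall y, y \in p.2 -> near_hull t y &
    close ((1 - (size t)%:R^-1) * r) p.2].
Proof.
have [n sn] := ubnP (size t); elim: n => // n IH in t sn *.
case: t sn => [|x t] sn cr p.
  by rewrite inE => /eqP ->; split.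
rewrite sd_cons => /mapP[q /mem_fs_bind[f /mem_bd[ft sf] [q' q's q'E]] -> /=].
case: sf => sf; move: q's; rewrite -sf => /(IH f.2 _ _)[]; first by rewrite sf.
  by move=> y z yf zf; apply: cr; exact: (mem_subseq ft).
move=> sq' hq' cq'; rewrite q'E sq' sf.
have hq y : y \in q'.2 -> near_hull (x :: t) y.
  move=> /hq'; apply: near_hull_trans => z zf.
  by apply: near_hull_mem; exact: (mem_subseq ft).
have bq y w : near_hull (x :: t) y ->
    `|y w - barycenter (x :: t) w| <= (1 - (size t).+1%:R^-1) * r.
  by apply => z zt; exact: barycenter_dist.
have r0 w : 0 <= r + (x w - x w).
  by have := cr x x (mem_head _ _) (mem_head _ _) w; rewrite subrr normr0 addr0.
split=> //.
  by move=> y; rewrite inE => /orP[/eqP->|/hq //]; exact: barycenter_hull.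
move=> y z; rewrite !inE => /orP[/eqP->|yq] /orP[/eqP->|zq] w.
- by apply: bq; exact: barycenter_hull.
- by rewrite distrC; apply: bq; exact: hq.
- by apply: bq; exact: hq.
(* Both points come from the subdivision of a face with one vertex fewer, whose contraction factor
   is smaller. *)
- apply: le_trans (cq' y z yq zq w) _; apply: ler_wpM2r; first by have := r0 w; rewrite subrr addr0.
   rewrite lerD2l lerN2 lef_pV2 ?posrE ?ltr0n// ?ler_nat sf//.
  by rewrite -sf -sq'; case: (q'.2) yq.
Qed.

Lemma in_spx_barycenter (s : {fset W}) x t :
  (forall y, y \in x :: t -> in_spx s y) -> in_spx s (barycenter (x :: t)).
Proof.
move=> h; split=> [w|w ws|].
- rewrite mulr_ge0 ?invr_ge0// big_seq sumr_ge0// => y /h[y0 _ _].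
  exact: y0.
- rewrite /barycenter big_seq big1 ?mul0r// => y /h[_ ys _]; exact: ys.
- rewrite -mulr_suml exchange_big/= big_seq (eq_bigr (fun=> 1)) => [|y /h[_ _ //]].
  rewrite -big_seq big_const_seq count_predT iter_addr_0 divff//.
  by rewrite pnatr_eq0.
Qed.

Lemma sd_in_spx (s : {fset W}) t : (forall y, y \in t -> in_spx s y) ->
  forall p, p \in sd t -> forall y, y \in p.2 -> in_spx s y.
Proof.
have [n sn] := ubnP (size t); elim: n => // n IH in t sn *.
case: t sn => [|x t] sn h p.
  by rewrite inE => /eqP ->.
rewrite sd_cons => /mapP[q /mem_fs_bind[f /mem_bd[ft sf] [q' q's q'E]] -> y].
case: sf => sf; rewrite -sf in q's.
rewrite inE => /orP[/eqP ->|]; first exact: in_spx_barycenter.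
rewrite q'E; apply: (IH f.2) => //; first by rewrite sf.
by move=> z zf; apply: h; exact: (mem_subseq ft).
Qed.

Fixpoint sd_iter M t : fsum (seq (W -> R)) :=
  if M is M'.+1 then fs_bind (sd_iter M' t) sd else [:: (1, t)].

Lemma sd_iter_chain M (N : lmodType C) (phi : seq (W -> R) -> N) t :
  ev (sd_iter M t) (D phi) = D (fun v => ev (sd_iter M v) phi) t.
Proof.
elim: M phi => [|M IH] phi /=.
  by rewrite ev_one; apply: D_ext => v _ _; rewrite ev_one.
rewrite ev_bind; transitivity (ev (sd_iter M t) (D (fun v => ev (sd v) phi))).
  by apply: eq_bigr => p _; rewrite sd_chain.
by rewrite IH; apply: D_ext => v _ _; rewrite ev_bind.
Qed.

Lemma sd_iter_small M (s : {fset W}) (r : R) t : (forall y, y \in t -> in_spx s y) ->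
  close r t ->
  forall p, p \in sd_iter M t -> [/\ size p.2 = size t,
    forall y, y \in p.2 -> in_spx s y &
    close ((1 - (size t)%:R^-1) ^+ M * r) p.2].
Proof.
move=> ts cr; elim: M => [|M IH] p.
  by rewrite inE => /eqP->; rewrite expr0 mul1r.
move=> /mem_fs_bind[q /IH[sq qs cq] [q' q'q ->]].
have [sq' _] := sd_small cq q'q.
rewrite sq mulrA -exprS => cq'; split=> //; first by rewrite sq'.
exact: sd_in_spx q'q.
Qed.

Definition vertex_pt (w : W) : W -> R := fun v => (v == w)%:R.

Lemma in_spx_vertex (s : {fset W}) w : w \in s -> in_spx s (vertex_pt w).
Proof.
move=> ws; split=> [v|v vs|]; rewrite /vertex_pt ?ler0n//.
  by case: eqP vs => // ->; rewrite ws.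
rewrite (big_fsetD1 w)//= eqxx big_seq big1 ?addr0// => v.
by rewrite !inE => /andP[/negbTE ->].
Qed.

Lemma in_spx_dist (s : {fset W}) (x y : W -> R) w : in_spx s x -> in_spx s y -> `|x w - y w| <= 1.
Proof.
move=> sx sy; have [x0 _ _] := sx; have [y0 _ _] := sy.
have x1 := in_spx_le1 sx w; have y1 := in_spx_le1 sy w.
by rewrite ler_norml; move: (x0 w) (y0 w); lra.
Qed.

End Subdivision.

(** * Filling cycles of ordered simplices *)

Section Acyclicity.
Variables (R : realType) (W : choiceType) (K : scomplex W).
Hypothesis K_contr : contractible R (realization R K).

Definition spans_spx (t : seq W) := K [fset w in t]%fset.

Lemma spans_sub (s : {fset W}) (t : seq W) : K s -> (0 < size t)%N ->
  (forall w, w \in t -> w \in s) -> spans_spx t.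
Proof.
move=> Ks t0 ts; apply: sc_sub Ks _ _.
  by apply/fsubsetP => w; rewrite !inE => /ts.
by case: t t0 ts => // w t _ _; apply/fset0Pn; exists w; rewrite !inE eqxx.
Qed.

Lemma geometric_small (c d : R) : 0 <= c < 1 -> 0 < d -> exists M, c ^+ M < d.
Proof.
move=> /andP[c0 c1] d0.
have /cvgrPdist_lt/(_ d d0) : (c ^+ n @[n --> \oo] --> (0 : R)).
  by apply: cvg_expr; rewrite ger0_norm.
move=> [M _ /(_ M (leqnn _))] /=; rewrite sub0r normrN ger0_norm ?exprn_ge0//.
by exists M.
Qed.

(** Write sd z for a fine enough iterated subdivision of z. Then z is homologous to f_0 (sd z) by a
    carrier homotopy inside each simplex, f_j (sd z) is homologous to f_{j+1} (sd z) because small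
    simplices have both images in one simplex, and f_N (sd z) bounds its cone from [v0] because f_N
    is constant. The filling [b] is built before [N] and [phi] are given, so that it can be used
    with values in the chain module itself. *)
Lemma ordered_acyclic m (z : fsum (seq W)) :
  (forall p, p \in z -> size p.2 = m.+1 /\ spans_spx p.2) ->
  exists b : fsum (seq W),
    (forall p, p \in b -> size p.2 = m.+2 /\ spans_spx p.2) /\
    forall (N : lmodType C) (phi : seq W -> N),
      (forall psi : seq W -> N, ev z (D psi) = 0) -> ev z phi = ev b (D phi).
Proof.
move=> zP; pose S := [seq [fset w in p.2]%fset | p <- z].
have SK s : s \in S -> K s by move=> /mapP[p /zP[_ ?] ->].
have [d [N0 [f [v0 [d0 f0P fP fN]]]]] := discretize K_contr SK.
(* Simplices start with mesh at most 1 and have m + 1 vertices, so M subdivisions bring the mesh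
   below the Lebesgue number [d]. *)
have [|M cM] := @geometric_small (1 - m.+1%:R^-1) d _ d0.
  by rewrite subr_ge0 invf_le1 ?ltr0n// ler1n/= ltrBlDr ltrDl invr_gt0 ltr0n.
pose io := map (@vertex_pt R W); pose sg t := sd_iter M (io t).
have io_spx (s : {fset W}) t : (forall w, w \in t -> w \in s) ->
    forall y, y \in io t -> in_spx s y.
  by move=> ts y /mapP[w /ts ws ->]; exact: in_spx_vertex.
have sg_small t (s : {fset W}) : (forall w, w \in t -> w \in s) ->
    forall p, p \in sg t ->
      [/\ size p.2 = size t, forall y, y \in p.2 -> in_spx s y &
          close ((1 - (size t)%:R^-1) ^+ M) p.2].
  move=> ts p; have iot := io_spx s t ts.
  have c1 : close 1 (io t) by move=> x y /iot sx /iot sy w; exact: in_spx_dist sx sy.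
  by move=> /(sd_iter_small iot c1); rewrite mulr1 size_map.
have sg_chain (N : lmodType C) (phi : seq (W -> R) -> N) t :
    ev (sg t) (D phi) = D (fun v => ev (sg v) phi) t.
  by rewrite sd_iter_chain D_map.
pose Qa (u : seq W) := exists2 p, p \in z & subseq u p.2.
pose tha u : fsum (seq W) := fs_map (map (f 0%N)) (sg u).
have Qa_S u : Qa u -> exists2 s, s \in S & forall w, w \in u -> w \in s.
  move=> [p pz up]; exists [fset w in p.2]%fset; first by apply/mapP; exists p.
  by move=> w wu; rewrite !inE; exact: (mem_subseq up).
have sg_nil (N : lmodType C) (phi : seq (W -> R) -> N) : ev (sg [::]) phi = phi [::].
  rewrite /sg /io /=; elim: (M) phi => [|M' IH] phi; first exact: ev_one.
  by rewrite /= ev_bind IH ev_one.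
(* Homotopy from f_0 after subdivision to the identity. The carrier of u is its own vertex set:
   [f 0] picks a vertex where the point is positive, hence a vertex of u. *)
pose Ta := carrier_htpy (head v0) tha (fun u => [:: (1, u)]).
have TaP u : Qa u -> fs_good (size u).+1 (fun w => w \in u) (Ta u) /\
    forall (N : lmodType C) (phi : seq W -> N),
    ev [:: (1, u)] phi - ev (tha u) phi =
    ev (Ta u) (D phi) + D (fun v => ev (Ta v) phi) u.
  apply: (@carrier_htpyP _ _ Qa (fun u w => w \in u)).
  - by move=> u1 u2 u12 [p pz u2p]; exists p => //; exact: subseq_trans u2p.
  - by move=> u1 u2 w u12; exact: mem_subseq.
  - by case=> [//|w u1 _ _]; exact: mem_head.
  - move=> u1 Qu1 _ /mapP[p pu1 ->] /=.
    have [|sp pspx _] := sg_small u1 [fset w in u1]%fset _ p pu1.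
      by move=> w; rewrite !inE.
    rewrite size_map; split=> // _ /mapP[y yp ->].
    have [s sS us] := Qa_S _ Qu1.
    have [_ sy _] := sg_small u1 s us p pu1.
    have fy := f0P s y sS (sy y yp).
    have [_ yu _] := pspx y yp.
    apply/negPn/negP => fyu; move: fy; rewrite yu ?ltxx//.
    by rewrite !inE.
  - by move=> u1 Qu1 p; rewrite inE => /eqP ->.
  - move=> N phi u1 _; rewrite ev_map.
    transitivity (ev (sg u1) (D (fun v => phi (map (f 0%N) v)))).
      by apply: eq_bigr => p _; rewrite D_map.
    by rewrite sg_chain; apply: D_ext => v _ _; rewrite ev_map.
  - by move=> N phi u1 _; rewrite ev_one; apply: D_ext => v _ _; rewrite ev_one.
  - by move=> N phi; rewrite ev_one ev_map sg_nil.
have z_Qa p : p \in z -> Qa p.2 by move=> pz; exists p.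
pose z' := fs_bind z sg.
have z'P q : q \in z' -> exists2 s, s \in S & [/\ size q.2 = m.+1,
    forall y, y \in q.2 -> in_spx s y &
    forall x y, x \in q.2 -> y \in q.2 -> forall w, `|x w - y w| < d].
  move=> /mem_fs_bind[p pz [q' q'p ->]].
  exists [fset w in p.2]%fset; first by apply/mapP; exists p.
  have [|sq qs cq] := sg_small p.2 [fset w in p.2]%fset _ q' q'p.
    by move=> w; rewrite !inE.
  rewrite sq (zP _ pz).1; split=> // x y xq yq w.
  by apply: le_lt_trans cM; rewrite -(zP _ pz).1; exact: cq.
have z'_cycle (N : lmodType C) : (forall psi : seq W -> N, ev z (D psi) = 0) ->
    forall psi : seq (W -> R) -> N, ev z' (D psi) = 0.
  move=> zc psi; rewrite ev_bind -(zc (fun v => ev (sg v) psi)).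
  by apply: eq_bigr => p _; rewrite sg_chain.
pose Qb (u : seq (W -> R)) := exists2 p, p \in z' & subseq u p.2.
(* By [discretize] the carrier of a small u spans a simplex, so the homotopy from stage j to stage j
   + 1 consists of simplices. *)
pose carb j (u : seq (W -> R)) w := exists2 x, x \in u & w = f j x \/ w = f j.+1 x.
pose thb j (u : seq (W -> R)) : fsum (seq W) := [:: (1, map (f j) u)].
pose Tb j := carrier_htpy (fun u => f j (head (fun=> 0) u)) (thb j) (thb j.+1).
have thb_chain j (N : lmodType C) (phi : seq W -> N) u :
    ev (thb j u) (D phi) = D (fun v => ev (thb j v) phi) u.
  by rewrite ev_one D_map; apply: D_ext => v _ _; rewrite ev_one.
have TbP j u : Qb u -> fs_good (size u).+1 (carb j u) (Tb j u) /\
    forall (N : lmodType C) (phi : seq W -> N),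
    ev (thb j.+1 u) phi - ev (thb j u) phi =
    ev (Tb j u) (D phi) + D (fun v => ev (Tb j v) phi) u.
  apply: (@carrier_htpyP _ _ Qb (carb j)) => //.
  - by move=> u1 u2 u12 [p pz u2p]; exists p => //; exact: subseq_trans u2p.
  - by move=> u1 u2 w u12 [x xu xw]; exists x => //; exact: (mem_subseq u12).
  - by case=> [//|x u1 _ _]; exists x; rewrite ?mem_head//; left.
  - move=> u1 Qu1 p; rewrite inE => /eqP ->; rewrite size_map; split=> // w.
    by move=> /mapP[x xu ->]; exists x => //; left.
  - move=> u1 Qu1 p; rewrite inE => /eqP ->; rewrite size_map; split=> // w.
    by move=> /mapP[x xu ->]; exists x => //; right.
have fj_htpy j : exists b : fsum (seq W),
    (forall p, p \in b -> size p.2 = m.+2 /\ spans_spx p.2) /\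
    forall (N : lmodType C) (phi : seq W -> N),
      (forall psi : seq W -> N, ev z (D psi) = 0) ->
      ev z' (fun u => phi (map (f j) u)) - ev z' (fun u => phi (map (f 0%N) u))
      = ev b (D phi).
  elim: j => [|j [b [bP bE]]].
    by exists [::]; split=> // N phi _; rewrite ev_nil subrr.
  exists (fs_bind z' (Tb j) ++ b); split.
    move=> p; rewrite mem_cat => /orP[|/bP //] /mem_fs_bind[q qz' [q' q'T ->]].
    have [s sS [sq qs cq]] := z'P q qz'.
    have [|T1 _] := TbP j q.2; first by exists q.
    have [t Kt tP] := fP j s q.2 sS qs cq.
    have [-> q'c] := T1 _ q'T; rewrite sq; split=> //.
    apply: (spans_sub Kt) => [|w /q'c[x /tP[x1 x2] [] ->]] //.
    by rewrite (T1 _ q'T).1.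
  move=> N phi zc; rewrite ev_cat -bE// addrA; congr (_ - _).
  apply/eqP; rewrite -subr_eq -evB [in X in _ == X]ev_bind; apply/eqP.
  rewrite -[RHS]addr0 -(z'_cycle N zc (fun v => ev (Tb j v) phi)) -evD.
  apply: eq_ev => p pz'; have [|_ TE] := TbP j p.2; first by exists p.
  by rewrite -TE !ev_one.
have [B [BP BE]] := fj_htpy N0.
pose z'' := fs_map (map (f N0)) z'.
exists (fs_bind z Ta ++ fs_scale (- 1) B ++ fs_map (cons v0) z''); split.
  move=> p; rewrite !mem_cat => /or3P[/mem_fs_bind[q qz [q' q'T ->]]|/mapP[q /BP ? -> //]|].
    have [T1 _] := TaP q.2 (z_Qa _ qz); have [-> q'c] := T1 _ q'T.
    have [sq Kq] := zP q qz; rewrite sq; split=> //.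
    apply: (spans_sub Kq) => [|w /q'c]; last by rewrite !inE.
    by rewrite (T1 _ q'T).1.
  move=> /mapP[q /mapP[q' q'z' ->] -> /=]; rewrite size_map.
  have [s sS [sq _ _]] := z'P q' q'z'; rewrite sq; split=> //.
  apply: (spans_sub (@sc_vertex _ K v0)) => // w; rewrite inE => /orP[/eqP->|].
    by rewrite !inE.
  by move=> /mapP[x _ ->]; rewrite fN !inE.
move=> N phi zc; rewrite !ev_cat ev_scale scaleN1r -BE//.
have -> : ev (fs_map (cons v0) z'') (D phi) = ev z'' phi.
  rewrite !ev_map -[RHS]subr0 -(z'_cycle N zc (fun v => phi (v0 :: map (f N0) v))) -evB.
  by apply: eq_bigr => p _; rewrite /= D_map.
rewrite ev_map opprB addrNK; apply/eqP; rewrite -subr_eq !ev_bind -evB; apply/eqP.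
rewrite -[RHS]addr0 -(zc (fun v => ev (Ta v) phi)) -evD.
apply: eq_ev => p pz; have [_ TE] := TaP p.2 (z_Qa p pz).
by rewrite -TE ev_one ev_map.
Qed.

End Acyclicity.

End FormalSums.

(** * Transport along edge paths and deck transformations *)

Section Transport.
Variables (V W : choiceType) (Y : scomplex V) (Yt : scomplex W) (p : W -> V).
Hypothesis cov : simplicial_covering Y Yt p.

Lemma cov_image t : Yt t -> Y [fset p w | w in t]%fset.
Proof. by case: cov => _ h _ /h[]. Qed.

Lemma cov_inj t : Yt t -> {in t &, injective p}.
Proof. by case: cov => _ h _ /h[]. Qed.

Lemma cov_lift w s : Y s -> p w \in s ->
  exists2 t, Yt t /\ w \in t & [fset p u | u in t]%fset = s.
Proof. by case: cov => _ _ h Ys /(h _ _ Ys)[t [[]]]; exists t. Qed.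

Lemma cov_lift_uniq w s t t' : Y s ->
  Yt t -> w \in t -> [fset p u | u in t]%fset = s ->
  Yt t' -> w \in t' -> [fset p u | u in t']%fset = s -> t = t'.
Proof.
case: cov => _ _ h Ys Yt1 wt ts Yt2 wt' t's.
have pws : p w \in s by rewrite -ts; apply/imfsetP; exists w.
have [t0 [_ t0u]] := h w s Ys pws.
by rewrite -(t0u t) // -(t0u t').
Qed.

Lemma simplex_pair t (x y : W) : Yt t -> x \in t -> y \in t -> Yt [fset x; y]%fset.
Proof.
move=> Ytt xt yt; apply: sc_sub Ytt _ _.
  by apply/fsubsetP => z; rewrite !inE => /orP[]/eqP->.
by apply/fset0Pn; exists x; rewrite !inE eqxx.
Qed.

(* The endpoint of the lift, starting at x, of the edge from p x to b. *)
Definition tr (b : V) (x : W) : W := xget x [set y | p y = b /\ Yt [fset x; y]%fset].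

Lemma tr_edge x y : Yt [fset x; y]%fset -> tr (p y) x = y.
Proof.
move=> xy; rewrite /tr; have := xgetPex x (ex_intro (fun z => p z = p y /\ Yt [fset x; z]%fset) y (conj erefl xy)).
set z := xget _ _; move=> [zy xz].
have E : [fset x; z]%fset = [fset x; y]%fset.
  apply: (@cov_lift_uniq x [fset p u | u in [fset x; y]]%fset) => //.
  - exact: cov_image.
  - by rewrite !inE eqxx.
  - by rewrite !imfsetU !imfset_fset1 zy.
  - by rewrite !inE eqxx.
apply: (cov_inj xy) => //; first by rewrite -E !inE eqxx orbT.
by rewrite !inE eqxx orbT.
Qed.

Lemma tr_mem t x y : Yt t -> x \in t -> y \in t -> tr (p y) x = y.
Proof. by move=> Ytt xt yt; apply: tr_edge; exact: simplex_pair Ytt xt yt. Qed.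

Lemma lift_mem s x b : Y s -> p x \in s -> b \in s ->
  exists2 t, Yt t /\ x \in t & tr b x \in t /\ p (tr b x) = b.
Proof.
move=> Ys xs bs; have [t [Ytt xt] ts] := cov_lift Ys xs; exists t => //.
move: bs; rewrite -ts => /imfsetP[y /= yt ->].
by rewrite (tr_mem Ytt xt yt).
Qed.

Lemma p_tr s x b : Y s -> p x \in s -> b \in s -> p (tr b x) = b.
Proof. by move=> Ys xs /(lift_mem Ys xs)[t _ []]. Qed.

Lemma tr_self x : tr (p x) x = x.
Proof.
by apply: tr_edge; rewrite fsetUid; exact: sc_vertex.
Qed.

(** Transport within one simplex is independent of the path, as all lifts are vertices of the unique
    lift of s through x. *)
Lemma tr_tri s x b c : Y s -> p x \in s -> b \in s -> c \in s ->
  tr c (tr b x) = tr c x.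
Proof.
move=> Ys xs bs cs; have [t [Ytt xt] ts] := cov_lift Ys xs.
move: bs cs; rewrite -ts => /imfsetP[y /= yt ->] /imfsetP[z /= zt ->].
by rewrite (tr_mem Ytt xt yt) (tr_mem Ytt yt zt) (tr_mem Ytt xt zt).
Qed.

Lemma tr_back s x b : Y s -> p x \in s -> b \in s -> tr (p x) (tr b x) = x.
Proof. by move=> Ys xs bs; rewrite (tr_tri Ys)// tr_self. Qed.

Fixpoint tpf (A : nat -> W) (x : W) (k : nat) : W :=
  if k is k'.+1 then tr (p (A k)) (tpf A x k') else x.

Lemma p_tpf A x M : p x = p (A 0%N) ->
  (forall k, (k < M)%N -> exists2 s, Yt s & A k \in s /\ A k.+1 \in s) ->
  p (tpf A x M) = p (A M).
Proof.
move=> xA; elim: M => [//|M IH] h /=.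
have [s Ys [As A's]] := h M (ltnSn _).
apply: (@p_tr [fset p u | u in s]%fset); first exact: cov_image.
  by rewrite IH => [|k kM]; [exact: in_imfset|apply: h; exact: ltnW].
exact: in_imfset.
Qed.

(** Each square of the ladder lies in one simplex, so by [tr_tri] transport along its two ways round
    agrees, and the rung moves from the start to the end. *)
Lemma tpf_ladder A B x M : p x = p (A 0%N) ->
  (exists2 s, Yt s & A 0%N \in s /\ B 0%N \in s) ->
  (forall k, (k < M)%N -> exists2 s, Yt s &
     [/\ A k \in s, A k.+1 \in s, B k \in s & B k.+1 \in s]) ->
  tr (p (B M)) (tpf A x M) = tpf B (tr (p (B 0%N)) x) M.
Proof.
move=> xA s0 h; elim: M h => [//|M IH] h.
have [s Ys [As A's Bs B's]] := h M (ltnSn _).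
have h' k : (k < M)%N -> exists2 s, Yt s &
     [/\ A k \in s, A k.+1 \in s, B k \in s & B k.+1 \in s].
  by move=> kM; apply: h; exact: ltnW.
have Y's := cov_image Ys.
have pA : p (tpf A x M) = p (A M).
  by apply: p_tpf => // k /h'[t Ytt [? ? _ _]]; exists t.
rewrite [tpf A x _]/= [tpf B _ _]/= -IH//.
rewrite (tr_tri Y's) ?pA ?in_imfset//.
by rewrite [RHS](tr_tri Y's) ?pA ?in_imfset.
Qed.

Lemma tpf_const A x M v : (forall k, A k = v) -> p x = p v -> tpf A x M = x.
Proof.
by move=> Av xv; elim: M => [//|M IH] /=; rewrite IH Av -xv tr_self.
Qed.

Fixpoint epath (u : W) (us : seq W) : Prop :=
  if us is u' :: us' then Yt [fset u; u']%fset /\ epath u' us' else True.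

Definition tp (x : W) (us : seq W) : W := foldl (fun y u => tr (p u) y) x us.

Lemma epath_cat u us vs : epath u (us ++ vs) <-> epath u us /\ epath (last u us) vs.
Proof.
elim: us u => [|v us IH] u /=; first by split=> // -[].
by rewrite IH; split=> [[? []]|[[]]].
Qed.

Lemma p_tp u us x : epath u us -> p x = p u -> p (tp x us) = p (last u us).
Proof.
elim: us u x => [//|v us IH] u x /= [uv /IH e] xu; apply: e.
by apply: (p_tr (cov_image uv)); rewrite ?xu in_imfset// !inE eqxx ?orbT.
Qed.

Lemma tp_inj u us x y : epath u us -> p x = p u -> p y = p u ->
  tp x us = tp y us -> x = y.
Proof.
elim: us u x y => [//|v us IH] u x y /= [uv euv] xu yu e.
have Yuv := cov_image uv.
have pu : p u \in [fset p w | w in [fset u; v]]%fset by rewrite in_imfset// !inE eqxx.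
have pv : p v \in [fset p w | w in [fset u; v]]%fset by rewrite in_imfset// !inE eqxx orbT.
have : tr (p v) x = tr (p v) y.
  by apply: (IH v _ _ euv _ _ e); apply: (p_tr Yuv); rewrite ?xu ?yu.
by move=> /(congr1 (tr (p u))); rewrite -{1}xu (tr_back Yuv) ?xu// -yu (tr_back Yuv) ?yu.
Qed.

Lemma tp_back u us x : epath u us -> p x = p u ->
  tp (tp x us) (rev (belast u us)) = x.
Proof.
elim: us u x => [//|v us IH] u x /= [uv euv] xu.
have Yuv := cov_image uv.
have pu : p u \in [fset p w | w in [fset u; v]]%fset by rewrite in_imfset// !inE eqxx.
have pv : p v \in [fset p w | w in [fset u; v]]%fset by rewrite in_imfset// !inE eqxx orbT.
rewrite rev_cons /tp foldl_rcons -/(tp _ _) IH//; last by apply: (p_tr Yuv); rewrite ?xu.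
by rewrite -xu (tr_back Yuv) ?xu.
Qed.

Lemma epath_rev u us : epath u us -> epath (last u us) (rev (belast u us)).
Proof.
elim: us u => [//|v us IH] u /= [uv /IH e]; rewrite rev_cons -cats1 epath_cat; split=> //=.
split=> //; rewrite fsetUC.
case: us {e IH} => [//|w us] /=; rewrite rev_cons last_rcons//.
Qed.

Lemma last_rev_belast (u : W) us : last (last u us) (rev (belast u us)) = u.
Proof. by case: us => [//|v us]; rewrite /= rev_cons last_rcons. Qed.

(** * Triviality of the holonomy and its consequences for deck transformations *)

Section Holonomy.
Variable R : realType.
Hypothesis Yt_contr : contractible R (realization R Yt).

(* Two consecutive stages of the discretized contraction of the closed edge path *)
(* g form a ladder of simplices, along which the holonomy does not change; the   *)
(* last stage is a constant path.                                                *)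
Lemma holonomyf (g : nat -> W) M x : (forall k, (k < M)%N -> Yt [fset g k; g k.+1]%fset) ->
  g M = g 0%N -> p x = p (g 0%N) -> tpf g x M = x.
Proof.
move=> gP gM xg; pose S := [seq [fset g k; g k.+1]%fset | k <- iota 0 M].
have gS k : (k < M)%N -> [fset g k; g k.+1]%fset \in S.
  by move=> kM; apply/mapP; exists k; rewrite // mem_iota.
have SK s : s \in S -> Yt s.
  by move=> /mapP[k]; rewrite mem_iota => /andP[_ kM] ->; exact: gP.
have [d [N [f [v0 [d0 f0P fP fN]]]]] := discretize Yt_contr SK.
(* Each edge is cut into L pieces shorter than [d]; [pt k r] is the point at parameter r/L of the
   k-th edge and [q] runs through all of them in order. *)
have [L L0 Ld] : exists2 L : nat, (0 < L)%N & (L%:R)^-1 < d.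
  exists (Num.truncn d^-1).+1 => //.
  by rewrite -[ltRHS]invrK ltf_pV2 ?posrE ?invr_gt0 ?ltr0n// truncnS_gt.
have LR0 : 0 < L%:R :> R by rewrite ltr0n.
pose pt k r : W -> R := fun w => (1 - r%:R / L%:R) * vertex_pt R (g k) w
  + r%:R / L%:R * vertex_pt R (g k.+1) w.
pose q i := pt (i %/ L)%N (i %% L)%N.
have pt0 k : pt k 0%N = vertex_pt R (g k).
  by apply/funext => w; rewrite /pt mul0r subr0 mul1r mul0r addr0.
have ptL k : pt k L = vertex_pt R (g k.+1).
  by apply/funext => w; rewrite /pt divff ?gt_eqF// subrr mul0r mul1r add0r.
have qkr k r : (r < L)%N -> q (k * L + r)%N = pt k r.
  by move=> rL; rewrite /q divnMDl// modnMDl divn_small// addn0 modn_small.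
have qkr' k r : (r <= L)%N -> q (k * L + r)%N = pt k r.
  rewrite leq_eqVlt => /orP[/eqP->|]; last exact: qkr.
  by rewrite -mulSnr -[(k.+1 * L)%N]addn0 qkr// pt0 ptL.
have pt_spx k r : (r <= L)%N -> in_spx [fset g k; g k.+1]%fset (pt k r).
  move=> rL; have [a0 a1 a2] : in_spx [fset g k; g k.+1]%fset (vertex_pt R (g k)).
    by apply: in_spx_vertex; rewrite !inE eqxx.
  have [b0 b1 b2] : in_spx [fset g k; g k.+1]%fset (vertex_pt R (g k.+1)).
    by apply: in_spx_vertex; rewrite !inE eqxx orbT.
  have c1 : r%:R / L%:R <= 1 :> R by rewrite ler_pdivrMr// mul1r ler_nat.
  have c0 : 0 <= r%:R / L%:R :> R by rewrite divr_ge0.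
  split=> [w|w ws|]; first by rewrite addr_ge0// mulr_ge0// subr_ge0.
    by rewrite /pt a1// b1// !mulr0 addr0.
  by rewrite /pt big_split/= -!mulr_sumr a2 b2 !mulr1 subrK.
have pt_dist k r w : `|pt k r w - pt k r.+1 w| < d.
  rewrite (_ : pt k r w - pt k r.+1 w =
     (vertex_pt R (g k) w - vertex_pt R (g k.+1) w) / L%:R); last first.
    by rewrite /pt -natr1; field; rewrite gt_eqF.
  rewrite normrM normfV [X in _ / X]gtr0_norm//; apply: le_lt_trans Ld.
  rewrite -[leRHS]mul1r; apply: ler_wpM2r; first by rewrite invr_ge0 ltW.
  by apply: (@in_spx_dist R W [fset g k; g k.+1]%fset); apply: in_spx_vertex; rewrite !inE eqxx ?orbT.
pose F j i := f j (q i).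
have Fsq j i : (i < M * L)%N -> exists2 s, Yt s &
    [/\ F j i \in s, F j i.+1 \in s, F j.+1 i \in s & F j.+1 i.+1 \in s].
  move=> iML; have rL : (i %% L < L)%N by rewrite ltn_pmod.
  have kM : (i %/ L < M)%N by rewrite ltn_divLR.
  have qi : q i = pt (i %/ L)%N (i %% L)%N by [].
  have qi1 : q i.+1 = pt (i %/ L)%N (i %% L).+1.
    by rewrite {1}(divn_eq i L) -addnS qkr'.
  have [||s Ys sP] := fP j _ [:: q i; q i.+1] (gS _ kM).
  - by move=> y; rewrite !inE => /orP[]/eqP ->; rewrite ?qi ?qi1; apply: pt_spx => //; exact: ltnW.
  - move=> y z; rewrite !inE qi qi1 => /orP[]/eqP -> /orP[]/eqP -> w.
    + by rewrite subrr normr0.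
    + exact: pt_dist.
    + by rewrite distrC; exact: pt_dist.
    + by rewrite subrr normr0.
  exists s => //; have [a b] := sP (q i) (mem_head _ _).
  by have [|a' b'] := sP (q i.+1) _; first by rewrite !inE eqxx orbT.
have [M0|M0] := posnP M; first by rewrite M0.
have F0sq j : exists2 s, Yt s & F j 0%N \in s /\ F j.+1 0%N \in s.
  by have [|s Ys [? ? ? ?]] := Fsq j 0%N; [rewrite muln_gt0 M0|exists s].
have qML : q (M * L)%N = q 0%N.
  by rewrite -[(M * L)%N]addn0 qkr// pt0 gM -pt0 -qkr.
(* Descending induction on the stage, from the constant path at stage N to stage 0; the stages are
   closed paths since the end points of [q] agree. *)
have holN j : (j <= N)%N -> forall y, p y = p (F (N - j)%N 0%N) -> tpf (F (N - j)%N) y (M * L) = y.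
  elim: j => [|j IH] jN y.
    by rewrite subn0 => yF; apply: (@tpf_const _ _ _ v0) => [k|]; rewrite ?yF /F fN.
  have -> : (N - j.+1 = (N - j).-1)%N by rewrite subnS.
  have Nj : (0 < N - j)%N by rewrite subn_gt0.
  have {}IH := IH (ltnW jN); move: Nj IH; case: (N - j)%N => // i _ /= IH yF.
  have [s Ys [Fs F's]] := F0sq i.
  have pF : p (F i 0%N) \in [fset p u | u in s]%fset by exact: in_imfset.
  have pF' : p (F i.+1 0%N) \in [fset p u | u in s]%fset by exact: in_imfset.
  have Y's := cov_image Ys.
  have := @tpf_ladder (F i) (F i.+1) y (M * L)%N yF (F0sq i) (Fsq i).
  rewrite IH; last by apply: (p_tr Y's); rewrite ?yF.
  have FM j' : F j' (M * L)%N = F j' 0%N by rewrite /F qML.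
  rewrite FM => /(congr1 (tr (p (F i 0%N)))).
  have py : p (tpf (F i) y (M * L)) = p (F i 0%N).
    by rewrite -FM; apply: p_tpf => // k /Fsq -/(_ i)[s' Ys' [? ? _ _]]; exists s'.
  by rewrite -{1}py (tr_back Y's) ?py// -{1}yF (tr_back Y's) ?yF.
have Fg k : (k < M)%N -> forall r, (r <= L)%N -> F 0%N (k * L + r)%N \in [fset g k; g k.+1]%fset.
  move=> kM r rL; rewrite /F qkr'//; have sx := pt_spx k r rL.
  have fy := f0P _ _ (gS k kM) sx; have [_ yu _] := sx.
  by apply/negPn/negP => /yu e; move: fy; rewrite e ltxx.
have Fk k : (k <= M)%N -> F 0%N (k * L)%N = g k.
  move=> kM; rewrite -[(k * L)%N]addn0 /F qkr// pt0.
  have fy : 0 < vertex_pt R (g k) (f 0%N (vertex_pt R (g k))).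
    have vk k' : (k' < M)%N -> g k \in [fset g k'; g k'.+1]%fset ->
        0 < vertex_pt R (g k) (f 0%N (vertex_pt R (g k))).
      by move=> k'M kk'; apply: f0P (gS k' k'M) _; exact: in_spx_vertex.
    move: kM; rewrite leq_eqVlt => /orP[/eqP kM|kM].
      by apply: (vk 0%N M0); rewrite kM gM !inE eqxx.
    by apply: (vk k kM); rewrite !inE eqxx.
  by apply/eqP; move: fy; rewrite /vertex_pt; case: eqP => // _; rewrite ltxx.
(* Stage 0 fixes the vertices and stays on each edge in turn, so within an edge [tr_tri] collapses
   its transport to a single step of [g]. *)
have main k : (k <= M)%N -> tpf (F 0%N) x (k * L) = tpf g x k.
  elim: k => [//|k IH] kM; have gk := gP k kM; have Y's := cov_image gk.
  have pg : p (tpf g x k) = p (g k).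
    apply: p_tpf => // i ik; exists [fset g i; g i.+1]%fset; first by apply: gP; exact: ltn_trans kM.
    by rewrite !inE !eqxx orbT.
  have pgk : p (tpf g x k) \in [fset p u | u in [fset g k; g k.+1]]%fset.
    by rewrite pg in_imfset// !inE eqxx.
  have seg r : (r <= L)%N -> tpf (F 0%N) x (k * L + r) = tr (p (F 0%N (k * L + r)%N)) (tpf g x k).
    elim: r => [|r IHr] rL.
      by rewrite addn0 IH ?(ltnW kM)// Fk ?(ltnW kM)// -pg tr_self.
    rewrite addnS /= IHr ?(ltnW rL)//; apply: (tr_tri Y's) => //; apply: in_imfset => /=.
      by apply: Fg => //; exact: ltnW.
    by rewrite -addnS; exact: Fg.
  by rewrite mulSnr seg// -mulSnr Fk.
have := holN N (leqnn _); rewrite subnn => h0.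
rewrite -main//; apply: h0; rewrite (_ : F 0%N 0%N = g 0%N)//.
by rewrite -(Fk 0%N).
Qed.

Lemma tpf_tp u us x k : (k <= size us)%N ->
  tpf (nth u (u :: us)) x k = tp x (take k us).
Proof.
elim: k => [|k IH] kus; first by rewrite take0.
rewrite [LHS]/= IH ?(ltnW kus)// (take_nth u)//.
by rewrite /tp foldl_rcons.
Qed.

Lemma epath_nth u us k : epath u us -> (k < size us)%N ->
  Yt [fset nth u (u :: us) k; nth u (u :: us) k.+1]%fset.
Proof.
elim: us u k => [//|v us IH] u [|k] /= [uv euv] // kus.
have := IH v k euv kus; rewrite (set_nth_default u)//= => [|]; last by rewrite ltnS ltnW.
by rewrite (set_nth_default u v kus).
Qed.

Lemma holonomy u us x : epath u us -> last u us = u -> p x = p u -> tp x us = x.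
Proof.
move=> eus lus xu; rewrite -[us in LHS]take_size -(tpf_tp u)//; apply: holonomyf => //.
  by move=> k; exact: epath_nth.
by rewrite /= -[in RHS]lus (last_nth u).
Qed.

Lemma tp_uniq u us vs x : epath u us -> epath u vs -> last u us = last u vs ->
  p x = p u -> tp x us = tp x vs.
Proof.
move=> eus evs uv xu.
have er := epath_rev evs.
have pu : p (tp x us) = p (last u vs) by rewrite (p_tp eus)// uv.
apply: (tp_inj er) => //; first by rewrite (p_tp evs).
rewrite tp_back// -[RHS](@holonomy u (us ++ rev (belast u vs)))//.
- by rewrite /tp foldl_cat.
- by rewrite epath_cat uv.
- by rewrite last_cat uv last_rev_belast.
Qed.

(** The discretized contraction moves u and v along edges to the same vertex [v0]. *)
Lemma epath_ex u v : exists us, epath u us /\ last u us = v.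
Proof.
have [|d [N [f [v0 [d0 f0P fP fN]]]]] := @discretize R W Yt [:: [fset u]%fset; [fset v]%fset] Yt_contr.
  by move=> s; rewrite !inE => /orP[]/eqP ->; exact: sc_vertex.
have to_v0 w : [fset w]%fset \in [:: [fset u]%fset; [fset v]%fset] ->
    exists us, epath w us /\ last w us = v0.
  move=> wS; have wspx : in_spx [fset w]%fset (vertex_pt R w).
    by apply: in_spx_vertex; rewrite !inE.
  have f0w : f 0%N (vertex_pt R w) = w.
    apply/eqP; have := f0P _ _ wS wspx; rewrite /vertex_pt; case: eqP => // _.
    by rewrite ltxx.
  have fw j : exists us, epath w us /\ last w us = f j (vertex_pt R w).
    elim: j => [|j [us [eus lus]]]; first by exists [::].
    exists (rcons us (f j.+1 (vertex_pt R w))); rewrite last_rcons; split=> //.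
    rewrite -cats1 epath_cat lus; split=> //=; split=> //.
    have [||t Ytt tP] := fP j _ [:: vertex_pt R w] wS.
    - by move=> y; rewrite inE => /eqP ->.
    - by move=> y z; rewrite !mem_seq1 => /eqP yE /eqP zE a; rewrite yE zE subrr normr0.
    have [a b] := tP _ (mem_head _ _).
    exact: simplex_pair Ytt a b.
  by have [us [eus lus]] := fw N; exists us; rewrite lus fN.
have [|us [eus lus]] := to_v0 u; first by rewrite mem_head.
have [|vs [evs lvs]] := to_v0 v; first by rewrite !inE eqxx orbT.
exists (us ++ rev (belast v vs)); rewrite epath_cat last_cat lus -lvs last_rev_belast.
by split=> //; split=> //; exact: epath_rev.
Qed.

Definition simplicial_lift (h : W -> W) :=
  (forall w, p (h w) = p w) /\ forall x y, Yt [fset x; y]%fset -> Yt [fset h x; h y]%fset.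

Lemma simplicial_lift_tp h u us : simplicial_lift h -> epath u us ->
  h (last u us) = tp (h u) us.
Proof.
move=> [ph hY]; elim: us u => [//|v us IH] u /= [uv /IH ->]; congr (tp _ us).
by rewrite -(ph v) tr_edge//; exact: hY.
Qed.

Lemma simplicial_lift_uniq h h' u : simplicial_lift h -> simplicial_lift h' ->
  h u = h' u -> h =1 h'.
Proof.
move=> hl hl' hu w; have [us [eus <-]] := epath_ex u w.
by rewrite !simplicial_lift_tp// hu.
Qed.

(** Send w to the transport of v along any edge path from u to w; trivial holonomy, as [tp_uniq],
    makes this independent of the path. *)
Lemma simplicial_lift_ex u v : p u = p v -> exists2 h, simplicial_lift h &
  h u = v /\ forall t, Yt t -> Yt [fset h w | w in t]%fset.
Proof.
move=> uv; have /choice[us usP] w := epath_ex u w.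
pose h w := tp v (us w).
have hE vs : epath u vs -> h (last u vs) = tp v vs.
  by move=> evs; have [? ?] := usP (last u vs); apply: (@tp_uniq u).
have ph w : p (h w) = p w.
  by have [? lw] := usP w; rewrite (@p_tp u) ?lw.
have he x y : Yt [fset x; y]%fset -> h y = tr (p y) (h x).
  move=> xy; have [ex lx] := usP x.
  have := hE (rcons (us x) y); rewrite last_rcons => ->; last first.
    by rewrite -cats1 epath_cat lx.
  by rewrite /tp foldl_rcons -/(tp _ _) -[x in RHS]lx hE.
have hs t : Yt t -> Yt [fset h w | w in t]%fset.
  move=> Ytt; have /fset0Pn[w wt] := sc_neq0 Ytt.
  have Yt' := cov_image Ytt.
  have pw : p (h w) \in [fset p u | u in t]%fset by rewrite ph in_imfset.
  have [t' [Ytt' hwt'] t't] := cov_lift Yt' pw.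
  apply: (sc_sub Ytt'); last by apply/fset0Pn; exists (h w); rewrite in_imfset.
  apply/fsubsetP => _ /imfsetP[x /= xt ->].
  rewrite (he w); last exact: simplex_pair Ytt wt xt.
  have : p x \in [fset p u | u in t']%fset by rewrite t't in_imfset.
  by move=> /imfsetP[y /= yt' ->]; rewrite (tr_mem Ytt').
exists h; last by split=> //; have := hE [::] I.
split=> // x y /hs; congr (Yt _).
by rewrite imfsetU !imfset_fset1.
Qed.

(** The lifts taking u to v and v to u are mutually inverse, since their composites agree with the
    identity at one vertex. *)
Lemma deck_ex u v : p u = p v -> exists2 h, deck_transformation Yt p h & h u = v.
Proof.
move=> uv; have [h hl [hu hs]] := simplicial_lift_ex uv.
have [g gl [gv gs]] := simplicial_lift_ex (esym uv).
have comp a b : simplicial_lift a -> simplicial_lift b -> simplicial_lift (a \o b).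
  by move=> [pa aY] [pb bY]; split=> [w|x y xy] /=; [rewrite pa pb|exact/aY/bY].
have idl : simplicial_lift id by [].
have gh : cancel h g.
  by apply: (@simplicial_lift_uniq (g \o h) id u) => //; [exact: comp|rewrite /= hu].
have hg : cancel g h.
  by apply: (@simplicial_lift_uniq (h \o g) id v) => //; [exact: comp|rewrite /= gv].
exists h => //; split; [by exists g| |by case: hl].
move=> t; split; first exact: hs.
move=> /gs; congr (Yt _); apply/fsetP => w; apply/imfsetP/idP => /=.
  by move=> [x /imfsetP[y /= yt ->] ->]; rewrite gh.
by move=> wt; exists (h w); rewrite ?gh// in_imfset.
Qed.

Lemma deck_lift h : deck_transformation Yt p h -> simplicial_lift h.
Proof.
move=> [_ hY ph]; split=> // x y /hY; congr (Yt _).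
by rewrite imfsetU !imfset_fset1.
Qed.

Section Action.
Variables (Gamma : groupType) (act : Gamma -> W -> W).
Hypothesis act_deck : acts_by_deck act Yt p.

Lemma act_free g h w : act g w = act h w -> g = h.
Proof.
case: act_deck => _ _ deck inj _ e; apply: inj.
by apply: (@simplicial_lift_uniq _ _ w) => //; apply: deck_lift; exact: deck.
Qed.

Lemma act_transitive u v : p u = p v -> exists g, act g u = v.
Proof.
case: act_deck => _ _ _ _ surj /deck_ex[h hd hu].
by have [g hg] := surj h hd; exists g; rewrite -hg.
Qed.

End Action.

End Holonomy.

End Transport.

(** * Cohomology from an arbitrary free resolution *)

Section LinearPack.
Variables (C : nzRingType) (A B : lmodType C).

Lemma linear_pack (f : A -> B) : linear f -> exists f' : {linear A -> B}, f = f'.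
Proof.
move=> fl; pose f' : {linear A -> B} := HB.pack f (GRing.isLinear.Build C A B *:%R f fl).
by exists f'.
Qed.

Lemma linear_comp_fun (D : lmodType C) (f : A -> B) (g : D -> A) :
  linear f -> linear g -> linear (f \o g).
Proof. by move=> fl gl a x y /=; rewrite gl fl. Qed.

Lemma linear_sub_fun (f g : A -> B) : linear f -> linear g -> linear (fun x => f x - g x).
Proof. by move=> fl gl a x y; rewrite fl gl scalerBr opprD addrACA. Qed.

Lemma linear_add_fun (f g : A -> B) : linear f -> linear g -> linear (fun x => f x + g x).
Proof. by move=> fl gl a x y; rewrite fl gl scalerDr addrACA. Qed.

End LinearPack.

Section FreeModLift.
Variables (R : realType) (Gamma : groupType) (Y : choiceType).
Local Notation M := (free_mod R Gamma Y).
Implicit Types (m : M) (N : lmodType R[i]).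

Definition fm_supp m : {fset Gamma * Y} := fset_set [set k | m k != 0].

Lemma in_fm_supp m k : (k \in fm_supp m) = (m k != 0).
Proof.
have mf : finite_set [set k | m k != 0] by case: m => m /= /asboolP.
by rewrite in_fset_set//; apply/idP/idP => [/set_mem|mk]; last exact/mem_set.
Qed.

Definition fm_lift N (phi : Gamma * Y -> N) m : N := \sum_(k <- fm_supp m) m k *: phi k.

Lemma fm_liftE N (phi : Gamma * Y -> N) m (A : {fset Gamma * Y}) :
  (forall k, m k != 0 -> k \in A) -> fm_lift phi m = \sum_(k <- A) m k *: phi k.
Proof.
move=> mA; apply: big_fset_incl; first by apply/fsubsetP => k; rewrite in_fm_supp => /mA.
by move=> k _; rewrite in_fm_supp negbK => /eqP ->; rewrite scale0r.
Qed.

Lemma fm_lift_linear N (phi : Gamma * Y -> N) : linear (fm_lift phi).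
Proof.
move=> a m1 m2; pose A := (fm_supp m1 `|` fm_supp m2)%fset.
have E k : (a *: m1 + m2) k = a * m1 k + m2 k by [].
rewrite !(@fm_liftE N phi _ A) => [|k mk|k mk|].
- rewrite scaler_sumr -big_split; apply: eq_bigr => k _ /=.
  transitivity ((a * m1 k + m2 k) *: phi k); first by congr (_ *: _); exact: E.
  by rewrite scalerDl scalerA.
- by apply/fsetUP; right; rewrite in_fm_supp; exact: mk.
- by apply/fsetUP; left; rewrite in_fm_supp; exact: mk.
- move=> k mk; apply/fsetUP/orP; rewrite !in_fm_supp -negb_and.
  apply: contraNN mk => /andP[/eqP m10 /eqP m20].
  by apply/eqP; rewrite [LHS](E k) m10 m20 mulr0 addr0.
Qed.

Lemma fm_sumE (J : Type) (r : seq J) (f : J -> M) k :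
  (\sum_(j <- r) f j) k = \sum_(j <- r) f j k.
Proof. by elim: r => [|j r IH]; rewrite ?big_nil// !big_cons -IH. Qed.

Lemma fm_actE g m k : fm_act g m k = m ((g^-1 * k.1)%g, k.2).
Proof. by []. Qed.

Lemma fm_act_basisE g (y : Y) (k : Gamma * Y) : fm_act g (fm_basis R Gamma y) k = (k == (g, y))%:R.
Proof.
rewrite fm_actE /=; case: k => h z /=; rewrite !xpair_eqE; congr ((_ && _)%:R).
apply/eqP/eqP => [e|->]; last by rewrite mulVg.
by rewrite -[h]mul1g -(mulgV g) -mulgA e mulg1.
Qed.

Lemma fm_lift_act_basis N (phi : Gamma * Y -> N) g y :
  fm_lift phi (fm_act g (fm_basis R Gamma y)) = phi (g, y).
Proof.
rewrite (@fm_liftE _ _ _ [fset (g, y)]%fset).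
  by rewrite big_seq_fset1 fm_act_basisE eqxx scale1r.
move=> k; rewrite fm_act_basisE => kb; apply/fset1P.
by move: kb; case: (k =P (g, y)) => //; rewrite eqxx.
Qed.

Lemma fm_dec m : m = fm_lift (fun k => fm_act k.1 (fm_basis R Gamma k.2)) m.
Proof.
apply: val_inj; apply/funext => k; rewrite /= /fm_lift fm_sumE.
transitivity (\sum_(j <- fm_supp m) m j * (k == j)%:R); last first.
  apply: eq_bigr => j _.
  transitivity (m j * fm_act j.1 (fm_basis R Gamma j.2) k); last by [].
  by rewrite fm_act_basisE -surjective_pairing.
have [km|] := boolP (k \in fm_supp m).
  rewrite (big_fsetD1 k)//= eqxx mulr1 big_seq big1 ?addr0// => j.
  by rewrite !inE eq_sym => /andP[/negbTE ->]; rewrite mulr0.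
rewrite in_fm_supp negbK => /eqP mk; rewrite mk big_seq big1// => j.
rewrite in_fm_supp => mj; case: eqP => [kj|]; last by rewrite mulr0.
by rewrite -kj mk eqxx in mj.
Qed.

Lemma linear_fm_dec N (f : M -> N) : linear f -> forall m,
  f m = \sum_(k <- fm_supp m) m k *: f (fm_act k.1 (fm_basis R Gamma k.2)).
Proof.
move=> /linear_pack[h ->] m; rewrite {1}(fm_dec m) /fm_lift linear_sum.
by apply: eq_bigr => k _; rewrite linearZ.
Qed.

Lemma fm_linear_ext N (f f' : M -> N) : linear f -> linear f' ->
  (forall g y, f (fm_act g (fm_basis R Gamma y)) = f' (fm_act g (fm_basis R Gamma y))) ->
  f = f'.
Proof.
move=> /linear_pack[h ->] /linear_pack[h' ->] hh'; apply/funext => m.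
rewrite (fm_dec m) /fm_lift !linear_sum; apply: eq_bigr => k _.
by rewrite !linearZ hh'.
Qed.

Lemma fm_act_linear g : linear (@fm_act R Gamma Y g).
Proof. by move=> a m1 m2; apply: val_inj. Qed.

Lemma fm_act1 m : fm_act 1%g m = m.
Proof. by apply: val_inj; apply/funext => -[h y] /=; rewrite invg1 mul1g. Qed.

Lemma fm_actM g h m : fm_act (g * h)%g m = fm_act g (fm_act h m).
Proof. by apply: val_inj; apply/funext => -[k y] /=; rewrite invgM mulgA. Qed.

Section Equivariant.
Variables (N : lmodType R[i]) (aN : Gamma -> N -> N).

Definition fm_hom (f : M -> N) := linear f /\ forall g m, f (fm_act g m) = aN g (f m).

Lemma fm_hom_ext (f f' : M -> N) : fm_hom f -> fm_hom f' ->
  (forall y, f (fm_basis R Gamma y) = f' (fm_basis R Gamma y)) -> f = f'.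
Proof.
move=> [fl fe] [f'l f'e] h; apply: fm_linear_ext => // g y.
by rewrite fe f'e h.
Qed.

Hypothesis aN_lin : forall g, linear (aN g).
Hypothesis aN1 : forall x, aN 1%g x = x.
Hypothesis aNM : forall g h x, aN (g * h)%g x = aN g (aN h x).

Lemma fm_hom_ex (phi : Y -> N) : exists2 f, fm_hom f &
  forall y, f (fm_basis R Gamma y) = phi y.
Proof.
pose f := fm_lift (fun k : Gamma * Y => aN k.1 (phi k.2)).
have fb g y : f (fm_act g (fm_basis R Gamma y)) = aN g (phi y).
  by rewrite /f fm_lift_act_basis.
have fl : linear f by exact: fm_lift_linear.
exists f; last by move=> y; rewrite -[fm_basis _ _ _]fm_act1 fb aN1.
split=> // g m.
suff /(congr1 (fun k => k m)) : f \o fm_act g = aN g \o f by [].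
apply: fm_linear_ext.
- by apply: linear_comp_fun => //; exact: fm_act_linear.
- by apply: linear_comp_fun.
- by move=> h y /=; rewrite -fm_actM !fb aNM.
Qed.

Lemma fm_hom_sub (f f' : M -> N) : fm_hom f -> fm_hom f' -> fm_hom (fun m => f m - f' m).
Proof.
move=> [fl fe] [f'l f'e]; split; first exact: linear_sub_fun.
move=> g m; rewrite fe f'e; have [h ->] := linear_pack (aN_lin g).
by rewrite linearB.
Qed.

Lemma fm_hom_add (f f' : M -> N) : fm_hom f -> fm_hom f' -> fm_hom (fun m => f m + f' m).
Proof.
move=> [fl fe] [f'l f'e]; split; first exact: linear_add_fun.
move=> g m; rewrite fe f'e; have [h ->] := linear_pack (aN_lin g).
by rewrite linearD.
Qed.

End Equivariant.

(** Projectivity of free modules, assuming only that the image of f lies in the image of d, which is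
    what exactness provides. *)
Lemma fm_projective (N N' : lmodType R[i]) (aN : Gamma -> N -> N) (aN' : Gamma -> N' -> N')
    (f : M -> N') (d : N -> N') :
  (forall g, linear (aN g)) -> (forall x, aN 1%g x = x) ->
  (forall g h x, aN (g * h)%g x = aN g (aN h x)) ->
  fm_hom aN' f -> linear d -> (forall g x, d (aN g x) = aN' g (d x)) ->
  (forall m, exists b, d b = f m) ->
  exists2 h, fm_hom aN h & forall m, d (h m) = f m.
Proof.
move=> aNl aN1 aNM fh dl de df.
have /choice[phi phiP] y := df (fm_basis R Gamma y).
have [h hh hphi] := fm_hom_ex aNl aN1 aNM phi.
exists h => // m; suff /(congr1 (fun k => k m)) : d \o h = f by [].
apply: (@fm_hom_ext _ aN') => //.
  split; first by apply: linear_comp_fun; case: hh.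
  by move=> g m' /=; rewrite hh.2 de.
by move=> y /=; rewrite hphi phiP.
Qed.

End FreeModLift.

Lemma fm_hom_comp (R : realType) (Gamma : groupType) (Y Y' : choiceType)
    (N : lmodType R[i]) (aN : Gamma -> N -> N)
    (f : free_mod R Gamma Y' -> N) (g : free_mod R Gamma Y -> free_mod R Gamma Y') :
  fm_hom aN f -> fm_hom (@fm_act R Gamma Y') g -> fm_hom aN (f \o g).
Proof.
move=> [fl fe] [gl ge]; split; first exact: linear_comp_fun.
by move=> k m /=; rewrite ge fe.
Qed.

(** * Comparison of free resolutions *)

Section Resolutions.
Variables (R : realType) (Gamma : groupType).
Implicit Types (F : free_resolution R Gamma).
Local Notation M F l := (free_mod R Gamma (res_basis F l)).
Local Notation act := (@fm_act R Gamma _).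

Definition res_cycle F l : M F l -> Prop :=
  match l with
  | 0 => fun m => res_aug m = 0
  | l'.+1 => fun m => res_d F l' m = 0
  end.

Lemma res_cycleP F l (m : M F l) : res_cycle m <-> exists b, res_d F l b = m.
Proof.
case: l m => [|l] m /=.
  have := res_exact0 F; rewrite predeqE => /(_ m) -[h1 h2].
  by split=> [/h1[b _ <-]|[b bm]]; [exists b|apply: h2; exists b].
have := res_exactS F l; rewrite predeqE => /(_ m) -[h1 h2].
by split=> [/h1[b _ <-]|[b bm]]; [exists b|apply: h2; exists b].
Qed.

Lemma res_dd F l m : res_d F l (res_d F l.+1 m) = 0.
Proof. by have : res_cycle (res_d F l.+1 m) by apply/res_cycleP; exists m. Qed.

Lemma res_d_hom F l : fm_hom act (@res_d _ _ F l).
Proof. by split; [exact: res_d_linear|exact: res_d_equiv]. Qed.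

Definition chain_map F F' (f : forall l, M F l -> M F' l) :=
  [/\ forall l, fm_hom act (f l), forall m, res_aug (f 0%N m) = res_aug m &
      forall l m, res_d F' l (f l.+1 m) = f l (res_d F l m)].

Lemma res_linear0 (N N' : lmodType R[i]) (f : N -> N') : linear f -> f 0 = 0.
Proof. by move=> /linear_pack[h ->]; rewrite linear0. Qed.

Lemma res_linearB (N N' : lmodType R[i]) (f : N -> N') x y : linear f -> f (x - y) = f x - f y.
Proof. by move=> /linear_pack[h ->]; rewrite linearB. Qed.

Lemma res_linearD (N N' : lmodType R[i]) (f : N -> N') x y : linear f -> f (x + y) = f x + f y.
Proof. by move=> /linear_pack[h ->]; rewrite linearD. Qed.

Lemma chain_map_ex F F' : exists f : forall l, M F l -> M F' l, chain_map f.
Proof.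
(* The recursion carries preservation of cycles along: by exactness, this is what makes f (d m) a
   boundary, so that the next map can be lifted. *)
pose P l (f : M F l -> M F' l) := fm_hom act f /\
  forall m, res_cycle m -> res_cycle (f m).
have [f0 f0h f0a] : exists2 f0 : M F 0 -> M F' 0, fm_hom act f0 &
    forall m, res_aug (f0 m) = res_aug m.
  apply: (@fm_projective _ _ _ _ _ act (fun _ x => x)).
  - exact: fm_act_linear.
  - exact: fm_act1.
  - exact: fm_actM.
  - by split; [exact: res_aug_linear|exact: res_aug_equiv].
  - exact: res_aug_linear.
  - by move=> g x; rewrite res_aug_equiv.
  - move=> m; have := res_aug_surj F'; rewrite predeqE => /(_ (res_aug m)) [_ /(_ I)].
    by case=> b _ <-; exists b.
have P0 : P 0%N f0 by split=> // m /=; rewrite f0a.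
have step l (f : {f | P l f}) : exists f' : {f' | P l.+1 f'},
    forall m, res_d F' l (sval f' m) = sval f (res_d F l m).
  case: f => f [fh fc] /=.
  have [h hh hd] : exists2 h : M F l.+1 -> M F' l.+1, fm_hom act h &
      forall m, res_d F' l (h m) = f (res_d F l m).
    apply: (@fm_projective _ _ _ _ _ act act).
    - exact: fm_act_linear.
    - exact: fm_act1.
    - exact: fm_actM.
    - exact: fm_hom_comp fh (res_d_hom F l).
    - exact: res_d_linear.
    - by move=> g x; rewrite res_d_equiv.
    - by move=> m; apply/res_cycleP/fc/res_cycleP; exists m.
  have Ph : P l.+1 h.
    split=> // m /= dm; rewrite hd dm; apply: res_linear0; exact: fh.1.
  by exists (exist _ h Ph).
have stepP l : exists s : {f | P l f} -> {f' | P l.+1 f'},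
    forall f m, res_d F' l (sval (s f) m) = sval f (res_d F l m).
  by have /choice[s sP] := step l; exists s.
pose s l := sval (cid (stepP l)).
have sP l f m : res_d F' l (sval (s l f) m) = sval f (res_d F l m).
  by rewrite /s; case: cid.
pose f l := nat_rect (fun l => {f | P l f}) (exist _ f0 P0) (fun l f => s l f) l.
exists (fun l => sval (f l)); split=> [l|m|l m].
- by case: (f l) => h [].
- exact: f0a.
- exact: sP.
Qed.

Lemma chain_map_comp F F' F'' (f : forall l, M F' l -> M F'' l) (g : forall l, M F l -> M F' l) :
  chain_map f -> chain_map g -> chain_map (fun l => f l \o g l).
Proof.
move=> [fh fa fd] [gh ga gd]; split=> [l|m|l m] /=.
- exact: fm_hom_comp.
- by rewrite fa ga.
- by rewrite fd gd.
Qed.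

Lemma chain_map_id F : chain_map (fun l => @id (M F l)).
Proof. by []. Qed.

Lemma chain_homotopy F F' (f f' : forall l, M F l -> M F' l) :
  chain_map f -> chain_map f' ->
  exists h : forall l, M F l -> M F' l.+1, (forall l, fm_hom act (h l)) /\
    forall l m, f l.+1 m - f' l.+1 m = res_d F' l.+1 (h l.+1 m) + h l (res_d F l m).
Proof.
move=> [fh fa fd] [f'h f'a f'd].
(* This invariant makes f - f' - h d a cycle one degree higher, so that the next homotopy exists by
   exactness. *)
pose P l (h : M F l -> M F' l.+1) := fm_hom act h /\
  forall m, res_d F' l (h (res_d F l m)) = f l (res_d F l m) - f' l (res_d F l m).
have [h0 h0h h0d] : exists2 h0 : M F 0 -> M F' 1, fm_hom act h0 &
    forall m, res_d F' 0 (h0 m) = f 0%N m - f' 0%N m.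
  apply: (@fm_projective _ _ _ _ _ act act).
  - exact: fm_act_linear.
  - exact: fm_act1.
  - exact: fm_actM.
  - by apply: fm_hom_sub => //; exact: fm_act_linear.
  - exact: res_d_linear.
  - by move=> g x; rewrite res_d_equiv.
  - move=> m; apply/res_cycleP => /=.
    by rewrite res_linearB ?fa ?f'a ?subrr//; exact: res_aug_linear.
have P0 : P 0%N h0 by split=> // m; rewrite h0d.
have step l (h : {h | P l h}) : exists h' : {h' | P l.+1 h'},
    forall m, f l.+1 m - f' l.+1 m = res_d F' l.+1 (sval h' m) + sval h (res_d F l m).
  case: h => h [hh hd] /=.
  have [k kh kd] : exists2 k : M F l.+1 -> M F' l.+2, fm_hom act k &
      forall m, res_d F' l.+1 (k m) = f l.+1 m - f' l.+1 m - h (res_d F l m).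
    apply: (@fm_projective _ _ _ _ _ act act).
    - exact: fm_act_linear.
    - exact: fm_act1.
    - exact: fm_actM.
    - apply: fm_hom_sub; first exact: fm_act_linear.
        by apply: fm_hom_sub => //; exact: fm_act_linear.
      exact: fm_hom_comp hh (res_d_hom F l).
    - exact: res_d_linear.
    - by move=> g x; rewrite res_d_equiv.
    - move=> m; apply/res_cycleP => /=.
      have dl := @res_d_linear _ _ F' l.
      by rewrite !(res_linearB _ _ dl) fd f'd hd subrr.
  have Pk : P l.+1 k.
    by split=> // m; rewrite kd res_dd (res_linear0 hh.1) subr0.
  by exists (exist _ k Pk) => m /=; rewrite kd subrK.
have stepP l : exists s : {h | P l h} -> {h' | P l.+1 h'}, forall h m,
    f l.+1 m - f' l.+1 m = res_d F' l.+1 (sval (s h) m) + sval h (res_d F l m).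
  by have /choice[s sP] := step l; exists s.
pose s l := sval (cid (stepP l)).
have sP l h m : f l.+1 m - f' l.+1 m = res_d F' l.+1 (sval (s l h) m) + sval h (res_d F l m).
  by rewrite /s; case: cid => s' s'P; exact: s'P.
pose h l := nat_rect (fun l => {h | P l h}) (exist _ h0 P0) (fun l h => s l h) l.
exists (fun l => sval (h l)); split=> [l|l m]; last exact: sP.
by case: (h l) => k [].
Qed.

End Resolutions.

Section PtwsNormed.
Variables (R : realType) (Y : choiceType) (V : normedModType R[i]).
Implicit Types (x : {ptws Y -> V}).

Lemma rnorm_lt (v : V) (e : R) : (rnorm v < e) = (`|v| < e%:C%C).
Proof. by rewrite -rnormE ltcR. Qed.

Lemma nbhs_rnorm (T : topologicalType) (f : T -> V) t (e : R) : 0 < e ->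
  continuous f -> \forall t' \near t, rnorm (f t - f t') < e.
Proof.
move=> e0 fc; have e0' : 0 < e%:C%C by rewrite ltcR.
have /cvgr_dist_lt/(_ _ e0') := @fc t.
by apply: filterS => t'; rewrite rnorm_lt.
Qed.

Lemma nbhs_rnorm_box (T : topologicalType) (f : Y -> T -> V) t (e : R) (ys : seq Y) : 0 < e ->
  (forall y, continuous (f y)) ->
  \forall t' \near t, forall y, y \in ys -> rnorm (f y t - f y t') < e.
Proof.
move=> e0 fc; elim: ys => [|y ys IH]; first exact: nearW.
have h := nbhs_rnorm t e0 (fc y).
near=> t' => v; rewrite inE => /orP[/eqP->|vU]; first by near: t'.
by move: v vU; near: t'.
Unshelve. all: by end_near. Qed.

Lemma ptws_nbhs_rnorm_box x (O : set {ptws Y -> V}) : nbhs x O ->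
  exists (ys : seq Y) (e : R), 0 < e /\
    forall y : {ptws Y -> V}, (forall i, i \in ys -> rnorm (x i - y i) < e) -> O y.
Proof.
pose G := filter_from [set ye : seq Y * R | 0 < ye.2]
  (fun ye => [set y : {ptws Y -> V} | forall i, i \in ye.1 -> rnorm (x i - y i) < ye.2]).
have FG : Filter G.
  apply: filter_from_filter; first by exists ([::], 1) => /=.
  move=> [y1 e1] [y2 e2] /= e10 e20; exists (y1 ++ y2, Num.min e1 e2).
    by rewrite /= lt_min e10.
  move=> y /= h; split=> i iy; have := h i; rewrite mem_cat iy ?orbT => /(_ isT).
    by rewrite lt_min => /andP[].
  by rewrite lt_min => /andP[].
have Gx : G --> x.
  apply/cvg_sup => i U [Q] [[A oA <-] Aw] QU.
  have : nbhs (x i) A by exact: open_nbhs_nbhs.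
  move=> /nbhs_ballP[e /= e0 eA].
  have eE : e = (complex.Re e)%:C%C by rewrite RRe_real// gtr0_real.
  exists ([:: i], complex.Re e) => /=; first by rewrite -ltcR -eE.
  move=> y /= h; apply: QU; apply: eA; rewrite -ball_normE /ball_/= eE -rnorm_lt.
  by apply: h; rewrite mem_head.
by move=> /Gx[[ys e] /= e0 eO]; exists ys, e.
Qed.

End PtwsNormed.

(** * Independence of vanishing and reducedness from the resolution *)

Section Cohomology.
Variables (R : realType) (Gamma : groupType).
Variables (V : normedModType R[i]) (pi : unitary_rep Gamma V).
Implicit Types (F : free_resolution R Gamma).
Local Notation M F l := (free_mod R Gamma (res_basis F l)).
Local Notation act := (@fm_act R Gamma _).
Local Notation hom := (fm_hom (rep pi)).

Lemma rep_rnorm g v : rnorm (pi g v) = rnorm v.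
Proof. by rewrite /rnorm rep_norm. Qed.

(** Membership of the closure for pointwise convergence on the whole module instead of on a basis.
    Without reference to a basis it pulls back along chain maps. *)
Definition approx (T : eqType) (z : T -> V) (B : set (T -> V)) :=
  forall (ms : seq T) (e : R), 0 < e -> exists2 b, B b &
    forall m, m \in ms -> rnorm (z m - b m) < e.

Lemma approx_comp (T T' : eqType) (f : T' -> T) (z : T -> V) (B : set (T -> V))
    (B' : set (T' -> V)) : (forall b, B b -> B' (b \o f)) ->
  approx z B -> approx (z \o f) B'.
Proof.
move=> BB' zB ms e e0; have [b Bb bz] := zB (map f ms) e e0.
by exists (b \o f); [exact: BB'|move=> m mms /=; apply: bz; exact: map_f].
Qed.

Lemma rnorm_sum (T : eqType) (s : seq T) (f : T -> V) :
  rnorm (\sum_(x <- s) f x) <= \sum_(x <- s) rnorm (f x).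
Proof.
elim: s => [|x s IH]; first by rewrite !big_nil /rnorm normr0.
by rewrite !big_cons; apply: le_trans (rnormD _ _) _; rewrite lerD2l.
Qed.

Lemma approx_basis F l (z : M F l -> V) (B : set (M F l -> V)) :
  hom z -> (forall b, B b -> hom b) ->
  (forall (ys : seq (res_basis F l)) (e : R), 0 < e -> exists2 b, B b &
    forall y, y \in ys -> rnorm (z (fm_basis R Gamma y) - b (fm_basis R Gamma y)) < e) ->
  approx z B.
Proof.
move=> zh Bh H ms e e0.
pose nm (m : M F l) : R := \sum_(k <- fm_supp m) complex.Re `|m k|.
have Re0 (c : R[i]) : 0 <= complex.Re `|c| by rewrite -ler0c RRe_real ?normr_real.
have nm0 m : 0 <= nm m by apply: sumr_ge0 => k _; exact: Re0.
pose S := \sum_(m <- ms) nm m.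
have S0 : 0 <= S by apply: sumr_ge0.
pose ys := flatten [seq [seq k.2 | k <- enum_fset (fm_supp m)] | m <- ms].
(* [S] is the total l^1 norm of the coefficients of the elements of [ms]. As the action is
   isometric, an error e / (1 + S) on the basis vectors yields an error below e on each of these
   elements. *)
have e'0 : 0 < e / (1 + S) by rewrite divr_gt0// ltr_pwDl.
have [b Bb bz] := H ys _ e'0; exists b => // m mms.
have [zl ze] := zh; have [bl be] := Bh _ Bb.
pose c k := z (fm_basis R Gamma k) - b (fm_basis R Gamma k).
have -> : z m - b m = \sum_(k <- fm_supp m) m k *: pi k.1 (c k.2).
  rewrite (linear_fm_dec zl m) (linear_fm_dec bl m) -sumrB; apply: eq_bigr => k _.
  rewrite -scalerBr ze be; congr (_ *: _).
  by rewrite /c res_linearB//; exact: rep_linear.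
apply: le_lt_trans (rnorm_sum _ _) _.
apply: (@le_lt_trans _ _ (nm m * (e / (1 + S)))).
  rewrite /nm mulr_suml big_seq [leRHS]big_seq; apply: ler_sum => k km.
  rewrite rnormZ rep_rnorm; apply: ler_wpM2l => //; apply/ltW/bz.
  by apply/flattenP; exists [seq k.2 | k <- enum_fset (fm_supp m)]; apply: map_f.
rewrite mulrCA -[ltRHS]mulr1 ltr_pM2l// ltr_pdivrMr ?ltr_pwDl// mul1r.
apply: (@le_lt_trans _ _ S); last by rewrite ltrDr.
by rewrite /S (big_rem m)//= lerDl; apply: sumr_ge0.
Qed.

Local Notation cocyc F l := (@cocycles R Gamma F V pi l).
Local Notation cobound F l := (@coboundaries R Gamma F V pi l).

Lemma coboundary_hom F l b : cobound F l b -> hom b.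
Proof.
case: l b => [b ->|l b [c ch <-]].
  split=> [a x y|g m]; first by rewrite scaler0 addr0.
  by rewrite (res_linear0 (rep_linear pi g)).
exact: fm_hom_comp ch (res_d_hom F l).
Qed.

Lemma reducedP F l : cohomology_reduced F pi l <->
  forall z, cocyc F l z -> approx z (cobound F l) -> cobound F l z.
Proof.
split=> [red z zc za|H x [clx [z zc zx]]].
  have [|b Bb bz] := red (on_basis z).
    split; last by exists z.
    move=> O /ptws_nbhs_rnorm_box[ys [e [e0 eO]]].
    have [b Bb bz] := za (map (@fm_basis R Gamma _) ys) e e0.
    exists (on_basis b); split; first by exists b.
    by apply: eO => y yys; apply: bz; exact: map_f.
  rewrite (_ : z = b)//; apply: (@fm_hom_ext _ _ _ _ (rep pi)).
  - by case: zc.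
  - exact: coboundary_hom Bb.
  - by move=> y; rewrite -[RHS]/(on_basis b y) bz.
exists z => //; apply: H => //; apply: approx_basis.
- by case: zc.
- exact: coboundary_hom.
- move=> ys e e0; have [|_ [[b Bb <-] be]] := clx
    [set f | forall y, y \in ys -> rnorm (x y - f y) < e].
    apply: (@nbhs_rnorm_box _ _ _ {ptws res_basis F l -> V} (fun y f => f y)) => // y.
    exact: (@proj_continuous _ (fun=> V) y).
  by exists b => // y /be; rewrite -zx.
Qed.

Lemma coboundaryD F l b b' : cobound F l b -> cobound F l b' ->
  cobound F l (fun m => b m + b' m).
Proof.
case: l b b' => [b b' -> ->|l b b' [c ch <-] [c' ch' <-]] /=.
  by apply/funext => m; rewrite addr0.
exists (fun m => c m + c' m) => //; apply: fm_hom_add => //.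
exact: rep_linear.
Qed.

Lemma cocycle_pull F F' (f : forall l, M F l -> M F' l) l z : chain_map f ->
  cocyc F' l z -> cocyc F l (z \o f l).
Proof.
move=> [fh _ fd] [zh zd]; split; first exact: fm_hom_comp zh (fh l).
by apply/funext => m /=; rewrite -fd; exact: (congr1 (fun k => k (f l.+1 m)) zd).
Qed.

Lemma coboundary_pull F F' (f : forall l, M F l -> M F' l) l z : chain_map f ->
  cobound F' l z -> cobound F l (z \o f l).
Proof.
case: l z => [z _ ->//|l z [fh _ fd] [c ch <-]].
exists (c \o f l); first exact: fm_hom_comp ch (fh l).
by apply/funext => m /=; rewrite fd.
Qed.

Lemma cocycle_htpy F F' (f f' : forall l, M F l -> M F' l) l z :
  chain_map f -> chain_map f' -> cocyc F' l.+1 z ->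
  cobound F l.+1 (fun m => z (f l.+1 m) - z (f' l.+1 m)).
Proof.
move=> fc f'c [[zl ze] zd]; have [h [hh hd]] := chain_homotopy fc f'c.
exists (z \o h l); first exact: fm_hom_comp.
apply/funext => m /=; rewrite -res_linearB// hd res_linearD//.
by rewrite -[X in _ = X + _]/((z \o res_d F' l.+1) (h l.+1 m)) zd add0r.
Qed.

(** The composite of f and g is homotopic to the identity, so z differs from its pullback along it
    by a coboundary. *)
Lemma coboundary_htpy F F' (f : forall l, M F l -> M F' l) (g : forall l, M F' l -> M F l) l z :
  chain_map f -> chain_map g -> cocyc F l.+1 z ->
  cobound F' l.+1 (z \o g l.+1) -> cobound F l.+1 z.
Proof.
move=> fc gc zc /(coboundary_pull fc) bz.
have := coboundaryD (cocycle_htpy (chain_map_id F) (chain_map_comp gc fc) zc) bz.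
by congr (cobound F l.+1 _); apply/funext => m /=; rewrite subrK.
Qed.

Lemma cohomology_eq0P F l : cohomology_eq0 F pi l.+1 <->
  cocyc F l.+1 `<=` cobound F l.+1.
Proof.
split=> [<-//|h]; apply/seteqP; split=> // _ [c ch <-]; split.
  exact: fm_hom_comp ch (res_d_hom F l).
by apply/funext => m /=; rewrite res_dd (res_linear0 ch.1).
Qed.

Lemma cohomology_eq0_indep F F' l :
  cohomology_eq0 F' pi l.+1 -> cohomology_eq0 F pi l.+1.
Proof.
move=> /cohomology_eq0P h; apply/cohomology_eq0P => z zc.
have [f fc] := chain_map_ex F F'; have [g gc] := chain_map_ex F' F.
by apply: (coboundary_htpy fc gc zc); apply: h; exact: cocycle_pull gc zc.
Qed.

Lemma cohomology_reduced_indep F F' l :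
  cohomology_reduced F' pi l.+1 -> cohomology_reduced F pi l.+1.
Proof.
move=> /reducedP h; apply/reducedP => z zc za.
have [f fc] := chain_map_ex F F'; have [g gc] := chain_map_ex F' F.
apply: (coboundary_htpy fc gc zc); apply: h; first exact: cocycle_pull gc zc.
by apply: approx_comp za => b; exact: coboundary_pull.
Qed.

End Cohomology.

(** * Equivariant alternating cochains *)

Section TupleDifferential.
Variables (C : nzRingType) (W : choiceType) (N : lmodType C).

Definition cob k (c : k.-tuple W -> N) (t : k.+1.-tuple W) : N :=
  \sum_(i < k.+1) (-1) ^+ i *: c (tuple_face i t).

Lemma D_sum (phi : seq W -> N) t :
  D phi t = \sum_(i < size t) (-1) ^+ i *: phi (take i t ++ drop i.+1 t).
Proof.
elim: t phi => [|x t IH] phi; first by rewrite big_ord0.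
rewrite [LHS]/= IH big_ord_recl expr0 scale1r /= drop0 -sumrN; congr (_ + _).
by apply: eq_bigr => i _; rewrite exprS mulN1r scaleNr.
Qed.

Lemma val_tuple_face k (i : 'I_k.+1) (t : k.+1.-tuple W) :
  tval (tuple_face i t) = take i t ++ drop i.+1 t.
Proof.
have st : size (take i t ++ drop i.+1 t) = k.
  have ik : (i <= k)%N by rewrite -ltnS.
  by rewrite size_cat size_takel ?size_drop size_tuple ?subSS ?subnKC// ltnW.
have x0 := tnth t ord0.
apply: (@eq_from_nth _ x0); first by rewrite size_tuple st.
move=> j; rewrite size_tuple => jk.
rewrite -[j]/(nat_of_ord (Ordinal jk)) -tnth_nth tnth_mktuple (tnth_nth x0) /=.
have si : size (take i t) = i by rewrite size_takel// size_tuple ltnW.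
rewrite nth_cat si /bump leqNgt; case: (ltnP j i) => ij /=.
  by rewrite add0n nth_take.
by rewrite add1n nth_drop addSn subnKC.
Qed.

Lemma D_cob k (phi : seq W -> N) (t : k.+1.-tuple W) :
  D phi t = cob (fun u : k.-tuple W => phi u) t.
Proof.
rewrite D_sum size_tuple; apply: eq_bigr => i _; congr (_ *: phi _).
by rewrite val_tuple_face.
Qed.

Definition alternating_fun k (c : k.-tuple W -> N) :=
  forall s t, c (tuple_perm s t) = (-1) ^+ odd_perm s *: c t.

Lemma tuple_permM k (s s' : 'S_k) (t : k.-tuple W) :
  tuple_perm s (tuple_perm s' t) = tuple_perm (s * s')%g t.
Proof. by apply: eq_from_tnth => i; rewrite !tnth_mktuple permM. Qed.

Lemma tuple_face_lift_perm k (i j : 'I_k.+1) (s : 'S_k) (t : k.+1.-tuple W) :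
  tuple_face i (tuple_perm (lift_perm i j s) t) = tuple_perm s (tuple_face j t).
Proof. by apply: eq_from_tnth => a; rewrite !tnth_mktuple lift_perm_lift. Qed.

(** Deleting i from the source and j from the target is a bijection from the permutations taking i
    to j onto those of k letters. *)
Lemma reindex_lift_perm k (i j : 'I_k.+1) (F : 'S_k.+1 -> N) :
  \sum_(s : 'S_k.+1 | s i == j) F s = \sum_(s : 'S_k) F (lift_perm i j s).
Proof.
rewrite (reindex (lift_perm i j)) /=.
  by apply: eq_bigl => s; rewrite lift_perm_id eqxx.
have unl (s : 'S_k.+1) : s i = j -> forall a, exists b, s (lift i a) = lift j b.
  move=> si a; have : j != s (lift i a) by rewrite -si (can_eq (permK s)) neq_lift.
  by case/unlift_some => b -> _; exists b.
pose f (s : 'S_k.+1) a := odflt a (unlift j (s (lift i a))).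
have f_inj (s : 'S_k.+1) : s i = j -> injective (f s).
  move=> si a b; have [a' ea] := unl s si a; have [b' eb] := unl s si b.
  rewrite /f ea eb !liftK /= => ab; apply: (@lift_inj _ i); apply: (@perm_inj _ s).
  by rewrite ea eb ab.
pose g (s : 'S_k.+1) : 'S_k := if s i =P j is ReflectT si then perm (f_inj s si) else 1%g.
exists g => [s _|s].
  apply/permP => a; rewrite /g; case: eqP => [si|]; last by rewrite lift_perm_id.
  by rewrite permE /f lift_perm_lift liftK.
rewrite inE => /eqP si; apply/permP => a.
case: (unliftP i a) => [b|] ->; last by rewrite lift_perm_id.
rewrite lift_perm_lift /g; case: eqP => // si'; rewrite permE /f.
by have [c ->] := unl s si b; rewrite liftK.
Qed.

End TupleDifferential.

Section Alternation.
Variables (R : realType) (W : choiceType) (N : lmodType R[i]).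

Definition alt k (c : k.-tuple W -> N) (t : k.-tuple W) : N :=
  (k`!)%:R^-1 *: \sum_(s : 'S_k) (-1) ^+ odd_perm s *: c (tuple_perm s t).

Lemma alt_alternating k (c : k.-tuple W -> N) : alternating_fun (alt c).
Proof.
move=> s t; rewrite /alt [RHS]scalerA mulrC -scalerA; congr (_ *: _).
rewrite scaler_sumr [RHS](reindex_inj (mulIg s)); apply: eq_bigr => s' _ /=.
by rewrite tuple_permM scalerA odd_permM signr_addb mulrCA -expr2 sqrr_sign mulr1.
Qed.

Lemma alt_id k (c : k.-tuple W -> N) : alternating_fun c -> alt c =1 c.
Proof.
move=> ca t; rewrite /alt (eq_bigr (fun=> c t)) => [|s _]; last first.
  by rewrite ca scalerA -expr2 sqrr_sign scale1r.
by rewrite sumr_const card_Sn -[c t *+ _]scaler_nat scalerA mulVf ?scale1r// pnatr_eq0 -lt0n fact_gt0.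
Qed.

(** Group the permutations s by j = s i. The sign of [lift_perm i j s] is that of s times (-1)^(i +
    j), which cancels the sign of face i and leaves a sum [G] not depending on i; the k + 1 equal
    contributions turn 1/(k + 1)! into 1/k!. *)
Lemma alt_cob k (c : k.-tuple W -> N) t : alt (cob c) t = cob (alt c) t.
Proof.
rewrite /alt /cob; under eq_bigr do rewrite scaler_sumr.
rewrite exchange_big/=.
pose G := \sum_(j < k.+1) \sum_(s : 'S_k)
  (-1) ^+ j *: ((-1) ^+ odd_perm s *: c (tuple_perm s (tuple_face j t))).
rewrite (eq_bigr (fun=> G)) => [|i _]; last first.
  rewrite (partition_big (fun s : 'S_k.+1 => s i) xpredT)//=; apply: eq_bigr => j _.
  rewrite reindex_lift_perm; apply: eq_bigr => s _.
  rewrite tuple_face_lift_perm !scalerA odd_lift_perm; congr (_ *: _).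
  rewrite !signr_addb (signr_odd _ i) (signr_odd _ j) mulrC !mulrA -expr2.
  by rewrite sqrr_sign mul1r.
rewrite sumr_const card_ord -[G *+ _]scaler_nat scalerA /G scaler_sumr; apply: eq_bigr => j _.
rewrite -scaler_sumr scalerA [RHS]scalerA; congr (_ *: _).
have -> : (k.+1`!)%:R^-1 * k.+1%:R = (k`!)%:R^-1 :> R[i].
  by rewrite factS natrM invfM mulrC mulrA mulfV ?mul1r ?pnatr_eq0.
exact: mulrC.
Qed.

End Alternation.

(** * The free resolution by ordered simplices of the universal cover *)

Section OrderedResolution.
Variables (R : realType) (Gamma : groupType) (V W : choiceType).
Variables (Y : scomplex V) (Yt : scomplex W) (p : W -> V).
Hypothesis cov : simplicial_covering Y Yt p.
Hypothesis Yt_contr : contractible R (realization R Yt).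
Variable act : Gamma -> W -> W.
Hypothesis act_deck : acts_by_deck act Yt p.

Local Notation spx := (spans_spx Yt).

Definition tact k (g : Gamma) (t : k.-tuple W) : k.-tuple W := map_tuple (act g) t.

Lemma tact1 k (t : k.-tuple W) : tact 1%g t = t.
Proof.
case: act_deck => a1 _ _ _ _; apply: eq_from_tnth => i.
by rewrite tnth_map a1.
Qed.

Lemma tactM k g h (t : k.-tuple W) : tact (g * h)%g t = tact g (tact h t).
Proof.
case: act_deck => _ aM _ _ _; apply: eq_from_tnth => i.
by rewrite !tnth_map aM.
Qed.

Lemma tact_free k g h (t : k.+1.-tuple W) : tact g t = tact h t -> g = h.
Proof.
move=> /(congr1 (fun u => tnth u ord0)); rewrite !tnth_map.
exact: (act_free cov Yt_contr act_deck).
Qed.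

Lemma spx_act g t : spx (map (act g) t) <-> spx t.
Proof.
case: act_deck => _ _ /(_ g)[_ dg _] _ _; rewrite /spans_spx [in X in _ <-> X]dg.
rewrite (_ : [fset act g w | w in [fset w in t]]%fset = [fset w in map (act g) t]%fset)//.
apply/fsetP => w; rewrite !inE; apply/imfsetP/mapP => /=.
  by move=> [x]; rewrite inE => xt ->; exists x.
by move=> [x xt ->]; exists x; rewrite // inE.
Qed.

Lemma spx_tact k g (t : k.-tuple W) : spx (tact g t) <-> spx t.
Proof. exact: spx_act. Qed.

Definition torbit k (t : k.-tuple W) : set (k.-tuple W) := [set tact g t | g in setT].

Lemma torbit_act k g (t : k.-tuple W) : torbit (tact g t) = torbit t.
Proof.
apply/seteqP; split=> _ [h _ <-].
  by exists (h * g)%g; rewrite // tactM.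
by exists (h * g^-1)%g; rewrite // -tactM -mulgA mulVg mulg1.
Qed.

(** The default is never reached, as an orbit is nonempty; hence the choice depends on the orbit
    alone. *)
Definition trep k (t : k.-tuple W) : k.-tuple W := xget t (torbit t).

Lemma trep_orbit k (t : k.-tuple W) : exists g, tact g (trep t) = t.
Proof.
have [g _ <-] : torbit t (trep t) by apply: xgetPex; exists t; exists 1%g; rewrite ?tact1.
by exists g^-1%g; rewrite -tactM mulVg tact1.
Qed.

Lemma trep_act k g (t : k.-tuple W) : trep (tact g t) = trep t.
Proof.
rewrite /trep torbit_act /xget; case: pselect => //= h; exfalso; apply: h.
by exists t; apply/asboolP; exists 1%g; rewrite ?tact1.
Qed.

Definition is_rep l (t : l.+1.-tuple W) : bool := `[< spx t /\ trep t = t >].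

(** One ordered simplex per orbit, repeated vertices allowed. These form a basis over the group ring
    because the action on nonempty tuples is free ([tact_free]). *)
Definition obasis l : choiceType := {t : l.+1.-tuple W | is_rep t}.

Lemma obasisP l (b : obasis l) : spx (val b) /\ trep (val b) = val b.
Proof. by case: b => t /= /asboolP. Qed.

Local Notation fr l := (free_mod R Gamma (obasis l)).

Definition tgrp k (t : k.-tuple W) : Gamma := xget 1%g [set g | tact g (trep t) = t].

Lemma tgrpP k (t : k.-tuple W) : tact (tgrp t) (trep t) = t.
Proof. by rewrite /tgrp; apply: (xgetPex 1%g (trep_orbit t)). Qed.

(* The ordered simplex t as an element of the free module on orbit representatives *)
(* (0 if t does not span a simplex).                                               *)
Definition elt l (t : l.+1.-tuple W) : fr l :=
  if insub (trep t) is Some b then fm_act (tgrp t) (fm_basis R Gamma b) else 0.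

Lemma spx_trep l (t : l.+1.-tuple W) : spx t -> is_rep (trep t).
Proof.
move=> st; apply/asboolP; have [g gt] := trep_orbit t; split.
  by rewrite -(spx_tact g) gt.
by rewrite -[in RHS]gt trep_act.
Qed.

Lemma elt_out l (t : l.+1.-tuple W) : ~ spx t -> elt t = 0.
Proof.
move=> st; rewrite /elt; case: insubP => //= b /asboolP[+ _] _.
by have [g gt] := trep_orbit t; rewrite -(spx_tact g) gt.
Qed.

Lemma elt_act l g (t : l.+1.-tuple W) : elt (tact g t) = fm_act g (elt t).
Proof.
rewrite /elt trep_act; case: insubP => [b _ bt|_]; last by apply: val_inj.
rewrite -fm_actM; congr (fm_act _ _); apply: (@tact_free l _ _ (trep t)).
by rewrite tactM tgrpP -(trep_act g) tgrpP.
Qed.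

Lemma elt_basis l (b : obasis l) : elt (val b) = fm_basis R Gamma b.
Proof.
have [sb rb] := obasisP b; rewrite /elt rb valK -[RHS]fm_act1; congr (fm_act _ _).
by apply: (@tact_free l _ _ (val b)); rewrite tact1 -{2}rb tgrpP.
Qed.

Lemma elt_tup l g (b : obasis l) : elt (tact g (val b)) = fm_act g (fm_basis R Gamma b).
Proof. by rewrite elt_act elt_basis. Qed.

Lemma elt_spx l (t : l.+1.-tuple W) : spx t -> exists g (b : obasis l), t = tact g (val b).
Proof. by move=> /spx_trep tr; exists (tgrp t), (Sub (trep t) tr); rewrite SubK tgrpP. Qed.

Lemma hom_elt_ext l (N : lmodType R[i]) (f f' : fr l -> N) : linear f -> linear f' ->
  (forall t : l.+1.-tuple W, spx t -> f (elt t) = f' (elt t)) -> f = f'.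
Proof.
move=> fl f'l h; apply: fm_linear_ext => // g b; rewrite -elt_tup h//.
by rewrite spx_tact; case: (obasisP b).
Qed.

Lemma elt_lift l (N : lmodType R[i]) (phi : l.+1.-tuple W -> N) :
  exists2 f : fr l -> N, linear f & forall t : l.+1.-tuple W, spx t -> f (elt t) = phi t.
Proof.
exists (fm_lift (fun k : Gamma * obasis l => phi (tact k.1 (val k.2)))).
  exact: fm_lift_linear.
by move=> t /elt_spx[g [b ->]]; rewrite elt_tup fm_lift_act_basis.
Qed.

Lemma elt_hom l (N : lmodType R[i]) (aN : Gamma -> N -> N) (phi : l.+1.-tuple W -> N) :
  (forall g, linear (aN g)) -> (forall x, aN 1%g x = x) ->
  (forall g h x, aN (g * h)%g x = aN g (aN h x)) ->
  (forall g (t : l.+1.-tuple W), spx t -> phi (tact g t) = aN g (phi t)) ->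
  exists2 f : fr l -> N, fm_hom aN f & forall t : l.+1.-tuple W, spx t -> f (elt t) = phi t.
Proof.
move=> al a1 aM phie.
have [f fh fb] := fm_hom_ex al a1 aM (fun b : obasis l => phi (val b)).
exists f => // t /elt_spx[g [b ->]].
by rewrite elt_tup fh.2 fb phie//; case: (obasisP b).
Qed.

Definition elts l (u : seq W) : fr l :=
  if insub u is Some t then elt (t : l.+1.-tuple W) else 0.

Lemma elts_tuple l (t : l.+1.-tuple W) : elts l t = elt t.
Proof. by rewrite /elts valK. Qed.

Lemma spx_face k (t : k.+2.-tuple W) i : spx t -> spx (tuple_face i t).
Proof.
move=> st; apply: (spans_sub st); first by rewrite size_tuple.
by move=> w /tnthP[j ->]; rewrite tnth_mktuple inE mem_tnth.
Qed.

Lemma tact_face k g (t : k.+1.-tuple W) i : tuple_face i (tact g t) = tact g (tuple_face i t).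
Proof. by apply: eq_from_tnth => j; rewrite !(tnth_mktuple, tnth_map). Qed.

Lemma od_ex l : exists2 f : fr l.+1 -> fr l, fm_hom (@fm_act R Gamma _) f &
  forall t : l.+2.-tuple W, spx t -> f (elt t) = cob (@elt l) t.
Proof.
apply: elt_hom; [exact: fm_act_linear|exact: fm_act1|exact: fm_actM|].
move=> g t st; have [h hE] := linear_pack (@fm_act_linear R Gamma (obasis l) g).
rewrite hE linear_sum; apply: eq_bigr => i _.
by rewrite linearZ -hE tact_face elt_act.
Qed.

Definition od l : fr l.+1 -> fr l := sval (cid2 (od_ex l)).

Lemma od_hom l : fm_hom (@fm_act R Gamma _) (@od l).
Proof. by rewrite /od; case: cid2. Qed.

Lemma od_elt l (t : l.+2.-tuple W) : spx t -> od (elt t) = cob (@elt l) t.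
Proof. by rewrite /od; case: cid2 => /= f _ h /h. Qed.

Lemma oaug_ex : exists2 f : fr 0 -> R[i]^o, fm_hom (fun (_ : Gamma) (x : R[i]^o) => x) f &
  forall t : 1.-tuple W, spx t -> f (elt t) = 1.
Proof. by apply: elt_hom. Qed.

Definition oaug : fr 0 -> R[i]^o := sval (cid2 oaug_ex).

Lemma oaug_hom : fm_hom (fun (_ : Gamma) (x : R[i]^o) => x) oaug.
Proof. by rewrite /oaug; case: cid2. Qed.

Lemma oaug_elt (t : 1.-tuple W) : spx t -> oaug (elt t) = 1.
Proof. by rewrite /oaug; case: cid2 => /= f _ h /h. Qed.

Lemma cob_lin k (N N' : lmodType R[i]) (f : N -> N') (c : k.-tuple W -> N) t :
  linear f -> f (cob c t) = cob (f \o c) t.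
Proof.
by move=> /linear_pack[h ->]; rewrite linear_sum; apply: eq_bigr => i _; rewrite linearZ.
Qed.

Lemma cob_elts k (N : lmodType R[i]) (c : k.-tuple W -> N) t :
  cob c t = D (fun u => if insub u is Some t then c t else 0) t.
Proof.
by rewrite D_cob; apply: eq_bigr => i _; rewrite valK.
Qed.

Lemma cob_cob k (N : lmodType R[i]) (c : k.-tuple W -> N) t : cob (cob c) t = 0.
Proof.
pose c' u := if insub u is Some t then c t else 0.
rewrite -(DD c' t) D_cob; apply: eq_bigr => i _; congr (_ *: _).
exact: cob_elts.
Qed.

Lemma eq_cob k (N : lmodType R[i]) (c c' : k.+1.-tuple W -> N) (t : k.+2.-tuple W) : spx t ->
  (forall t : k.+1.-tuple W, spx t -> c t = c' t) -> cob c t = cob c' t.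
Proof.
by move=> st h; apply: eq_bigr => i _; rewrite h//; exact: spx_face.
Qed.

Lemma odd0 l m : od (@od l.+1 m) = 0.
Proof.
suff /(congr1 (fun f => f m)) : @od l \o @od l.+1 = fun=> 0 by [].
apply: hom_elt_ext.
- by apply: linear_comp_fun; [case: (od_hom l)|case: (od_hom l.+1)].
- by move=> a x y; rewrite scaler0 addr0.
- move=> t st /=; rewrite od_elt// cob_lin; last by case: (od_hom l).
  rewrite -[RHS](cob_cob (@elt l) t); apply: eq_cob => // u su.
  by rewrite /= od_elt.
Qed.

Lemma oaugd0 m : oaug (@od 0 m) = 0.
Proof.
suff /(congr1 (fun f => f m)) : oaug \o @od 0 = fun=> 0 by [].
apply: hom_elt_ext.
- by apply: linear_comp_fun; [case: oaug_hom|case: (od_hom 0)].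
- by move=> a x y; rewrite scaler0 addr0.
- move=> t st /=; rewrite od_elt// cob_lin; last by case: oaug_hom.
  rewrite /cob !big_ord_recl big_ord0 /= !oaug_elt; try exact: spx_face.
  by rewrite expr0 expr1 scale1r scaleN1r addr0 subrr.
Qed.

Definition fsum_of l (m : fr l) : fsum R[i] (seq W) :=
  [seq (m k, tval (tact k.1 (val k.2))) | k <- enum_fset (fm_supp m)].

Lemma ev_fsum_of l (m : fr l) (N : lmodType R[i]) (f : fr l -> N) (phi : seq W -> N) :
  linear f -> (forall t : l.+1.-tuple W, spx t -> f (elt t) = phi t) ->
  ev (fsum_of m) phi = f m.
Proof.
move=> fl h; rewrite (linear_fm_dec fl m) /ev big_map; apply: eq_bigr => k _ /=.
by rewrite -elt_tup h// spx_tact; case: (obasisP k.2).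
Qed.

Lemma fsum_ofP l (m : fr l) q : q \in fsum_of m -> size q.2 = l.+1 /\ spx q.2.
Proof.
move=> /mapP[k _ ->] /=; rewrite size_map size_tuple; split=> //.
by rewrite spx_act; case: (obasisP k.2).
Qed.

Definition ocycle l : fr l -> Prop :=
  match l with
  | 0 => fun m => oaug m = 0
  | l'.+1 => fun m => @od l' m = 0
  end.

(** Pairing with D psi factors through the differential of m; in degree 0 it is the augmentation
    times psi [::]. *)
Lemma fsum_of_cycle l (m : fr l) (N : lmodType R[i]) (psi : seq W -> N) :
  ocycle m -> ev (fsum_of m) (D psi) = 0.
Proof.
case: l m => [|l] m /= mc.
  rewrite (@ev_fsum_of 0 m _ (fun m => oaug m *: psi [::])).
  - by rewrite mc scale0r.
  - move=> a x y; rewrite oaug_hom.1 scalerDl; congr (_ + _).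
    by rewrite -[_ *: oaug x]/(a * oaug x) scalerA.
  - move=> t st; rewrite oaug_elt// scale1r; case: t st => -[|w [|]]//= _ _.
    by rewrite subr0.
have [f fl fP] := elt_lift (fun t : l.+1.-tuple W => psi t).
rewrite (@ev_fsum_of l.+1 m _ (f \o @od l)).
- by rewrite /= mc (res_linear0 fl).
- by apply: linear_comp_fun => //; case: (od_hom l).
- move=> t st /=; rewrite od_elt// cob_lin// D_cob; exact: (eq_cob st).
Qed.

(** [ordered_acyclic] is applied with values in the chain module, to the tautological function
    [elts], whose pairing with m returns m. *)
Lemma ocycle_boundary l (m : fr l) : ocycle m -> exists b, od b = m.
Proof.
move=> mc; have [b [bP bE]] := ordered_acyclic Yt_contr (@fsum_ofP l m).
exists (\sum_(q <- b) q.1 *: elts l.+1 q.2).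
have [h hE] := linear_pack (od_hom l).1; rewrite hE linear_sum.
transitivity (ev b (D (elts l))).
  rewrite /ev; apply: eq_big_seq => q /bP[sq spq].
  rewrite linearZ -hE; congr (_ *: _).
  have sq' : size q.2 == l.+2 by apply/eqP.
  rewrite -[q.2]/(tval (Tuple sq')) elts_tuple od_elt// D_cob.
  by apply: eq_bigr => i _; rewrite elts_tuple.
rewrite -bE; first by apply: (@ev_fsum_of l m _ id) => // t _; rewrite elts_tuple.
by move=> psi; exact: fsum_of_cycle.
Qed.

Definition ores : free_resolution R Gamma.
Proof.
apply: (@FreeResolution R Gamma obasis (@od) oaug).
- by move=> l; case: (od_hom l).
- by move=> l; case: (od_hom l).
- by case: oaug_hom.
- by case: oaug_hom.
- apply/seteqP; split=> // a _.
  have [x0 _] := Yt_contr.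
  have [v _] := realization_supp_neq0 x0.
  have sv : spx [tuple v].
    apply: (spans_sub (@sc_vertex _ Yt v)) => // w.
    by rewrite mem_seq1 => /eqP ->; rewrite !inE.
  exists (a *: elt [tuple v]) => //.
  have [h hE] := linear_pack oaug_hom.1.
  by rewrite hE linearZ -hE oaug_elt//=; exact: mulr1.
- apply/seteqP; split=> [m /= /(@ocycle_boundary 0)[b <-]|m [b _ <-]]; first by exists b.
  exact: oaugd0.
- move=> l; apply/seteqP; split=> [m /= /(@ocycle_boundary l.+1)[b <-]|m [b _ <-]].
    by exists b.
  exact: odd0.
Defined.

Lemma spx_perm k (s : 'S_k.+1) (t : k.+1.-tuple W) : spx (tuple_perm s t) <-> spx t.
Proof.
have h (s' : 'S_k.+1) (t' : k.+1.-tuple W) : spx t' -> spx (tuple_perm s' t').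
  move=> st; apply: (spans_sub st); first by rewrite size_tuple.
  by move=> w /tnthP[j ->]; rewrite tnth_mktuple inE mem_tnth.
split; last exact: h.
move=> /(h s^-1%g); rewrite tuple_permM mulVg.
rewrite (_ : tuple_perm 1%g t = t)//; apply: eq_from_tnth => i.
by rewrite tnth_mktuple perm1.
Qed.

Lemma tact_perm k g (s : 'S_k) (t : k.-tuple W) : tuple_perm s (tact g t) = tact g (tuple_perm s t).
Proof. by apply: eq_from_tnth => j; rewrite !(tnth_mktuple, tnth_map). Qed.

Lemma alt_lin k (N N' : lmodType R[i]) (f : N -> N') (c : k.-tuple W -> N) t :
  linear f -> f (alt c t) = alt (f \o c) t.
Proof.
move=> /linear_pack[h ->]; rewrite linearZ; congr (_ *: _).
by rewrite linear_sum; apply: eq_bigr => s _; rewrite linearZ.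
Qed.

Lemma eq_alt k (N : lmodType R[i]) (c c' : k.+1.-tuple W -> N) (t : k.+1.-tuple W) : spx t ->
  (forall t : k.+1.-tuple W, spx t -> c t = c' t) -> alt c t = alt c' t.
Proof.
move=> st h; congr (_ *: _); apply: eq_bigr => s _; rewrite h//.
exact/spx_perm.
Qed.

Lemma oalt_ex l : exists2 f : fr l -> fr l, fm_hom (@fm_act R Gamma _) f &
  forall t : l.+1.-tuple W, spx t -> f (elt t) = alt (@elt l) t.
Proof.
apply: elt_hom; [exact: fm_act_linear|exact: fm_act1|exact: fm_actM|].
move=> g t st; rewrite alt_lin; last exact: fm_act_linear.
congr (_ *: _); apply: eq_bigr => s _.
by rewrite tact_perm elt_act.
Qed.

Definition oalt l : fr l -> fr l := sval (cid2 (oalt_ex l)).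

Lemma oalt_hom l : fm_hom (@fm_act R Gamma _) (@oalt l).
Proof. by rewrite /oalt; case: cid2. Qed.

Lemma oalt_elt l (t : l.+1.-tuple W) : spx t -> oalt (elt t) = alt (@elt l) t.
Proof. by rewrite /oalt; case: cid2 => /= f _ h /h. Qed.

Lemma oalt_chain_map : @chain_map R Gamma ores ores oalt.
Proof.
split=> [l|m|l m]; first exact: oalt_hom.
  suff /(congr1 (fun f => f m)) : oaug \o @oalt 0 = oaug by [].
  apply: hom_elt_ext; [|by case: oaug_hom|].
    by apply: linear_comp_fun; [case: oaug_hom|case: (oalt_hom 0)].
  move=> t st /=; rewrite oalt_elt// alt_lin; last by case: oaug_hom.
  by rewrite (@eq_alt _ _ _ (fun=> oaug (elt t)))// => [|u su]; rewrite ?alt_id ?/= ?oaug_elt// => s u;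
    rewrite (_ : s = 1%g) ?odd_perm1 ?scale1r//; apply/permP => i; rewrite !ord1.
suff /(congr1 (fun f => f m)) : @od l \o @oalt l.+1 = @oalt l \o @od l by [].
apply: hom_elt_ext.
- by apply: linear_comp_fun; [case: (od_hom l)|case: (oalt_hom l.+1)].
- by apply: linear_comp_fun; [case: (oalt_hom l)|case: (od_hom l)].
move=> t st /=; rewrite oalt_elt// od_elt// cob_lin; last by case: (oalt_hom l).
rewrite alt_lin; last by case: (od_hom l).
rewrite (eq_alt st (c' := cob (@elt l))) => [|u su]; last by rewrite /= od_elt.
rewrite alt_cob; apply: (eq_cob st) => u su.
by rewrite /= oalt_elt.
Qed.

Section Cochains.
Local Notation tspx t := (spans_spx Yt (tval t)).
Variables (U : normedModType R[i]) (pi : unitary_rep Gamma U).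

Definition ecochain k (c : k.-tuple W -> U) :=
  [/\ forall t, ~ tspx t -> c t = 0, forall g t, c (tact g t) = pi g (c t) & alternating_fun c].

Local Notation hom := (fm_hom (rep pi)).

Lemma hom_ecochain l (z : fr l -> U) : hom z -> ecochain (fun t => z (alt (@elt l) t)).
Proof.
move=> [zl ze]; split.
- move=> t st; rewrite /alt big1 ?scaler0 ?(res_linear0 zl)// => s _.
  by rewrite elt_out ?scaler0// spx_perm.
- move=> g t; rewrite -ze; congr z.
  rewrite (@alt_lin _ _ _ (@fm_act R Gamma _ g)); last exact: fm_act_linear.
  congr (_ *: _); apply: eq_bigr => s _.
  by rewrite tact_perm elt_act.
- move=> s t; rewrite alt_alternating.
  by have [h ->] := linear_pack zl; rewrite linearZ.
Qed.

Lemma ecochain_hom l (c : l.+1.-tuple W -> U) : ecochain c ->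
  exists2 z : fr l -> U, hom z & forall t, z (elt t) = c t.
Proof.
move=> [c0 ce ca]; have [||||z zh zc] := @elt_hom l U (rep pi) c.
- exact: rep_linear.
- exact: rep1.
- exact: repM.
- by move=> g t _; rewrite ce.
exists z => // t; have [st|st] := pselect (tspx t); first exact: zc.
by rewrite elt_out// c0// (res_linear0 zh.1).
Qed.

Lemma hom_od_elt l (z : fr l -> U) t : linear z -> tspx t ->
  z (od (elt t)) = cob (fun u => z (elt u)) t.
Proof. by move=> zl st; rewrite od_elt// cob_lin. Qed.

Lemma ecochain_cocycle l (z : fr l.+1 -> U) : hom z ->
  (forall t, tspx t -> cob (fun u => z (elt u)) t = 0) -> z \o @od l.+1 = cst 0.
Proof.
move=> [zl ze] zt; apply: hom_elt_ext.
- by apply: linear_comp_fun => //; case: (od_hom l.+1).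
- by move=> a x y; rewrite /cst scaler0 addr0.
- by move=> t st /=; rewrite hom_od_elt// zt.
Qed.

Local Notation cocyc l := (@cocycles R Gamma ores U pi l).
Local Notation cobound l := (@coboundaries R Gamma ores U pi l).

(** z and its antisymmetrization are cohomologous, because [oalt] is homotopic to the identity; so
    it suffices that the latter is a coboundary. *)
Lemma cobound_of_cochain l (z : fr l.+1 -> U) (b : l.+1.-tuple W -> U) : cocyc l.+1 z ->
  ecochain b -> (forall t, tspx t -> z (alt (@elt l.+1) t) = cob b t) -> cobound l.+1 z.
Proof.
move=> zc be zb; have [B Bh Bb] := ecochain_hom be.
have za : z \o @oalt l.+1 = B \o @od l.
  have [zl ze] := zc.1; have Bl := Bh.1.
  apply: hom_elt_ext.
  - by apply: linear_comp_fun => //; case: (oalt_hom l.+1).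
  - by apply: linear_comp_fun => //; case: (od_hom l).
  - move=> t st /=; rewrite oalt_elt// zb// hom_od_elt//.
    by apply: eq_bigr => i _; rewrite Bb.
have := coboundaryD (cocycle_htpy (chain_map_id ores) oalt_chain_map zc)
   (ex_intro2 _ _ B Bh (esym za) : cobound l.+1 (z \o @oalt l.+1)).
by congr (cobound l.+1 _); apply/funext => m /=; rewrite subrK.
Qed.

(** A preimage of an alternating cochain may be antisymmetrized, since [alt] commutes with [cob] and
    fixes c. *)
Lemma cochain_of_cobound l (z : fr l.+1 -> U) (c : l.+2.-tuple W -> U) :
  ecochain c -> (forall t, z (elt t) = c t) -> hom z -> cobound l.+1 z ->
  exists2 b : l.+1.-tuple W -> U, ecochain b & forall t, tspx t -> c t = cob b t.
Proof.
move=> [_ _ ca] zc [zl ze] [B Bh Bz]; exists (fun t => B (alt (@elt l) t)).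
  exact: hom_ecochain.
move=> t st; rewrite -(alt_id ca) -(eq_alt st (c := z \o @elt l.+1)) => [|u _]; last exact: zc.
rewrite -alt_lin// -Bz /= alt_lin; last by case: (od_hom l).
rewrite (eq_alt st (c' := cob (@elt l))) => [|u su]; last by rewrite /= od_elt.
by rewrite alt_cob cob_lin//; case: Bh.
Qed.

Definition cochain_exact l := forall c : l.+2.-tuple W -> U, ecochain c ->
  (forall t, tspx t -> cob c t = 0) ->
  exists2 b : l.+1.-tuple W -> U, ecochain b & forall t, tspx t -> c t = cob b t.

Definition cochain_closed l := forall c : l.+2.-tuple W -> U, ecochain c ->
  (forall t, tspx t -> cob c t = 0) ->
  (forall (ts : seq (l.+2.-tuple W)) (e : R), 0 < e ->
     exists2 b : l.+1.-tuple W -> U, ecochain b &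
       forall t, t \in ts -> tspx t -> rnorm (c t - cob b t) < e) ->
  exists2 b : l.+1.-tuple W -> U, ecochain b & forall t, tspx t -> c t = cob b t.

Lemma cocycle_cob0 l (z : fr l.+1 -> U) : cocyc l.+1 z ->
  forall t, tspx t -> cob (fun t => z (alt (@elt l.+1) t)) t = 0.
Proof.
move=> [[zl ze] zd] t st; rewrite -cob_lin// -alt_cob -(eq_alt st (c := @od l.+1 \o @elt l.+2)).
  rewrite -alt_lin; last by case: (od_hom l.+1).
  exact: (congr1 (fun f => f (alt (@elt l.+2) t)) zd).
by move=> u su; rewrite /= od_elt.
Qed.

Lemma cohomology_eq0_cochain (F : free_resolution R Gamma) l :
  cohomology_eq0 F pi l.+1 <-> cochain_exact l.
Proof.
split=> [H|H].
  have /cohomology_eq0P H' := @cohomology_eq0_indep _ _ _ pi ores F l H.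
  move=> c cE cc; have [z zh zc] := ecochain_hom cE.
  apply: (cochain_of_cobound cE zc zh); apply: H'; split=> //.
  apply: ecochain_cocycle => // t st; rewrite -(cc t st).
  by apply: eq_bigr => i _; rewrite zc.
apply: (@cohomology_eq0_indep _ _ _ _ _ ores); apply/cohomology_eq0P => z zc.
have [b bE bc] := H _ (hom_ecochain zc.1) (cocycle_cob0 zc).
exact: cobound_of_cochain zc bE bc.
Qed.

Lemma cohomology_reduced_cochain (F : free_resolution R Gamma) l :
  cohomology_reduced F pi l.+1 <-> cochain_closed l.
Proof.
split=> [H|H].
  have /reducedP H' := @cohomology_reduced_indep _ _ _ pi ores F l H.
  move=> c cE cc ca; have [z zh zc] := ecochain_hom cE.
  apply: (cochain_of_cobound cE zc zh); apply: H'.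
    split=> //; apply: ecochain_cocycle => // t st; rewrite -(cc t st).
    by apply: eq_bigr => i _; rewrite zc.
  apply: (@approx_basis _ _ _ pi ores l.+1 z _ zh (@coboundary_hom _ _ _ pi ores l.+1)).
  move=> ys e e0; have [b bE be] := ca [seq val y | y <- ys] e e0.
  have [B Bh Bb] := ecochain_hom bE.
  exists (B \o @od l); first by exists B.
  move=> y yys; rewrite -elt_basis zc /= hom_od_elt; [|by case: Bh|by case: (obasisP y)].
  have := be (val y) (map_f _ yys) (obasisP y).1; congr (rnorm (_ - _) < _).
  by apply: eq_bigr => i _; rewrite Bb.
apply: (@cohomology_reduced_indep _ _ _ _ _ ores); apply/reducedP => z zc za.
have [|b bE bc] := H _ (hom_ecochain zc.1) (cocycle_cob0 zc).
  move=> ts e e0; have [_ [B Bh <-] Be] := za [seq alt (@elt l.+1) t | t <- ts] e e0.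
  exists (fun t => B (alt (@elt l) t)); first exact: hom_ecochain.
  move=> t tts st; have := Be _ (map_f _ tts); congr (rnorm (_ - _) < _).
  rewrite /= alt_lin; last by case: (od_hom l).
  rewrite (eq_alt st (c' := cob (@elt l))) => [|u su]; last by rewrite /= od_elt.
  by rewrite alt_cob cob_lin//; case: Bh.
exact: cobound_of_cochain zc bE bc.
Qed.

End Cochains.

End OrderedResolution.

(** * Spectral gaps of finite complexes *)

Section HermitianForms.
Variables (C : numClosedFieldType) (L : lmodType C) (q : L -> L -> C).
Hypothesis q_lin : forall y a x x', q (a *: x + x') y = a * q x y + q x' y.
Hypothesis q_conj : forall x y, q y x = (q x y)^*.
Hypothesis q_ge0 : forall x, 0 <= q x x.
Hypothesis q_eq0 : forall x, q x x = 0 -> x = 0.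

Lemma qDl x x' y : q (x + x') y = q x y + q x' y.
Proof. by rewrite -[x]scale1r q_lin mul1r scale1r. Qed.

Lemma q0l y : q 0 y = 0.
Proof. by apply: (addrI (q 0 y)); rewrite -qDl !addr0. Qed.

Lemma qZl a x y : q (a *: x) y = a * q x y.
Proof. by rewrite -[_ *: _]addr0 q_lin q0l addr0. Qed.

Lemma qBl x x' y : q (x - x') y = q x y - q x' y.
Proof. by rewrite qDl -scaleN1r qZl mulN1r. Qed.

Lemma q_suml (J : Type) (r : seq J) (F : J -> L) y :
  q (\sum_(j <- r) F j) y = \sum_(j <- r) q (F j) y.
Proof. by elim: r => [|j r IH]; rewrite ?big_nil ?q0l// !big_cons qDl IH. Qed.

Lemma qZr a x y : q x (a *: y) = a^* * q x y.
Proof. by rewrite q_conj qZl rmorphM [q x y]q_conj. Qed.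

Lemma q_sumr (J : Type) (r : seq J) (F : J -> L) x :
  q x (\sum_(j <- r) F j) = \sum_(j <- r) q x (F j).
Proof.
rewrite q_conj q_suml rmorph_sum; apply: eq_bigr => j _.
by rewrite [RHS]q_conj.
Qed.

Definition orthonormal m (b : 'I_m -> L) := forall i j, q (b i) (b j) = (i == j)%:R.

Lemma orthonormal_coord m (b : 'I_m -> L) (a : 'I_m -> C) j : orthonormal b ->
  q (\sum_i a i *: b i) (b j) = a j.
Proof.
move=> bo; rewrite q_suml (bigD1 j)//= qZl bo eqxx mulr1 big1 ?addr0// => i ij.
by rewrite qZl bo (negbTE ij) mulr0.
Qed.

Variable S : L -> Prop.
Hypothesis S0 : S 0.
Hypothesis S_lin : forall a x y, S x -> S y -> S (a *: x + y).
Variable dimS : nat.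
Hypothesis S_dim : forall m (b : 'I_m -> L), (forall i, S (b i)) -> orthonormal b -> (m <= dimS)%N.

Lemma S_Z a x : S x -> S (a *: x).
Proof. by move=> Sx; rewrite -[_ *: _]addr0; exact: S_lin. Qed.

Lemma S_B x y : S x -> S y -> S (x - y).
Proof. by move=> Sx Sy; rewrite addrC -scaleN1r; exact: S_lin. Qed.

Lemma S_sum (J : Type) (r : seq J) (a : J -> C) (F : J -> L) :
  (forall j, S (F j)) -> S (\sum_(j <- r) a j *: F j).
Proof.
by move=> SF; elim: r => [|j r IH]; rewrite ?big_nil// big_cons; exact: S_lin.
Qed.

Definition onb m (b : 'I_m -> L) :=
  [/\ forall i, S (b i), orthonormal b & forall x, S x -> x = \sum_i q x (b i) *: b i].

(** Take an orthonormal family in [S] of maximal length, which exists by the bound [dimS]. A vector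
    outside its span would have a nonzero residue, and the normalized residue could be adjoined. *)
Lemma onb_ex : exists m (b : 'I_m -> L), onb b.
Proof.
pose P m := `[< exists b : 'I_m -> L, (forall i, S (b i)) /\ orthonormal b >].
have P0 : exists m, P m by exists 0%N; apply/asboolP; exists (fun=> 0); split=> -[].
have Pb m : P m -> (m <= dimS)%N by move=> /asboolP[b [Sb bo]]; exact: S_dim Sb bo.
case: (ex_maxnP P0 Pb) => m /asboolP[b [Sb bo]] mmax; exists m, b; split=> // x Sx.
apply: contrapT => xb; pose y := x - \sum_i q x (b i) *: b i.
have y0 : q y y != 0.
  by apply/eqP => /q_eq0/eqP; rewrite subr_eq0 => /eqP.
have Sy : S y by apply: S_B => //; exact: S_sum.
have yb i : q y (b i) = 0 by rewrite qBl orthonormal_coord// subrr.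
pose r := sqrtC (q y y).
have r0 : r != 0 by rewrite sqrtC_eq0.
have rr : r^-1 * (r^-1)^* * q y y = 1.
  rewrite -(sqrtCK (q y y)) -/r.
  have -> : (r^-1)^* = r^-1 by apply/CrealP; rewrite realV ger0_real// sqrtC_ge0.
  by rewrite expr2 mulrACA mulVf// mulr1.
suff /mmax : P m.+1 by rewrite ltnn.
apply/asboolP; exists (fun i => if unlift ord0 i is Some j then b j else r^-1 *: y).
split=> [i|i j]; first by case: unliftP => [j _|_]; [exact: Sb|exact: S_Z].
case: (unliftP ord0 i) => [i'|] ->; case: (unliftP ord0 j) => [j'|] ->.
- by rewrite bo (inj_eq lift_inj).
- by rewrite q_conj qZl yb mulr0 conjC0 eq_sym (negbTE (neq_lift _ _)).
- by rewrite qZl yb mulr0 (negbTE (neq_lift _ _)).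
- by rewrite qZl qZr mulrA rr eqxx.
Qed.

Lemma onb_norm m (b : 'I_m -> L) x : onb b -> S x -> q x x = \sum_i `|q x (b i)| ^+ 2.
Proof.
move=> [Sb bo bx] Sx; rewrite {2}(bx x Sx) q_sumr; apply: eq_bigr => i _.
by rewrite qZr mulrC normCK.
Qed.

Lemma proj_ex x : exists2 y, S y & forall z, S z -> q (x - y) z = 0.
Proof.
have [m [b [Sb bo bx]]] := onb_ex.
exists (\sum_i q x (b i) *: b i); first exact: S_sum.
move=> z Sz; rewrite (bx z Sz) q_sumr big1// => i _.
by rewrite qZr qBl orthonormal_coord// subrr mulr0.
Qed.

Variable T : L -> L.
Hypothesis T_lin : linear T.
Hypothesis TS : forall x, S x -> S (T x).
Hypothesis T_adj : forall x y, S x -> S y -> q (T x) y = q x (T y).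

Local Open Scope sesquilinear_scope.

(** In an orthonormal basis T has a Hermitian, hence normal, matrix; the rows of the diagonalizing
    unitary matrix are the coordinates of the eigenvectors. *)
Lemma eigenbasis_ex : exists m (f : 'I_m -> L) (lam : 'I_m -> C),
  onb f /\ forall i, T (f i) = lam i *: f i.
Proof.
have [m [b [Sb bo bx]]] := onb_ex.
pose A : 'M[C]_m := \matrix_(i, j) q (T (b i)) (b j).
have Ah : A ^t* = A.
  by apply/matrixP => i j; rewrite !mxE -q_conj T_adj.
have /orthomx_spectralP AE : A \is normalmx by apply/normalmxP; rewrite Ah.
set P := spectralmx A in AE; set sp := spectral_diag A in AE.
have Pu : P \is unitarymx by exact: spectral_unitarymx.
have PP : P *m P ^t* = 1%:M by apply/unitarymxP.
have PP' : P ^t* *m P = 1%:M by apply: mulmx1C.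
have PA : P *m A = diag_mx sp *m P.
  by rewrite AE -mulmxA mulKVmx ?unitarymx_unit.
pose f i := \sum_j P i j *: b j.
have Sf i : S (f i) by exact: S_sum.
have qf x i : q x (f i) = \sum_j q x (b j) * P ^t* j i.
  by rewrite q_sumr; apply: eq_bigr => j _; rewrite qZr !mxE mulrC.
have fo : orthonormal f.
  move=> i k; rewrite qf; transitivity ((P *m P ^t*) i k); last by rewrite PP mxE.
  by rewrite mxE; apply: eq_bigr => j _; rewrite orthonormal_coord.
exists m, f, (fun i => sp 0 i); split.
  split=> // x Sx; rewrite {1}(bx x Sx).
  under [RHS]eq_bigr do rewrite qf scaler_sumr.
  rewrite exchange_big/=; apply: eq_bigr => k _.
  under eq_bigr do rewrite scaler_suml.
  rewrite exchange_big/=.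
  transitivity (\sum_j (q x (b j) * (P ^t* *m P) j k) *: b k).
    rewrite PP' (bigD1 k)//= mxE eqxx mulr1 big1 ?addr0// => j jk.
    by rewrite mxE (negbTE jk) mulr0 scale0r.
  apply: eq_bigr => j _; rewrite mxE mulr_sumr scaler_suml.
  by apply: eq_bigr => i _; rewrite scalerA mulrA.
move=> i; have [T' TE] := linear_pack T_lin.
have Tb j : T (b j) = \sum_k A j k *: b k.
  by rewrite {1}(bx _ (TS (Sb j))); apply: eq_bigr => k _; rewrite mxE.
transitivity (\sum_k (P *m A) i k *: b k).
  transitivity (\sum_j P i j *: T (b j)).
    by rewrite {1}/f TE linear_sum; apply: eq_bigr => j _; rewrite linearZ.
  under eq_bigr do rewrite Tb scaler_sumr.
  rewrite exchange_big/=; apply: eq_bigr => k _; rewrite mxE scaler_suml.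
  by apply: eq_bigr => j _; rewrite scalerA.
rewrite PA scaler_sumr; apply: eq_bigr => k _.
by rewrite scalerA mul_diag_mx mxE.
Qed.

Lemma eigen_ineq (e : C) :
  (forall x lam, S x -> x != 0 -> T x = lam *: x -> e <= lam) ->
  forall x, S x -> e * q x x <= q (T x) x.
Proof.
move=> H x Sx; have [m [f [lam [fb fl]]]] := eigenbasis_ex.
have [Sf fo fx] := fb; rewrite (onb_norm fb Sx) mulr_sumr.
have -> : q (T x) x = \sum_i lam i * `|q x (f i)| ^+ 2.
  have [T' TE] := linear_pack T_lin.
  rewrite {1}(fx x Sx) TE linear_sum q_suml; apply: eq_bigr => i _.
  by rewrite linearZ -TE fl qZl qZl [q (f i) x]q_conj mulrCA normCK.
apply: ler_sum => i _; apply: ler_wpM2r; first exact: exprn_ge0.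
apply: (H (f i)) => //; apply/eqP => fi0.
by have := fo i i; rewrite fi0 q0l eqxx => /eqP; rewrite eq_sym oner_eq0.
Qed.

Lemma eigen_pos : (forall x, S x -> x != 0 -> 0 < q (T x) x) ->
  exists2 e : C, 0 < e & forall x, S x -> e * q x x <= q (T x) x.
Proof.
move=> H; have [m [f [lam [fb fl]]]] := eigenbasis_ex.
have [Sf fo fx] := fb.
have lam0 i : 0 < lam i.
  have := H (f i) (Sf i); rewrite fl qZl fo eqxx mulr1; apply.
  apply/eqP => fi0.
  by have := fo i i; rewrite fi0 q0l eqxx => /eqP; rewrite eq_sym oner_eq0.
(* A positive number below every eigenvalue that makes sense also when there are none. *)
pose e := (1 + \sum_i (lam i)^-1)^-1.
have s0 : 0 < 1 + \sum_i (lam i)^-1.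
  by rewrite ltr_pwDl// sumr_ge0// => i _; rewrite invr_ge0 ltW.
exists e; first by rewrite invr_gt0.
move=> x Sx; rewrite (onb_norm fb Sx) mulr_sumr.
have -> : q (T x) x = \sum_i lam i * `|q x (f i)| ^+ 2.
  have [T' TE] := linear_pack T_lin.
  rewrite {1}(fx x Sx) TE linear_sum q_suml; apply: eq_bigr => i _.
  by rewrite linearZ -TE fl qZl qZl [q (f i) x]q_conj mulrCA normCK.
apply: ler_sum => i _; apply: ler_wpM2r; first exact: exprn_ge0.
rewrite -[leRHS]invrK lef_pV2 ?posrE ?invr_gt0// (bigD1 i)//= addrCA lerDl.
by rewrite addr_ge0// sumr_ge0// => j _; rewrite invr_ge0 ltW.
Qed.

End HermitianForms.

(** * The upper Laplacian of a finite complex *)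

Section FiniteComplex.
Variables (R : realType) (V : choiceType) (Z : scomplex V).
Hypothesis Zfin : finite_set (simplices Z).
Local Notation L k := (k.-tuple V -> R[i]^o).
Local Notation cochain := (@cochain R V Z).
Local Notation osx := (@ord_simplex V Z).

Lemma vertices_finite : finite_set [set: V].
Proof.
have := @finite_preimage _ _ (simplices Z) (fun v : V => [fset v]%fset) _ Zfin.
rewrite (_ : _ @^-1` _ = setT); first by apply => u v _ _; exact: fset1_inj.
by apply/seteqP; split=> v // _; exact: sc_vertex.
Qed.

Lemma tuples_finite k : finite_set [set: k.-tuple V].
Proof.
pose U := fset_set [set: V]; have inU v : v \in U by rewrite in_fset_set ?inE //; exact: vertices_finite.
have := @finite_image _ _ [set: k.-tuple U] (fun t => map_tuple val t) finite_finset.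
apply: sub_finite_set => t _; exists (map_tuple (fun v => FSetSub (inU v)) t) => //.
by apply: eq_from_tnth => i; rewrite !tnth_map.
Qed.
Local Hint Resolve tuples_finite : core.

Definition tups k : seq (k.-tuple V) := enum_fset (fset_set [set: k.-tuple V]).

Lemma mem_tups k (t : k.-tuple V) : t \in tups k.
Proof. by rewrite /tups in_fset_set//= in_setT. Qed.

Lemma tups_uniq k : uniq (tups k).
Proof. exact: fset_uniq. Qed.

Lemma big_tups_bij k m (h : k.-tuple V -> m.-tuple V) (F : m.-tuple V -> R[i]) : bijective h ->
  \sum_(t <- tups m) F t = \sum_(t <- tups k) F (h t).
Proof.
move=> [g hg gh]; rewrite -[RHS](big_map h xpredT); apply: perm_big.
apply: uniq_perm; rewrite ?tups_uniq//.
  by rewrite map_inj_uniq ?tups_uniq//; exact: can_inj hg.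
by move=> t; rewrite mem_tups; apply/esym/mapP; exists (g t); rewrite ?mem_tups ?gh.
Qed.

Definition verts : seq V := enum_fset (fset_set [set: V]).

Lemma big_tups_cons k (F : k.+1.-tuple V -> R[i]) :
  \sum_(t <- tups k.+1) F t = \sum_(t <- tups k) \sum_(v <- verts) F (cons_tuple v t).
Proof.
rewrite exchange_big/=.
transitivity (\sum_(t <- [seq cons_tuple v t | v <- verts, t <- tups k]) F t); last first.
  by rewrite big_allpairs_dep.
apply: perm_big; apply: uniq_perm; first exact: tups_uniq.
  apply: allpairs_uniq; [exact: fset_uniq|exact: tups_uniq|].
  move=> [v t] [v' t'] _ _ /= /(congr1 val)/= [-> tt]; congr pair.
  exact: val_inj.
move=> t; rewrite mem_tups; apply/esym/allpairsP.
exists (thead t, [tuple of behead t]); split=> /=.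
- by rewrite in_fset_set ?in_setT//; exact: vertices_finite.
- exact: mem_tups.
- by apply: val_inj; rewrite /= {1}(tuple_eta t).
Qed.

(** The inner product without the normalization 1/k!, defined on all functions of tuples. *)
Definition ip k (c e : L k) : R[i] := \sum_(t <- tups k) c t * (e t)^*.

Lemma ip_lin k (y : L k) a x x' : ip (a *: x + x') y = a * ip x y + ip x' y.
Proof.
rewrite /ip mulr_sumr -big_split; apply: eq_bigr => t _ /=.
by rewrite mulrA -mulrDl.
Qed.

Lemma ip_conj k (x y : L k) : ip y x = (ip x y)^*.
Proof.
rewrite /ip rmorph_sum; apply: eq_bigr => t _.
by rewrite rmorphM /= conjCK mulrC.
Qed.

Lemma ip_ge0 k (x : L k) : 0 <= ip x x.
Proof. by apply: sumr_ge0 => t _; rewrite mul_conjC_ge0. Qed.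

Lemma ip_eq0 k (x : L k) : ip x x = 0 -> x = 0.
Proof.
move=> /eqP; rewrite psumr_eq0 => [/allP h|t _]; last exact: mul_conjC_ge0.
by apply/funext => t; have := h t (mem_tups t); rewrite mul_conjC_eq0 => /eqP.
Qed.

Lemma ip_dim k m (b : 'I_m -> L k) : orthonormal (@ip k) b -> (m <= size (tups k))%N.
Proof.
move=> bo; set N := size _.
pose tt := tnth (in_tuple (tups k)).
pose M : 'M[R[i]]_(m, N) := \matrix_(i, j) b i (tt j).
have MM : M *m (map_mx Num.conj M^T) = 1%:M.
  apply/matrixP => i j; rewrite [RHS]mxE -bo [LHS]mxE /ip [RHS]big_tnth; apply: eq_bigr => l _.
  by rewrite !mxE.
have /eqP <- : row_free M by apply/row_freeP; exists (map_mx Num.conj M^T).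
exact: rank_leq_col.
Qed.

Lemma cochain_out k (c : L k) t : cochain c -> ~ osx t -> c t = 0.
Proof. by case=> h _ /h. Qed.

Lemma cochain_alt k (c : L k) : cochain c -> alternating_fun c.
Proof. by case=> _ h s t; exact: h. Qed.

Lemma innerE k (c e : L k) : cochain c -> inner Z c e = (k`!)%:R^-1 * ip c e.
Proof.
move=> cc; congr (_ * _); rewrite /ip /tups -fsbig_finite; last exact: tuples_finite.
apply: fsbig_widen => // t [_ /= nt]; by rewrite (cochain_out cc nt) mul0r.
Qed.

Lemma cochain_lin k a (x y : L k) : cochain x -> cochain y -> cochain (a *: x + y).
Proof.
move=> [x0 xa] [y0 ya]; split=> [t nt|s t].
  have -> : (a *: x + y) t = a * x t + y t by [].
  by rewrite x0// y0// mulr0 addr0.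
have E u : (a *: x + y) u = a * x u + y u by [].
by rewrite !E xa ya mulrDr mulrCA.
Qed.

Lemma cochain0 k : cochain (0 : L k).
Proof. by split=> [//|s t]; rewrite mulr0. Qed.

Lemma osx_perm k (s : 'S_k) (t : k.-tuple V) : osx (tuple_perm s t) <-> osx t.
Proof.
have h (s' : 'S_k) (t' : k.-tuple V) : osx t' -> osx (tuple_perm s' t').
  move=> [ut kt]; split.
    by rewrite map_inj_in_uniq ?enum_uniq// => i j _ _ /(tuple_uniqP _ ut)/perm_inj.
  case: kt => [k0|Zt]; first by left.
  have [k0|k0] := posnP k; first by left.
  right; apply: sc_sub Zt _ _.
    by apply/fsubsetP => w; rewrite !inE => /tnthP[i ->]; rewrite tnth_mktuple mem_tnth.
  by apply/fset0Pn; exists (tnth (tuple_perm s' t') (Ordinal k0)); rewrite !inE mem_tnth.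
split; last exact: h.
move=> /(h s^-1%g); rewrite tuple_permM mulVg (_ : tuple_perm 1%g t = t)//.
by apply: eq_from_tnth => i; rewrite tnth_mktuple perm1.
Qed.

Definition cobZ k (c : L k) : L k.+1 := coboundary Z c.

Lemma cobZ_in k (c : L k) t : osx t -> cobZ c t = cob c t.
Proof. by move=> h; rewrite /cobZ /coboundary asboolT. Qed.

Lemma cobZ_out k (c : L k) t : ~ osx t -> cobZ c t = 0.
Proof. by move=> h; rewrite /cobZ /coboundary asboolF. Qed.

Lemma cob_alternating k (c : L k) : alternating_fun c -> alternating_fun (@cob _ V _ k c).
Proof.
move=> ca s t; have E u : cob c u = alt (@cob _ V _ k c) u.
  by rewrite alt_cob; apply: eq_bigr => i _; rewrite alt_id.
by rewrite !E alt_alternating.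
Qed.

Lemma cobZ_cochain k (c : L k) : cochain c -> cochain (cobZ c).
Proof.
move=> cc; split=> [t|s t]; first exact: cobZ_out.
have [h|h] := pselect (osx t); last by rewrite !cobZ_out ?mulr0// osx_perm.
rewrite !cobZ_in//; last exact/osx_perm.
exact: (cob_alternating (cochain_alt cc)).
Qed.

Lemma cobZ_linear k : linear (@cobZ k).
Proof.
move=> a x y; apply/funext => t; have E u : (a *: x + y) u = a * x u + y u by [].
have E' u : (a *: cobZ x + cobZ y) u = a * cobZ x u + cobZ y u by [].
rewrite E'; have [h|h] := pselect (osx t); last by rewrite !cobZ_out ?mulr0 ?addr0.
rewrite !cobZ_in// mulr_sumr -big_split; apply: eq_bigr => i _.
by rewrite E scalerDr /= -[_ *: (a * _)]/((-1) ^+ i * (a * x (tuple_face i t))) mulrCA.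
Qed.

Lemma osx_face k (t : k.+1.-tuple V) i : osx t -> osx (tuple_face i t).
Proof.
move=> [ut [//|Zt]]; split.
  rewrite map_inj_in_uniq ?enum_uniq// => a b _ _ /(tuple_uniqP _ ut).
  exact: lift_inj.
case: k => [|k] in t i ut Zt *; first by left.
right; apply: sc_sub Zt _ _.
  by apply/fsubsetP => w; rewrite !inE => /tnthP[j ->]; rewrite tnth_mktuple mem_tnth.
by apply/fset0Pn; exists (tnth (tuple_face i t) ord0); rewrite !inE mem_tnth.
Qed.

Lemma cobZ_cobZ k (c : L k) : cobZ (cobZ c) = 0.
Proof.
apply/funext => t; have [h|h] := pselect (osx t); last by rewrite cobZ_out.
rewrite cobZ_in// -[RHS](cob_cob c t); apply: eq_bigr => i _.
by rewrite cobZ_in//; exact: osx_face.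
Qed.

Definition adj k (e : L k.+1) : L k := fun t => \sum_(v <- verts) e (cons_tuple v t).

Lemma adj_linear k : linear (@adj k).
Proof.
move=> a x y; apply/funext => t.
have E' u : (a *: adj x + adj y) u = a * adj x u + adj y u by [].
rewrite E' /adj mulr_sumr -big_split; apply: eq_bigr => v _.
by [].
Qed.

Lemma cons_tuple_perm k v (s : 'S_k) (t : k.-tuple V) :
  cons_tuple v (tuple_perm s t) = tuple_perm (lift_perm ord0 ord0 s) (cons_tuple v t).
Proof.
apply: eq_from_tnth => i; rewrite tnth_mktuple; case: (unliftP ord0 i) => [j|] ->.
  by rewrite lift_perm_lift !tnthS tnth_mktuple.
by rewrite lift_perm_id !tnth0.
Qed.

Lemma adj_cochain k (e : L k.+1) : cochain e -> cochain (adj e).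
Proof.
move=> ec; split=> [t nt|s t].
  rewrite /adj big1// => v _; apply: (cochain_out ec) => -[]; rewrite [uniq _]/= => /andP[_ ut] [//|Zt].
  apply: nt; split=> //; case: k => [|k] in e ec t Zt ut *; first by left.
  right; apply: sc_sub Zt _ _.
    by apply/fsubsetP => w; rewrite !inE => ->; rewrite orbT.
  by apply/fset0Pn; exists (tnth t ord0); rewrite !inE mem_tnth.
rewrite /adj mulr_sumr; apply: eq_bigr => v _; rewrite cons_tuple_perm.
by have [_ ->] := ec; rewrite odd_lift_perm addbb.
Qed.

Lemma tuple_face0_cons k v (t : k.-tuple V) : tuple_face ord0 (cons_tuple v t) = t.
Proof. by apply: eq_from_tnth => i; rewrite tnth_mktuple tnthS. Qed.

(** Moving entry i to the front turns face i into face 0, and the sign is absorbed by the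
    alternation of e; so the k + 1 faces contribute equally. This factor k + 1 is exactly the ratio
    of the normalizations of [inner] in degrees k and k + 1, whence [adj_is_adjoint]. *)
Lemma ip_cobZ k (c : L k) (e : L k.+1) : cochain e ->
  ip (cobZ c) e = k.+1%:R * ip c (adj e).
Proof.
move=> ec; have [e0 ea] := ec.
transitivity (\sum_(t <- tups k.+1) \sum_(i < k.+1) (-1) ^+ i * c (tuple_face i t) * (e t)^*).
  apply: eq_bigr => t _; have [h|h] := pselect (osx t).
    by rewrite cobZ_in// mulr_suml.
  by rewrite e0// conjC0 mulr0 big1// => i _; rewrite mulr0.
rewrite exchange_big/= (eq_bigr (fun=> ip c (adj e))) => [|i _]; last first.
  pose h (t : k.+1.-tuple V) := tuple_perm (lift_perm ord0 i 1%g) t.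
  have hb : bijective h.
    by exists (fun t => tuple_perm (lift_perm ord0 i 1%g)^-1%g t) => t;
      rewrite /h tuple_permM ?mulVg ?mulgV; apply: eq_from_tnth => j; rewrite tnth_mktuple perm1.
  rewrite /ip; transitivity (\sum_(t <- tups k.+1) c (tuple_face ord0 t) * (e t)^*).
    rewrite [RHS](big_tups_bij _ hb); apply: eq_bigr => t _.
    rewrite /h tuple_face_lift_perm ea odd_lift_perm odd_perm1 /= addbF signr_odd rmorphM.
    rewrite rmorph_sign mulrCA mulrA (_ : tuple_perm 1%g (tuple_face i t) = tuple_face i t)//.
    by apply: eq_from_tnth => j; rewrite tnth_mktuple perm1.
  rewrite big_tups_cons; apply: eq_bigr => t _; rewrite rmorph_sum mulr_sumr.
  by apply: eq_bigr => v _; rewrite tuple_face0_cons.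
by rewrite sumr_const card_ord -[ip _ _ *+ _]mulr_natl.
Qed.

Lemma adj_is_adjoint k (e : L k.+1) : cochain e -> is_adjoint_value Z e (adj e).
Proof.
move=> ec; split; first exact: adj_cochain.
move=> c cc; rewrite !innerE//; last exact: cobZ_cochain.
rewrite -/(cobZ c) ip_cobZ// mulrA; congr (_ * _).
by rewrite factS natrM invfM mulrC mulrA mulfV ?mul1r ?pnatr_eq0.
Qed.

(** The adjoint value chosen in the definition exists, namely [adj], and is unique because [ip] is
    definite on cochains. *)
Lemma up_laplacianE k (c : L k) : cochain c -> up_laplacian Z c = adj (cobZ c).
Proof.
move=> cc; have ec := cobZ_cochain cc.
have [fc fP] : is_adjoint_value Z (cobZ c) (up_laplacian Z c).
  by apply: xgetPex; exists (adj (cobZ c)); exact: adj_is_adjoint.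
have [gc gP] := adj_is_adjoint ec.
set f := up_laplacian Z c in fc fP *; set g := adj _ in gc gP *.
have dc : cochain (f - g : L k).
  by rewrite addrC -scaleN1r; exact: cochain_lin.
have k0 : (k`!)%:R^-1 != 0 :> R[i] by rewrite invr_eq0 pnatr_eq0 -lt0n fact_gt0.
have : ip (f - g : L k) f = ip (f - g : L k) g.
  by apply: (mulfI k0); rewrite -!innerE// -fP// gP.
rewrite [LHS]ip_conj [RHS]ip_conj => /(can_inj conjCK) /eqP.
rewrite -subr_eq0 -(qBl (@ip_lin k)) => /eqP /ip_eq0 /eqP.
by rewrite subr_eq0 => /eqP.
Qed.

Definition perp_im l (c : L l.+1) := cochain c /\ forall b : L l, cochain b -> ip c (cobZ b) = 0.

Lemma perp_im_lin l a (x y : L l.+1) : perp_im x -> perp_im y -> perp_im (a *: x + y).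
Proof.
move=> [xc xb] [yc yb]; split=> [|b bc]; first exact: cochain_lin.
by rewrite ip_lin xb// yb// mulr0 addr0.
Qed.

Lemma perp_im0 l : perp_im (0 : L l.+1).
Proof. by split=> [|b _]; [exact: cochain0|exact: (q0l (@ip_lin l.+1))]. Qed.

Lemma ip_lap l (x y : L l.+1) : cochain y ->
  l.+2%:R * ip x (adj (cobZ y)) = ip (cobZ x) (cobZ y).
Proof. by move=> yc; rewrite ip_cobZ//; exact: cobZ_cochain. Qed.

Lemma lap_perp l (x : L l.+1) : perp_im x -> perp_im (adj (cobZ x)).
Proof.
move=> [xc xb]; split=> [|b bc]; first exact/adj_cochain/cobZ_cochain.
have l0 : l.+2%:R != 0 :> R[i] by rewrite pnatr_eq0.
apply: (mulfI l0); rewrite mulr0 ip_conj -[l.+2%:R]conjCK -rmorphM conjC_nat ip_lap//.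
by rewrite cobZ_cobZ (q0l (@ip_lin l.+2)) rmorph0.
Qed.

Lemma lap_adj l (x y : L l.+1) : cochain x -> cochain y ->
  ip (adj (cobZ x)) y = ip x (adj (cobZ y)).
Proof.
move=> xc yc; have l0 : l.+2%:R != 0 :> R[i] by rewrite pnatr_eq0.
apply: (mulfI l0); rewrite ip_lap// ip_conj -[X in X * _]conjCK -rmorphM conjC_nat ip_lap//.
by rewrite [RHS]ip_conj.
Qed.

Lemma lap_linear l : linear (fun x : L l.+1 => adj (cobZ x)).
Proof.
apply: (@linear_comp_fun _ _ _ _ (@adj l.+1) (@cobZ l.+1)); [exact: adj_linear|exact: cobZ_linear].
Qed.

Definition nsq k (c : L k) : R := \sum_(t <- tups k) complex.Re `|c t| ^+ 2.

Lemma ip_nsq k (c : L k) : ip c c = (nsq c)%:C%C.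
Proof.
rewrite /ip /nsq rmorph_sum; apply: eq_bigr => t _.
by rewrite -normCK [RHS]rmorphXn; congr (_ ^+ 2); exact/esym/RRe_real/normr_real.
Qed.

Lemma nsq_ge0 k (c : L k) : 0 <= nsq c.
Proof. by rewrite -ler0c -ip_nsq ip_ge0. Qed.

Lemma nsq_eq0 k (c : L k) : nsq c = 0 -> c = 0.
Proof. by move=> h; apply: ip_eq0; rewrite ip_nsq h. Qed.

Lemma lap_nsq l (c : L l.+1) : cochain c ->
  ip (adj (cobZ c)) c = (nsq (cobZ c) / l.+2%:R)%:C%C.
Proof.
move=> cc; have l0 : l.+2%:R != 0 :> R[i] by rewrite pnatr_eq0.
apply: (mulfI l0); rewrite lap_adj// ip_lap// ip_nsq -[l.+2%:R in RHS](rmorph_nat (real_complex R)) -rmorphM.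
by rewrite mulrC divfK// pnatr_eq0.
Qed.

Lemma complex_ge0_real (z : R[i]) : 0 <= z -> z = (complex.Re z)%:C%C.
Proof. by move=> z0; rewrite RRe_real// ger0_real. Qed.

Lemma perp_innerP l (c : L l.+1) : cochain c ->
  (forall b : l.-tuple V -> R[i], cochain b -> inner Z c (coboundary Z b) = 0) <->
  forall b : L l, cochain b -> ip c (cobZ b) = 0.
Proof.
move=> cc; have k0 : (l.+1`!)%:R^-1 != 0 :> R[i] by rewrite invr_eq0 pnatr_eq0 -lt0n fact_gt0.
split=> h b bc; have := h b bc; rewrite innerE//.
  by move=> /eqP; rewrite mulf_eq0 (negbTE k0) => /eqP.
by rewrite -/(cobZ b) => ->; rewrite mulr0.
Qed.

Lemma gap_eigenvalueP l (lam : R) : gap_eigenvalue Z l lam <->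
  exists c : L l.+1, [/\ perp_im c, c != 0 & adj (cobZ c) = lam%:C%C *: c].
Proof.
split=> [[c [cc c0 cb cl]]|[c [[cc cb] c0 cl]]]; exists c.
  split=> //; first by split=> //; exact/perp_innerP.
  by rewrite -up_laplacianE// cl.
split=> //; first exact/perp_innerP.
by rewrite up_laplacianE.
Qed.

Lemma perp_dim l m (b : 'I_m -> L l.+1) : (forall i, perp_im (b i)) ->
  orthonormal (@ip l.+1) b -> (m <= size (tups l.+1))%N.
Proof. by move=> _; exact: ip_dim. Qed.

Lemma gap_ineq l (e : R) : (e%:E <= spectral_gap R Z l)%E ->
  forall c : L l.+1, perp_im c -> e * nsq c <= nsq (cobZ c).
Proof.
move=> eg c cP; have [e0|e0] := leP e 0.
  by apply: (@le_trans _ _ 0); rewrite ?nsq_ge0// mulr_le0_ge0 ?nsq_ge0.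
have H := @eigen_ineq _ _ _ (@ip_lin l.+1) (@ip_conj l.+1) (@ip_ge0 l.+1) (@ip_eq0 l.+1)
  (@perp_im l) (@perp_im0 l) (@perp_im_lin l) _ (@perp_dim l) _ (@lap_linear l)
  (@lap_perp l) (fun x y xP yP => lap_adj xP.1 yP.1) e%:C%C.
have : e%:C%C * ip c c <= ip (adj (cobZ c)) c.
  apply: H => // x lam xP x0 xl.
  have lam0 : 0 <= lam.
    have : 0 <= lam * ip x x.
      rewrite -(qZl (@ip_lin l.+1)) -xl lap_nsq; last by case: xP.
      by rewrite ler0c divr_ge0// nsq_ge0.
    rewrite pmulr_lge0// lt_neqAle eq_sym ip_ge0 andbT.
    by apply: contra_neq x0; exact: ip_eq0.
  rewrite (complex_ge0_real lam0) lecR -lee_fin; apply: le_trans eg _.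
  apply: ereal_inf_lbound; exists (complex.Re lam) => //; apply/gap_eigenvalueP.
  by exists x; rewrite -complex_ge0_real.
rewrite lap_nsq; last by case: cP.
rewrite ip_nsq -rmorphM lecR => /le_trans; apply.
by rewrite ler_pdivrMr// ler_peMr ?nsq_ge0// ler1n.
Qed.

(** The factor l + 2 arises because [nsq] counts all orderings of a simplex, and the two degrees
    differ in their number of orderings. *)
Lemma ineq_gap l (e : R) : (forall c : L l.+1, perp_im c -> e * nsq c <= nsq (cobZ c)) ->
  ((e / l.+2%:R)%:E <= spectral_gap R Z l)%E.
Proof.
move=> H; apply: le_ereal_inf_tmp => _ [lam /gap_eigenvalueP[c [cP c0 cl]] <-].
rewrite lee_fin ler_pdivrMr//.
have c0' : 0 < nsq c.
  rewrite lt_neqAle eq_sym nsq_ge0 andbT; apply: contra_neq c0; exact: nsq_eq0.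
rewrite -(ler_pM2r c0'); apply: le_trans (H c cP) _.
have := lap_nsq cP.1; rewrite cl (qZl (@ip_lin l.+1)) ip_nsq -rmorphM => /complexI E.
by rewrite mulrAC E divfK// pnatr_eq0.
Qed.

Lemma cochain_proj l (c : L l.+1) : cochain c ->
  exists2 b : L l, cochain b & perp_im (c - cobZ b).
Proof.
move=> cc; pose S (x : L l.+1) := exists2 b : L l, cochain b & x = cobZ b.
have S0 : S 0.
  by exists 0; [exact: cochain0|rewrite (res_linear0 (@cobZ_linear l))].
have Sl a x y : S x -> S y -> S (a *: x + y).
  move=> [b bc ->] [b' b'c ->]; exists (a *: b + b'); first exact: cochain_lin.
  by rewrite cobZ_linear.
have Sd m (b : 'I_m -> L l.+1) : (forall i, S (b i)) ->
  orthonormal (@ip l.+1) b -> (m <= size (tups l.+1))%N by move=> _; exact: ip_dim.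
have [y [b bc ->] yP] := proj_ex (@ip_lin l.+1) (@ip_conj l.+1) (@ip_ge0 l.+1)
  (@ip_eq0 l.+1) S0 Sl Sd c.
exists b => //; split.
  by rewrite addrC -scaleN1r; apply: cochain_lin => //; exact: cobZ_cochain.
by move=> b' b'c; apply: yP; exists b'.
Qed.

(** The constant depends on the complex. In [closed_gap] it ensures that one complex can be bad only
    finitely often. *)
Lemma perp_pos l : (forall c : L l.+1, perp_im c -> cobZ c = 0 -> c = 0) ->
  exists2 e : R, 0 < e & forall c : L l.+1, perp_im c -> e * nsq c <= nsq (cobZ c).
Proof.
move=> H; have [|e e0 eP] := @eigen_pos _ _ _ (@ip_lin l.+1) (@ip_conj l.+1) (@ip_ge0 l.+1) (@ip_eq0 l.+1)
  (@perp_im l) (@perp_im0 l) (@perp_im_lin l) _ (@perp_dim l) _ (@lap_linear l)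
  (@lap_perp l) (fun x y xP yP => lap_adj xP.1 yP.1).
  move=> x xP x0; rewrite lap_nsq; last by case: xP.
  rewrite ltcR divr_gt0// lt_neqAle eq_sym nsq_ge0 andbT.
  by apply: contra_neq x0 => /nsq_eq0/H; apply.
have eE := complex_ge0_real (ltW e0).
exists (complex.Re e); first by rewrite -ltcR -eE.
move=> c cP; have := eP c cP; rewrite lap_nsq; last by case: cP.
rewrite ip_nsq eE -rmorphM lecR => /le_trans; apply.
by rewrite ler_pdivrMr// ler_peMr ?nsq_ge0// ler1n.
Qed.

End FiniteComplex.

(** * Quotients of the universal cover *)

Section Quotient.
Variables (R : realType) (Gamma : groupType) (V W : choiceType).
Variables (Y : scomplex V) (Yt : scomplex W) (p : W -> V).
Hypothesis cov : simplicial_covering Y Yt p.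
Hypothesis Yt_contr : contractible R (realization R Yt).
Variable act : Gamma -> W -> W.
Hypothesis act_deck : acts_by_deck act Yt p.
Variable n : nat.
Hypothesis Y_fin : finite_set (simplices (skeleton n Y)).
Variable Lam : groupClosed Gamma.
Hypothesis Lam_fin : finite_set [set: rcosets Lam].

Local Notation Z := (quotient_complex act Lam (skeleton n Yt)).
Local Notation orb := (orbits act Lam).
Local Notation tor := (to_orbit act Lam).
Local Notation osx := (@ord_simplex orb Z).
Local Notation tspx t := (spans_spx Yt (tval t)).
Local Notation tact := (tact act).

Lemma p_act g w : p (act g w) = p w.
Proof. by case: act_deck => _ _ /(_ g)[_ _ ->]. Qed.

Lemma act_mul g h w : act (g * h)%g w = act g (act h w).
Proof. by case: act_deck. Qed.

Lemma act_one w : act 1%g w = w.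
Proof. by case: act_deck. Qed.

Lemma orbit_eqP w w' : tor w = tor (w') <-> exists2 g, g \in Lam & w' = act g w.
Proof.
split=> [/(congr1 val)/= ww'|[g gL ->]].
  have : Defs.orbit act Lam w' w' by exists 1%g; [exact: gpred1|exact: act_one].
  by rewrite -ww' => -[g gL <-]; exists g.
apply: val_inj; apply/seteqP; split=> _ /= [h hL <-].
  exists (h * g^-1)%g; first by rewrite /= gpredM// gpredV.
  by rewrite -act_mul mulgVK.
by exists (h * g)%g; [exact: gpredM|exact: act_mul].
Qed.

Lemma orbit_act g w : g \in Lam -> tor (act g w) = tor w.
Proof. by move=> gL; apply/esym/orbit_eqP; exists g. Qed.

Lemma p_orbit w w' : tor w = tor (w') -> p w = p w'.
Proof. by move=> /orbit_eqP[g _ ->]; rewrite p_act. Qed.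

Lemma orbit_surj (o : orb) : exists w, o = tor w.
Proof. by case: o => o oP; have [w _ wo] := set_mem oP; exists w; exact: val_inj. Qed.

Lemma orbit_inj s : Yt s -> {in s &, injective (to_orbit act Lam)}.
Proof. by move=> Ys x y xs ys /p_orbit; exact: (cov_inj cov Ys). Qed.

Definition torb k (t : k.-tuple W) : k.-tuple orb := map_tuple (to_orbit act Lam) t.

Lemma torb_act k g (t : k.-tuple W) : g \in Lam -> torb (tact g t) = torb t.
Proof. by move=> gL; apply: eq_from_tnth => i; rewrite !tnth_map orbit_act. Qed.

Lemma torb_perm k (s : 'S_k) (t : k.-tuple W) : torb (tuple_perm s t) = tuple_perm s (torb t).
Proof. by apply: eq_from_tnth => i; rewrite !(tnth_map, tnth_mktuple). Qed.

Lemma torb_face k (i : 'I_k.+1) (t : k.+1.-tuple W) : torb (tuple_face i t) = tuple_face i (torb t).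
Proof. by apply: eq_from_tnth => j; rewrite !(tnth_map, tnth_mktuple). Qed.

Lemma fset_torb k (t : k.-tuple W) :
  [fset v in (torb t : seq orb)]%fset = [fset tor w | w in [fset w in (t : seq W)]]%fset.
Proof.
apply/fsetP => v; rewrite !inE; apply/mapP/imfsetP => /= -[w wt ->].
  by exists w; rewrite // inE.
by exists w => //; rewrite inE in wt.
Qed.

Lemma torb_osx k (t : k.+1.-tuple W) : (k <= n)%N -> tspx t -> uniq t -> osx (torb t).
Proof.
move=> kn st ut; split.
  rewrite map_inj_in_uniq// => x y xt yt; apply: (orbit_inj st); by rewrite inE.
right; exists [fset w in (t : seq W)]%fset; last by rewrite fset_torb.
split=> //; apply: leq_trans (_ : (size t <= _)%N); last by rewrite size_tuple.
by rewrite card_fseq size_undup.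
Qed.

Lemma osx_torb k (u : k.+1.-tuple orb) : osx u ->
  exists t : k.+1.-tuple W, [/\ u = torb t, tspx t, uniq t & (k <= n)%N].
Proof.
move=> [uu [//|[s [Ys sn] su]]].
have /choice[f fP] i : exists w, w \in s /\ tnth u i = tor w.
  have : tnth u i \in [fset v in (u : seq orb)]%fset by rewrite inE mem_tnth.
  by rewrite -su => /imfsetP[w /= ws ->]; exists w.
exists [tuple f i | i < k.+1]; split.
- by apply: eq_from_tnth => i; rewrite tnth_map tnth_mktuple (fP i).2.
- apply: (spans_sub Ys); first by rewrite size_tuple.
  by move=> w /tnthP[i ->]; rewrite tnth_mktuple (fP i).1.
- rewrite map_inj_in_uniq ?enum_uniq// => i j _ _ fij.
  by have := (fP i).2; rewrite fij -(fP j).2 => /(tuple_uniqP _ uu).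
- rewrite -ltnS; apply: leq_trans sn.
  have : (#|` [fset v in (u : seq orb)]%fset| <= #|` s|)%N by rewrite -su leq_imfset_card.
  by rewrite card_fseq undup_id// size_tuple.
Qed.

(** Lifts of a simplex through a given vertex are unique, and p is injective on the lift. *)
Lemma lift_tuple_eq k (t t' : k.+1.-tuple W) : tspx t -> tspx t' ->
  (forall i, p (tnth t i) = p (tnth t' i)) -> tnth t ord0 = tnth t' ord0 -> t = t'.
Proof.
move=> st st' pt t0.
have E : [fset w in (t : seq W)]%fset = [fset w in (t' : seq W)]%fset.
  apply: (@cov_lift_uniq _ _ _ _ _ cov (tnth t' ord0) [fset p u | u in [fset w in (t' : seq W)]]%fset) => //.
  - exact: (cov_image cov).
  - by rewrite inE -t0 mem_tnth.
  - apply/fsetP => v; apply/imfsetP/imfsetP => /= -[w] /[!inE] /tnthP[i ->] ->.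
      by exists (tnth t' i); rewrite ?inE ?mem_tnth// pt.
    by exists (tnth t i); rewrite ?inE ?mem_tnth// pt.
  - by rewrite inE mem_tnth.
apply: eq_from_tnth => i; apply: (cov_inj cov st') => //.
- by rewrite -E inE mem_tnth.
- by rewrite inE mem_tnth.
Qed.

Lemma torb_inj k (t t' : k.+1.-tuple W) : tspx t -> tspx t' -> torb t = torb t' ->
  exists2 g, g \in Lam & t' = tact g t.
Proof.
move=> st st' tt'.
have o i : tor (tnth t i) = tor (tnth t' i).
  by have := congr1 (fun u => tnth u i) tt'; rewrite !tnth_map.
have /orbit_eqP[g gL g0] := o ord0; exists g => //.
apply: lift_tuple_eq => //; first by rewrite (spx_tact act_deck).
  by move=> i; rewrite tnth_map p_act; exact/esym/p_orbit.
by rewrite tnth_map g0.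
Qed.

(** One lift per tuple of vertices of Y is enough, as deck transformations are transitive on fibres
    and Y has finitely many vertices. *)
Lemma tuple_reps k : exists ts : seq (k.+1.-tuple W), (forall t, t \in ts -> tspx t) /\
  forall t : k.+1.-tuple W, tspx t -> exists g t0, t0 \in ts /\ t = tact g t0.
Proof.
pose P v (t : k.+1.-tuple W) := tspx t /\ map_tuple p t = v.
pose f v := if pselect (exists t, P v t) is left h then [:: sval (cid h)] else [::].
exists (flatten [seq f v | v <- tups V k.+1]); split=> [t /flatten_mapP[v _]|t st].
  by rewrite /f; case: pselect => // h; rewrite mem_seq1 => /eqP ->; case: (svalP (cid h)).
have : exists t', P (map_tuple p t) t' by exists t.
move=> h; pose t0 := sval (cid h); have [st0 pt0] : P (map_tuple p t) t0 := svalP (cid h).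
have pt i : p (tnth t0 i) = p (tnth t i).
  by have := congr1 (fun u => tnth u i) pt0; rewrite !tnth_map.
have [g gt] := act_transitive cov Yt_contr act_deck (pt ord0).
exists g, t0; split.
  apply/flatten_mapP; exists (map_tuple p t); first by rewrite (mem_tups Y_fin).
  rewrite /f; case: pselect => // h'; rewrite mem_seq1 /t0.
  by rewrite (Prop_irrelevance h h').
apply: lift_tuple_eq => //; first by rewrite (spx_tact act_deck).
  by move=> i; rewrite tnth_map p_act.
by rewrite tnth_map.
Qed.

Lemma V_finite : finite_set [set: V].
Proof. exact: (vertices_finite Y_fin). Qed.

Definition crep (c : rcosets Lam) : Gamma := xget 1%g [set x | val c = rcoset Lam x].

Lemma crepP c : val c = rcoset Lam (crep c).
Proof.
rewrite /crep; apply: (@xgetPex _ 1%g [set x | val c = rcoset Lam x]).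
by case: c => c cP; have [x _ xc] := set_mem cP; exists x.
Qed.

Definition to_rcoset (x : Gamma) : rcosets Lam := exist _ (rcoset Lam x) (mem_set (imageT (rcoset Lam) x)).

Lemma to_rcoset_crep c : to_rcoset (crep c) = c.
Proof. by apply: val_inj; rewrite [RHS]crepP. Qed.

Lemma to_rcosetP x y : to_rcoset x = to_rcoset y <-> (y / x)%g \in Lam.
Proof.
split=> [/(congr1 val)/= xy|yx].
  have : rcoset Lam y y by rewrite /rcoset /= mulgV gpred1.
  by rewrite -xy.
rewrite /rcoset /=.
apply: val_inj; apply/seteqP; split=> z /= zx.
  rewrite /rcoset /=; have -> : (z / y = (z / x) * (y / x)^-1)%g by rewrite invgM invgK mulgA mulgVK.
  by rewrite gpredM// gpredV.
rewrite /rcoset /=; have -> : (z / x = (z / y) * (y / x))%g by rewrite mulgA mulgVK.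
by rewrite gpredM.
Qed.

Lemma crep_to_rcoset x : exists2 g, g \in Lam & x = (g * crep (to_rcoset x))%g.
Proof.
exists (x / crep (to_rcoset x))%g; last by rewrite mulgVK.
by apply/to_rcosetP; rewrite to_rcoset_crep.
Qed.

Lemma rcoset_mul_to_rcoset x g : rcoset_mul (to_rcoset x) g = to_rcoset (x * g)%g.
Proof.
apply: val_inj => /=; apply/seteqP; split=> [_ /= [y yx <-]|z /= zx].
  by rewrite /rcoset/= invgM mulgA mulgK.
exists (z * g^-1)%g; last by rewrite mulgVK.
by move: zx; rewrite /rcoset/= invgM mulgA.
Qed.

Lemma orbits_finite : finite_set [set: orb].
Proof.
have [x0 _] := Yt_contr; have [w0 _] := realization_supp_neq0 x0.
pose sec v : W := xget w0 [set w | p w = v].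
have secP w : p (sec (p w)) = p w by apply: (@xgetPex _ w0 [set w' | p w' = p w]); exists w.
have := finite_image (fun cv : rcosets Lam * V => tor (act (crep cv.1) (sec cv.2)))
  (finite_setX Lam_fin V_finite).
apply: sub_finite_set => o _; have [w ->] := orbit_surj o.
have [g gw] := act_transitive cov Yt_contr act_deck (secP w).
exists (to_rcoset g, p w) => //=; apply/orbit_eqP.
have [l lL gE] := crep_to_rcoset g; exists l => //.
by rewrite -act_mul -gE.
Qed.

Lemma quotient_finite : finite_set (simplices Z).
Proof.
pose U := fset_set [set: orb].
have := finite_fset (fpowerset U); apply: sub_finite_set => s _ /=.
rewrite fpowersetE; apply/fsubsetP => v _.
by rewrite in_fset_set ?inE//; exact: orbits_finite.
Qed.

(** A simplex of the quotient through the orbit of w has a lift through w, which is determined by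
    its image in Y. The resulting bound does not involve the subgroup. *)
Lemma quotient_degree v : exists2 D : set {fset orb}, finite_set D /\
  (D #<= simplices (skeleton n Y))%card & [set s | Z s /\ v \in s] `<=` D.
Proof.
have [w ->] := orbit_surj v.
pose lft s : {fset W} := xget fset0 [set t | [/\ Yt t, w \in t & [fset p u | u in t]%fset = s]].
exists [set [fset tor x | x in lft s]%fset | s in simplices (skeleton n Y)].
  by split; [exact: finite_image|exact: card_image_le].
move=> s /= [[t [Yt' tn] <-] /imfsetP[w' /= w't /orbit_eqP[g gL gw]]].
have w'E : w' = act g w by [].
pose t' := [fset act g^-1 x | x in t]%fset.
have Yt'' : Yt t' by case: act_deck => _ _ /(_ g^-1%g)[_ h _] _ _; rewrite -h.
have wt' : w \in t'.
  by apply/imfsetP; exists w' => //=; rewrite w'E -act_mul mulVg act_one.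
pose s0 := [fset p u | u in t']%fset.
have Ys : Y s0 by exact: (cov_image cov).
exists s0.
  have l1 : (#|` s0| <= #|` t'|)%N by rewrite leq_imfset_card.
  have l2 : (#|` t'| <= #|` t|)%N by rewrite leq_imfset_card.
  by split=> //; apply: leq_trans l1 (leq_trans l2 tn).
have [Yl wl ls] : [set t | [/\ Yt t, w \in t & [fset p u | u in t]%fset = s0]] (lft s0).
  by apply: xgetPex; exists t'.
have -> : lft s0 = t' by apply: (@cov_lift_uniq _ _ _ _ _ cov w s0).
apply/fsetP => o; apply/imfsetP/imfsetP => /=.
  by move=> [_ /imfsetP[x /= xt ->] ->]; exists x => //; rewrite orbit_act// gpredV.
move=> [x xt ->]; exists (act g^-1%g x); first by rewrite in_imfset.
by rewrite orbit_act// gpredV.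
Qed.

End Quotient.

(** * Uniform gaps and cohomology *)

Section Sums.
Variable R : realType.

Lemma ler_sum_sub (T : eqType) (s1 s2 : seq T) (F : T -> R) : uniq s1 ->
  (forall x, 0 <= F x) -> (forall x, x \in s1 -> F x != 0 -> x \in s2) ->
  \sum_(x <- s1) F x <= \sum_(x <- s2) F x.
Proof.
move=> u1 F0; elim: s1 s2 u1 => [|x s1 IH] s2 /=; first by rewrite big_nil sumr_ge0.
move=> /andP[xs1 u1] h; rewrite big_cons.
have [Fx|Fx] := eqVneq (F x) 0.
  by rewrite Fx add0r; apply: IH => // y ys; apply: h; rewrite inE ys orbT.
have xs2 := h x (mem_head _ _) Fx.
rewrite (perm_big _ (perm_to_rem xs2)) big_cons lerD2l; apply: IH => // y ys Fy.
apply: rem_mem; first by apply: contraNneq xs1 => <-.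
by apply: h => //; rewrite inE ys orbT.
Qed.

(** For nonnegative a this is summability, with no ordering of the index set. *)
Definition bounded_sums (T : eqType) (a : T -> R) :=
  exists B, forall s : seq T, uniq s -> \sum_(i <- s) a i <= B.

Lemma bounded_sums_tail (T : eqType) (a : T -> R) e : (forall i, 0 <= a i) -> bounded_sums a -> 0 < e ->
  exists J : seq T, forall s : seq T, uniq s -> (forall i, i \in s -> i \notin J) -> \sum_(i <- s) a i <= e.
Proof.
move=> a0 [B aB] e0; pose S := [set \sum_(i <- s) a i | s in [set s : seq T | uniq s]].
have supS : has_sup S.
  split; first by exists (\sum_(i <- [::]) a i), [::].
  by exists B => _ [s us <-]; exact: aB.
have [_ [J uJ <-] SJ] := sup_adherent e0 supS.
exists J => s us sJ.
have : \sum_(i <- J ++ s) a i <= sup S.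
  apply: (sup_upper_bound supS); exists (J ++ s) => //=; rewrite cat_uniq uJ us andbT.
  by apply/hasPn => i /sJ.
by rewrite big_cat /= -lerBrDl => /le_trans; apply; rewrite lerBlDl -lerBlDr ltW.
Qed.

Lemma sum_inv_exp2_le (s : seq nat) : uniq s -> \sum_(m <- s) (2 ^+ m)^-1 <= 2 :> R.
Proof.
move=> us; pose K := (\max_(m <- s) m).+1.
apply: (@le_trans _ _ (\sum_(m <- iota 0 K) (2 ^+ m)^-1)).
  apply: ler_sum_sub => // m ms _; rewrite mem_iota add0n ltnS.
  exact: (@leq_bigmax_seq _ _ xpredT id).
suff -> : \sum_(m <- iota 0 K) (2 ^+ m)^-1 = 2 - 2 / 2 ^+ K :> R.
  by rewrite gerBl divr_ge0// exprn_ge0.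
elim: K => [|K IH]; first by rewrite big_nil expr0 divr1 subrr.
rewrite -addn1 iotaD big_cat /= IH big_seq1 add0n addn1 exprS.
by field; rewrite expf_neq0.
Qed.

Section Hilbert.
Variables (I : choiceType) (V : I -> normedModType R[i]).

Lemma sqsum_le (f : forall i, V i) B :
  (forall s, uniq s -> \sum_(i <- s) rnorm (f i) ^+ 2 <= B) -> (sqsum f <= B%:E)%E.
Proof.
move=> h; apply: ge_ereal_sup => _ [X [finX _] <-].
by rewrite fsbig_finite//= sumEFin lee_fin; exact: h.
Qed.

Lemma hs_sq_le (f : hilbert_sum V) B :
  (forall s, uniq s -> \sum_(i <- s) rnorm (f i) ^+ 2 <= B) -> hs_sq f <= B.
Proof. by move=> h; rewrite -lee_fin fineK ?hs_fin//; exact: sqsum_le. Qed.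

Lemma hs_sq_sum (f : hilbert_sum V) s : uniq s -> \sum_(i <- s) rnorm (f i) ^+ 2 <= hs_sq f.
Proof.
move=> us; rewrite -lee_fin fineK ?hs_fin//; apply: esum_ge; exists [set` s].
  by split.
by rewrite -fsbig_seq// sumEFin.
Qed.

Lemma rnorm_sq (f : hilbert_sum V) : rnorm f ^+ 2 = hs_sq f.
Proof. by rewrite /rnorm -[Num.norm f]/(hs_norm f) /hs_norm /= sqr_sqrtr ?hs_sq_ge0. Qed.

End Hilbert.

Lemma alternating_nonuniq (T : choiceType) (N : lmodType R[i]) k (c : k.-tuple T -> N) (t : k.-tuple T) :
  alternating_fun c -> ~~ uniq t -> c t = 0.
Proof.
move=> ca /tuple_uniqP ninj.
have [i [j [ij tij]]] : exists i j, i != j /\ tnth t i = tnth t j.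
  apply: contrapT => H; apply: ninj => i j tij; apply/eqP; apply: contraT => ij.
  by exfalso; apply: H; exists i, j.
have tt : tuple_perm (tperm i j) t = t.
  by apply: eq_from_tnth => a; rewrite tnth_mktuple; case: tpermP => // ->.
have := ca (tperm i j) t; rewrite tt odd_tperm ij expr1 scaleN1r => /eqP.
by rewrite -addr_eq0 -mulr2n -scaler_nat scaler_eq0 pnatr_eq0 => /eqP.
Qed.

End Sums.

(** * Equivariant cochains as square-summable families on the quotients *)

Section Expanders.
Variables (R : realType) (Gamma : groupType) (V W : choiceType).
Variables (Y : scomplex V) (Yt : scomplex W) (p : W -> V).
Hypothesis cov : simplicial_covering Y Yt p.
Hypothesis Yt_contr : contractible R (realization R Yt).
Variable act : Gamma -> W -> W.
Hypothesis act_deck : acts_by_deck act Yt p.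
Variable n : nat.
Hypothesis Y_fin : finite_set (simplices (skeleton n Y)).
Variables (I : choiceType) (Lambda : I -> groupClosed Gamma).
Hypothesis Lambda_fin : forall i, finite_set [set: rcosets (Lambda i)].

Local Notation Z i := (quotient_complex act (Lambda i) (skeleton n Yt)).
Local Notation orb i := (orbits act (Lambda i)).
Local Notation tspx t := (spans_spx Yt (tval t)).
Local Notation tact := (tact act).
Local Notation torb i t := (torb act (Lambda i) t).
Local Notation tco i x := (to_rcoset (Lambda i) x).
Local Notation L i k := (k.-tuple (orb i) -> R[i]^o).
Local Notation cochain i := (@cochain R _ (Z i)).
Local Notation cobZ i := (@cobZ R _ (Z i) _).
Local Notation perp_im i := (@perp_im R _ (Z i) _).
Local Notation pi := (hs_rep (fun i => coset_rep R (Lambda i))).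
Local Notation U := (hilbert_sum (fun i => (L2_cosets R (Lambda i) : normedModType R[i]))).
Local Notation ecochain := (@ecochain R Gamma W Yt act U pi _).

Let Zfin i : finite_set (simplices (Z i)) :=
  quotient_finite cov Yt_contr act_deck Y_fin (Lambda_fin i).

Definition crd i (f : U) (c : rcosets (Lambda i)) : R[i]^o := (f i : L2_cosets R (Lambda i)) c.

Lemma crd_linear i (c : rcosets (Lambda i)) : linear (fun f : U => crd f c).
Proof. by []. Qed.

Lemma crd_rep i g (f : U) (c : rcosets (Lambda i)) : crd (pi g f) c = crd f (rcoset_mul c g).
Proof. by []. Qed.

Lemma crd_ext (f f' : U) : (forall i x, crd f (tco i x) = crd f' (tco i x)) -> f = f'.
Proof.
move=> h; apply: hilbert_sumP => i; apply: hilbert_sumP => c.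
by have := h i (crep c); rewrite to_rcoset_crep.
Qed.

Lemma crd_cob k (c : k.-tuple W -> U) t i (x : rcosets (Lambda i)) :
  crd (cob c t) x = cob (fun t => crd (c t) x) t.
Proof. by rewrite ((@cob_lin _ _ _ _ _ _ _ _ (crd_linear x))). Qed.

Definition cosets i : seq (rcosets (Lambda i)) := enum_fset (fset_set [set: rcosets (Lambda i)]).

Lemma mem_cosets i c : c \in cosets i.
Proof. by rewrite /cosets in_fset_set ?in_setT//; exact: Lambda_fin. Qed.

Lemma rnorm_crd i (f : U) : rnorm (f i) ^+ 2 = \sum_(c <- cosets i) complex.Re `|crd f c| ^+ 2.
Proof.
rewrite rnorm_sq; apply/eqP; rewrite eq_le; apply/andP; split.
  apply: hs_sq_le => s us; apply: ler_sum_sub => // [c|c _ _]; first exact: sqr_ge0.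
  exact: mem_cosets.
exact: (hs_sq_sum (f i) (fset_uniq _)).
Qed.

Lemma cobZ_torb i k (b : L i k.+1) (t : k.+2.-tuple W) : (k < n)%N -> tspx t -> cochain i b ->
  cobZ i b (torb i t) = cob b (torb i t).
Proof.
move=> kn st bc; have [ut|ut] := boolP (uniq t).
  by rewrite cobZ_in//; exact: (torb_osx cov act_deck).
have nu : ~~ uniq (torb i t) by apply: contra ut => /map_uniq.
rewrite cobZ_out; last by case => + _; apply/negP.
by rewrite (alternating_nonuniq (cob_alternating (cochain_alt bc)) nu).
Qed.

Lemma cochain_ext i k (b b' : L i k.+1) : cochain i b -> cochain i b' ->
  (forall t : k.+1.-tuple W, tspx t -> (k <= n)%N -> b (torb i t) = b' (torb i t)) -> b = b'.
Proof.
move=> bc b'c h; apply/funext => u; have [ou|ou] := pselect (ord_simplex (Z i) u).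
  by have [t [-> st _ kn]] := osx_torb ou; exact: h.
by rewrite (cochain_out bc ou) (cochain_out b'c ou).
Qed.

(* The value of c at a lift of u, at the trivial coset of Lambda i. *)
Definition desc i k (c : k.+1.-tuple W -> U) : L i k.+1 := fun u =>
  if pselect (ord_simplex (Z i) u) is left h then crd (c (sval (cid (osx_torb h)))) (tco i 1%g) else 0.
Arguments desc i {k} c _.

(** By equivariance the coordinates at all cosets are read off from the trivial coset at translates,
    so [desc] loses no information. *)
Lemma crd_cos i k (c : k.+1.-tuple W -> U) t x : ecochain c ->
  crd (c t) (tco i x) = crd (c (tact x t)) (tco i 1%g).
Proof. by move=> [_ ce _]; rewrite ce crd_rep rcoset_mul_to_rcoset mul1g. Qed.

Lemma desc_torb i k (c : k.+1.-tuple W -> U) t : (k <= n)%N -> ecochain c -> tspx t ->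
  desc i c (torb i t) = crd (c t) (tco i 1%g).
Proof.
move=> kn cc st; have [ut|ut] := boolP (uniq t); last first.
  rewrite /desc; case: pselect => [ot|_].
    by have [+ _] := ot; move=> /map_uniq; rewrite (negbTE ut).
  by case: cc => _ _ ca; rewrite (alternating_nonuniq ca ut).
have ot := torb_osx cov act_deck (Lambda i) kn st ut.
rewrite /desc; case: pselect => // h; case: cid => t' [/= tt' st' ut' _].
have [g gL ->] := torb_inj cov act_deck st st' tt'.
rewrite -crd_cos//; congr (crd _ _); apply/to_rcosetP.
by rewrite mul1g gpredV.
Qed.

Lemma desc_torb_act i k (c : k.+1.-tuple W -> U) t x : (k <= n)%N -> ecochain c -> tspx t ->
  desc i c (torb i (tact x t)) = crd (c t) (tco i x).
Proof. by move=> kn cc st; rewrite desc_torb ?(spx_tact act_deck)// -crd_cos. Qed.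

Lemma desc_cochain i k (c : k.+1.-tuple W -> U) : ecochain c -> cochain i (desc i c).
Proof.
move=> cc; split=> [u nu|s u]; first by rewrite /desc; case: pselect.
have [ou|ou] := pselect (ord_simplex (Z i) u); last first.
  have ou' : ~ ord_simplex (Z i) (tuple_perm s u) by rewrite osx_perm.
  by rewrite /desc; do 2![case: pselect => // _]; rewrite mulr0.
have [t [-> st _ kn]] := osx_torb ou.
rewrite -torb_perm !desc_torb//; last exact/spx_perm.
by case: cc => _ _ ->.
Qed.

Lemma desc_cob i k (c : k.+1.-tuple W -> U) t : (k < n)%N -> ecochain c -> tspx t ->
  cobZ i (desc i c) (torb i t) = crd (cob c t) (tco i 1%g).
Proof.
move=> kn cc st; rewrite cobZ_torb//; last exact: desc_cochain.
rewrite crd_cob; apply: eq_bigr => j _; rewrite -torb_face desc_torb//; first exact: ltnW.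
exact: spx_face.
Qed.

(** The list [ts] of orbit representatives is the same for all i, which makes the comparison of
    norms uniform: each simplex of Z i comes from a coset translate of some t in [ts]. *)
Lemma nsq_reps k : exists2 ts : seq (k.+1.-tuple W), (forall t, t \in ts -> tspx t) &
  forall i (x : L i k.+1), cochain i x -> forall F : k.+1.-tuple W -> U,
   (forall t y, tspx t -> x (torb i (tact y t)) = crd (F t) (tco i y)) ->
   nsq x <= \sum_(t <- ts) rnorm (F t i) ^+ 2.
Proof.
have [ts [tss tsP]] := tuple_reps cov Yt_contr act_deck Y_fin k.
exists ts => // i x xc F xF.
pose h (q : k.+1.-tuple W * rcosets (Lambda i)) := torb i (tact (crep q.2) q.1).
pose G u := complex.Re `|x u| ^+ 2.
apply: (@le_trans _ _ (\sum_(u <- [seq h (t, c) | t <- ts, c <- cosets i]) G u)).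
  apply: ler_sum_sub; first exact: tups_uniq.
    by move=> u; exact: sqr_ge0.
  move=> u _ Gu; have ou : ord_simplex (Z i) u.
    apply: contrapT => nu; move: Gu; rewrite /G (cochain_out xc nu) normr0.
    by rewrite expr0n eqxx.
  have [t [-> st _ _]] := osx_torb ou; have [g [t0 [t0s ->]]] := tsP t st.
  apply/allpairsP; exists (t0, tco i g); split; rewrite ?mem_cosets//.
  rewrite /h /=; have [l lL {1}->] := crep_to_rcoset (Lambda i) g.
  by rewrite (tactM act_deck) (torb_act act_deck).
rewrite big_allpairs_dep big_seq [leRHS]big_seq; apply: ler_sum => t /tss st.
rewrite rnorm_crd; apply: ler_sum => c _; rewrite /G /h xF//.
by rewrite to_rcoset_crep.
Qed.

(** Freeness of the action makes the simplices obtained from different cosets distinct, so each is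
    counted at most once. *)
Lemma nsq_orbit i k (x : L i k.+1) t : tspx t ->
  \sum_(c <- cosets i) complex.Re `|x (torb i (tact (crep c) t))| ^+ 2 <= nsq x.
Proof.
move=> st; pose h (c : rcosets (Lambda i)) := torb i (tact (crep c) t).
rewrite -(big_map h xpredT (fun u => complex.Re `|x u| ^+ 2)).
apply: ler_sum_sub => [|u|u _ _]; last 2 first.
- exact: sqr_ge0.
- exact: (mem_tups (@Zfin i)).
rewrite map_inj_in_uniq ?fset_uniq// => c c' _ _ hc.
have [||g gL] := torb_inj cov act_deck _ _ hc; rewrite ?(spx_tact act_deck)//.
rewrite -(tactM act_deck) => /(tact_free cov Yt_contr act_deck) cg.
by rewrite -(to_rcoset_crep c) -(to_rcoset_crep c'); apply/to_rcosetP; rewrite cg mulgK.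
Qed.

Lemma nsq_ge i k (x : L i k.+1) t (f : U) : tspx t ->
  (forall y, x (torb i (tact y t)) = crd f (tco i y)) -> rnorm (f i) ^+ 2 <= nsq x.
Proof.
move=> st h; rewrite rnorm_crd; apply: le_trans (nsq_orbit x st).
by apply: ler_sum => c _; rewrite h to_rcoset_crep.
Qed.

(** The inverse of [desc]: the coordinate at the coset of y is x i at the translate by y, and
    summability places the family in the Hilbert sum. *)
Lemma mk_ecochain k (x : forall i, L i k.+1) : (forall i, cochain i (x i)) ->
  bounded_sums (fun i => nsq (x i)) ->
  exists2 b : k.+1.-tuple W -> U, ecochain b &
    forall t, tspx t -> forall i y, crd (b t) (tco i y) = x i (torb i (tact y t)).
Proof.
move=> xc [B xB].
pose v t i (c : rcosets (Lambda i)) : R[i]^o := if `[< tspx t >] then x i (torb i (tact (crep c) t)) else 0.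
have v1 t i s : uniq s -> \sum_(c <- s) rnorm (v t i c) ^+ 2 <= nsq (x i).
  move=> us; rewrite /v; case: asboolP => st.
    apply: le_trans (nsq_orbit (x i) st); apply: ler_sum_sub => // [c|c _ _].
      exact: sqr_ge0.
    exact: mem_cosets.
  rewrite big1 ?nsq_ge0// => c _; by rewrite /rnorm normr0 expr0n.
have v2 t i : (sqsum (v t i) < +oo)%E.
  exact: le_lt_trans (sqsum_le (v1 t i)) (ltry _).
pose w t i : L2_cosets R (Lambda i) := HilbertSum (v2 t i).
have w1 t : (sqsum (w t : forall i, (L2_cosets R (Lambda i) : normedModType R[i])) < +oo)%E.
  apply: (@le_lt_trans _ _ B%:E); last exact: ltry.
  apply: sqsum_le => s us; apply: le_trans (xB s us); apply: ler_sum => i _.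
  by rewrite rnorm_sq; apply: hs_sq_le => s' us'; exact: v1.
pose b t : U := HilbertSum (w1 t).
have bE t : tspx t -> forall i y, crd (b t) (tco i y) = x i (torb i (tact y t)).
  move=> st i y; rewrite /crd /= /v asboolT//.
  have [l lL {2}->] := crep_to_rcoset (Lambda i) y.
  by rewrite (tactM act_deck) (torb_act act_deck _ lL).
have bN t : ~ tspx t -> b t = 0.
  by move=> st; apply: crd_ext => i y; rewrite /crd /= /v asboolF.
exists b => //; split=> [//|g t|s t].
  have [st|st] := pselect (tspx t).
    apply: crd_ext => i y; rewrite crd_rep rcoset_mul_to_rcoset !bE//.
      by rewrite (tactM act_deck).
    by rewrite (spx_tact act_deck).
  have st' : ~ tspx (tact g t) by rewrite (spx_tact act_deck).
  by rewrite !bN//; apply: crd_ext => i y; rewrite crd_rep.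
have [st|st] := pselect (tspx t); last first.
  have st' : ~ tspx (tuple_perm s t) by rewrite spx_perm.
  by rewrite !bN// scaler0.
have st' : tspx (tuple_perm s t) by rewrite spx_perm.
apply: crd_ext => i y; rewrite bE//.
transitivity ((-1) ^+ odd_perm s *: crd (b t) (tco i y)) => //.
rewrite bE// -tact_perm torb_perm; exact: (cochain_alt (xc i)).
Qed.

Lemma mk_ecochain_cob k (x : forall i, L i k.+1) (b : k.+1.-tuple W -> U) : (k < n)%N ->
  (forall i, cochain i (x i)) ->
  (forall t, tspx t -> forall i y, crd (b t) (tco i y) = x i (torb i (tact y t))) ->
  forall t, tspx t -> forall i y, crd (cob b t) (tco i y) = cobZ i (x i) (torb i (tact y t)).
Proof.
move=> kn xc bE t st i y; rewrite cobZ_torb ?(spx_tact act_deck)// crd_cob.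
apply: eq_bigr => j _; rewrite bE; last exact: spx_face.
by rewrite -torb_face tact_face.
Qed.

Lemma perp_nsq_le i l (r : L i l.+1) z : perp_im i r -> cochain i z -> nsq r <= nsq (r + cobZ i z).
Proof.
move=> [rc rp] zc; rewrite -lecR -!ip_nsq.
have rz := rp z zc; have zr : ip (cobZ i z) r = 0 by rewrite ip_conj rz conjC0.
have E (y x : L i l.+1) : ip y (r + x) = ip y r + ip y x.
  by rewrite ip_conj (qDl (@ip_lin R _ l.+1)) rmorphD /= [ip y r]ip_conj [ip y x]ip_conj.
by rewrite (qDl (@ip_lin R _ l.+1)) !E rz zr addr0 add0r lerDl ip_ge0.
Qed.

Lemma desc_bounded k (c : k.+1.-tuple W -> U) : (k <= n)%N -> ecochain c ->
  bounded_sums (fun i => nsq (desc i c)).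
Proof.
move=> kn cc; have [ts tss tsP] := nsq_reps k.
exists (\sum_(t <- ts) hs_sq (c t)) => s us.
apply: (@le_trans _ _ (\sum_(i <- s) \sum_(t <- ts) rnorm (c t i) ^+ 2)).
  apply: ler_sum => i _; apply: tsP; first exact: desc_cochain.
  by move=> t y st; exact: desc_torb_act.
by rewrite exchange_big; apply: ler_sum => t _; exact: hs_sq_sum.
Qed.

Lemma desc_eq_cob i k (c : k.+2.-tuple W -> U) (b : k.+1.-tuple W -> U) : (k < n)%N ->
  ecochain c -> ecochain b -> (forall t, tspx t -> c t = cob b t) ->
  desc i c = cobZ i (desc i b).
Proof.
move=> kn cc bc cb; apply: cochain_ext; first exact: desc_cochain.
  by apply: cobZ_cochain; exact: desc_cochain.
by move=> t st _; rewrite desc_cob// desc_torb// cb.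
Qed.

Lemma desc_cocycle i k (c : k.+1.-tuple W -> U) : (k < n)%N ->
  ecochain c -> (forall t, tspx t -> cob c t = 0) -> cobZ i (desc i c) = 0.
Proof.
move=> kn cc c0; apply: cochain_ext; [|exact: cochain0|].
  by apply: cobZ_cochain; exact: desc_cochain.
by move=> t st _; rewrite desc_cob// c0.
Qed.

Lemma cobZB i k (x y : L i k) : cobZ i (x - y) = cobZ i x - cobZ i y.
Proof. by have [h hE] := linear_pack (@cobZ_linear R _ (Z i) k); rewrite !hE linearB. Qed.

Lemma cochainB i k (x y : L i k) : cochain i x -> cochain i y -> cochain i (x - y).
Proof. by move=> xc yc; rewrite addrC -scaleN1r; exact: cochain_lin. Qed.

(** * From a uniform gap to exactness and closedness *)

Section Forward.
Variable e : R.
Hypothesis e0 : 0 < e.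

(* The preimages are projected off the image of cobZ, where the gap bounds them. *)
Lemma lift_cob l (c : l.+2.-tuple W -> U) : (l < n)%N ->
  (forall i, (e%:E <= spectral_gap R (Z i) l)%E) -> ecochain c ->
  (forall i, exists2 b : L i l.+1, cochain i b & desc i c = cobZ i b) ->
  exists2 b : l.+1.-tuple W -> U, ecochain b & forall t, tspx t -> c t = cob b t.
Proof.
move=> ln gap cc cb.
have /all_sig[x xP] i : {x : L i l.+1 | perp_im i x /\ desc i c = cobZ i x}.
  apply: cid; have [b bc ->] := cb i; have [z zc bz] := cochain_proj (@Zfin i) bc.
  by exists (b - cobZ i z); split; rewrite // cobZB cobZ_cobZ subr0.
have [B cB] := desc_bounded ln cc.
have [|b bc bE] := mk_ecochain (fun i => (xP i).1.1).
  exists (e^-1 * B) => s us; rewrite mulrC ler_pdivlMr// mulr_suml.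
  apply: le_trans (cB s us); apply: ler_sum => i _.
  rewrite mulrC (xP i).2; exact: (gap_ineq (@Zfin i) (gap i) (xP i).1).
exists b => // t st; apply: crd_ext => i y.
rewrite (mk_ecochain_cob ln (fun i => (xP i).1.1) bE)// -(xP i).2.
by rewrite desc_torb_act.
Qed.

(** The residue of [desc i c] off the image of d is a cocycle in [perp_im], hence zero by the gap in
    degree l + 1; the gap in degree l then bounds the preimages. *)
Lemma gap_exact l : (l.+1 < n)%N ->
  (forall i k, (k < n)%N -> (e%:E <= spectral_gap R (Z i) k)%E) ->
  @cochain_exact R Gamma W Yt act U pi l.
Proof.
move=> ln gap c cc c0; apply: lift_cob => // [|i|i]; [exact: ltnW|apply: gap; exact: ltnW|].
have [b bc rP] := cochain_proj (@Zfin i) (desc_cochain i cc).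
exists b => //; apply/eqP; rewrite -subr_eq0; apply/eqP/(nsq_eq0 (@Zfin i)).
apply/eqP; rewrite eq_le nsq_ge0 andbT -(pmulr_rle0 _ e0).
apply: le_trans (gap_ineq (@Zfin i) (gap i l.+1 ln) rP) _.
rewrite cobZB cobZ_cobZ subr0 (desc_cocycle i ln cc c0).
by rewrite -lecR -ip_nsq (q0l (@ip_lin R _ _)).
Qed.

(** In degree n the residue off the image is killed by approximation instead: its norm is at most
    the distance from [desc i c] to any coboundary. *)
Lemma gap_closed l : l.+1 = n ->
  (forall i k, (k < n)%N -> (e%:E <= spectral_gap R (Z i) k)%E) ->
  @cochain_closed R Gamma W Yt act U pi l.
Proof.
move=> ln gap c cc c0 capp; have ln' : (l < n)%N by rewrite -ln.
apply: lift_cob => // [i|i]; first exact: gap.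
have [b bc rP] := cochain_proj (@Zfin i) (desc_cochain i cc).
exists b => //; apply/eqP; rewrite -subr_eq0; apply/eqP/(nsq_eq0 (@Zfin i)).
have [ts tss tsP] := nsq_reps l.+1.
set r := desc i c - _ in rP *.
(* Approximation on the finite list [ts] is enough, because [nsq_reps] bounds the norm on Z i by the
   values there. *)
have H d : 0 < d -> nsq r <= (size ts)%:R * d ^+ 2.
  move=> d0; have [b' b'c b'P] := capp ts d d0.
  have b'd := desc_cochain i b'c.
  have -> : (size ts)%:R * d ^+ 2 = \sum_(t <- ts) d ^+ 2.
    by rewrite big_const_seq count_predT iter_addr_0 mulr_natl.
  apply: (@le_trans _ _ (nsq (r + cobZ i (b - desc i b')))).
    by apply: perp_nsq_le => //; exact: cochainB.
  have -> : r + cobZ i (b - desc i b') = desc i c - cobZ i (desc i b').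
    by rewrite /r cobZB addrA subrK.
  apply: (@le_trans _ _ (\sum_(t <- ts) rnorm ((c t - cob b' t) i) ^+ 2)).
    apply: (tsP i _ _ (fun t => c t - cob b' t)).
      by apply: cochainB; [exact: desc_cochain|exact: cobZ_cochain].
    move=> t y st; transitivity (desc i c (torb i (tact y t)) - cobZ i (desc i b') (torb i (tact y t))) => //.
    have -> : crd (c t - cob b' t) (tco i y) = crd (c t) (tco i y) - crd (cob b' t) (tco i y) by [].
    rewrite desc_torb_act ?ln//; congr (_ - _).
    rewrite desc_cob ?(spx_tact act_deck)// !crd_cob; apply: eq_bigr => j _; congr (_ *: _).
    by rewrite tact_face -crd_cos.
  rewrite big_seq [leRHS]big_seq; apply: ler_sum => t tts.
  apply: le_trans (hs_sq_coord _ _) _; rewrite -rnorm_sq.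
  rewrite lerXn2r ?nnegrE ?rnorm_ge0 ?(ltW d0)// ltW//.
  by apply: b'P => //; exact: tss.
apply/eqP; rewrite eq_le nsq_ge0 andbT; apply/ler_addgt0Pr => d d0; rewrite add0r.
have s0 : 0 < (size ts).+1%:R :> R by rewrite ltr0n.
have d1 : 0 < Num.sqrt (d / (size ts).+1%:R) by rewrite sqrtr_gt0 divr_gt0.
apply: le_trans (H _ d1) _; rewrite sqr_sqrtr; last by rewrite divr_ge0// ltW.
by rewrite mulrCA ger_pMr// ler_pdivrMr// mul1r ler_nat.
Qed.

End Forward.

Lemma mk_desc i k (x : forall i, L i k.+1) (b : k.+1.-tuple W -> U) :
  (forall i, cochain i (x i)) -> ecochain b ->
  (forall t, tspx t -> forall i y, crd (b t) (tco i y) = x i (torb i (tact y t))) ->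
  desc i b = x i.
Proof.
move=> xc bc bE; apply: cochain_ext => [||t st kn]; [exact: desc_cochain|exact: xc|].
by rewrite desc_torb// bE// (tact1 act_deck).
Qed.

Lemma im_perp_eq0 i l (c : L i l.+1) b : perp_im i c -> cochain i b -> c = cobZ i b -> c = 0.
Proof. by move=> [_ cp] bc cb; apply: (ip_eq0 (@Zfin i)); rewrite {2}cb; exact: cp. Qed.

Lemma cobZ0 i k : cobZ i (0 : L i k) = 0.
Proof. by have [h hE] := linear_pack (@cobZ_linear R _ (Z i) k); rewrite hE linear0. Qed.

Lemma nsq0 i k : nsq (0 : L i k) = 0.
Proof. by apply: complexI; rewrite -ip_nsq (q0l (@ip_lin R _ _)). Qed.

Lemma perp_imB i l (x y : L i l.+1) : perp_im i x -> perp_im i y -> perp_im i (x - y).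
Proof. by move=> xp yp; rewrite addrC -scaleN1r; exact: perp_im_lin. Qed.

Lemma cocycle_const i (c : L i 1) : (0 < n)%N -> cochain i c -> cobZ i c = 0 ->
  exists z, forall w, c (torb i [tuple w]) = z.
Proof.
move=> n0 cc c0; have [x0 _] := Yt_contr; have [w0 _] := realization_supp_neq0 x0.
exists (c (torb i [tuple w0])) => w; have [us [ep <-]] := epath_ex Yt_contr w0 w.
elim: us w0 ep => [//|u us IH] w0 /= [wu ep]; rewrite IH//.
have st : tspx [tuple w0; u].
  by apply: (spans_sub wu) => // v; rewrite !inE.
have := congr1 (fun f : L i 2 => f (torb i [tuple w0; u])) c0; rewrite cobZ_torb//.
rewrite /cob !big_ord_recl big_ord0 -!torb_face.
have -> : tuple_face ord0 [tuple w0; u] = [tuple u].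
  by apply: eq_from_tnth => j; rewrite tnth_mktuple !ord1.
have -> : tuple_face (lift ord0 ord0) [tuple w0; u] = [tuple w0].
  by apply: eq_from_tnth => j; rewrite tnth_mktuple !ord1.
rewrite expr0 expr1 scale1r scaleN1r addr0 => /eqP.
by rewrite subr_eq0 => /eqP.
Qed.

(** By connectedness a 0-cocycle is constant, and constants are the image of the augmented
    coboundary. *)
Lemma perp_inj0 i (c : L i 1) : (0 < n)%N -> perp_im i c -> cobZ i c = 0 -> c = 0.
Proof.
move=> n0 cp c0; have [z zP] := cocycle_const n0 cp.1 c0.
pose b : L i 0 := fun=> z.
have bc : cochain i b.
  split=> [t nt|s t].
    by exfalso; apply: nt; split; [rewrite tuple0|left].
  by rewrite (_ : s = 1%g) ?odd_perm1 ?mul1r//; apply/permP => -[].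
apply: (im_perp_eq0 cp bc); apply: cochain_ext; [exact: cp.1|exact: cobZ_cochain|].
move=> t; case/tupleP: t => w t; rewrite (tuple0 t) => st _.
rewrite cobZ_in; last exact: (torb_osx cov act_deck).
by rewrite /cob big_ord_recl big_ord0 expr0 scale1r addr0; exact: zP.
Qed.

(** Extend c by zero to the other quotients. Exactness makes this family a coboundary, so c is both
    orthogonal to the image of d and in it. *)
Lemma exact_inj l i (c : L i l.+2) : (l.+1 < n)%N ->
  @cochain_exact R Gamma W Yt act U pi l ->
  perp_im i c -> cobZ i c = 0 -> c = 0.
Proof.
move=> ln ex cp c0; pose x := @eqtype.dfwith I (fun j => L j l.+2) (fun=> 0) i c.
have xi : x i = c by rewrite /x eqtype.dfwith_in.
have xc j : cochain j (x j).
  by rewrite /x; case: eqtype.dfwithP => [|j' _]; [exact: cp.1|exact: cochain0].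
have x0 j : cobZ j (x j) = 0.
  by rewrite /x; case: eqtype.dfwithP => [|j' _]; [exact: c0|exact: cobZ0].
have [|b bc bE] := mk_ecochain xc.
  exists (nsq c) => s us; apply: (@le_trans _ _ (\sum_(j <- [:: i]) nsq (x j))).
    apply: ler_sum_sub => // [j|j _ xj]; first exact: nsq_ge0.
    rewrite mem_seq1; apply: contraNT xj => ji.
    by rewrite /x eqtype.dfwith_out 1?eq_sym// nsq0.
  by rewrite big_seq1 xi.
have [|b' b'c bb'] := ex b bc.
  by move=> t st; apply: crd_ext => j y; rewrite (mk_ecochain_cob ln xc bE)// x0.
apply: (im_perp_eq0 cp (desc_cochain i b'c)).
by rewrite -xi -(mk_desc i xc bc bE); apply: desc_eq_cob => //; exact: ltnW.
Qed.

Lemma nsqZ i k (a : R) (c : L i k) : 0 <= a -> nsq (a%:C%C *: c) = a ^+ 2 * nsq c.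
Proof.
move=> a0; rewrite /nsq mulr_sumr; apply: eq_bigr => t _.
transitivity (rnorm (a%:C%C *: c t : R[i]^o) ^+ 2) => //.
by rewrite rnormZ exprMn ger0_norm// ler0c.
Qed.

Lemma cobZZ i k a (c : L i k) : cobZ i (a *: c) = a *: cobZ i c.
Proof. by have [h hE] := linear_pack (@cobZ_linear R _ (Z i) k); rewrite !hE linearZ. Qed.

(** * From closedness to a uniform gap *)

Section Backward.
Variable l : nat.
Hypothesis ln : (l < n)%N.
Hypothesis inj : forall i (c : L i l.+1), perp_im i c -> cobZ i c = 0 -> c = 0.
Hypothesis closed : @cochain_closed R Gamma W Yt act U pi l.

(* The cobZ i (x i) assemble into a limit of coboundaries, hence a coboundary cob b; *)
(* by injectivity x i is the projection of desc i b, so nsq (x i) <= nsq (desc i b). *)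
Lemma cochain_closed_bounded (x : forall i, L i l.+1) : (forall i, perp_im i (x i)) ->
  bounded_sums (fun i => nsq (cobZ i (x i))) -> bounded_sums (fun i => nsq (x i)).
Proof.
move=> xp xB; have xc i : cochain i (x i) by case: (xp i).
have [|d dc dE] := mk_ecochain _ xB; first by move=> i; exact: cobZ_cochain.
(* The x i are not known to be square-summable, so the cocycle condition is checked coordinatewise,
   from the double coboundary of x i. *)
have dcob : forall t, tspx t -> cob d t = 0.
  move=> t st; apply: crd_ext => i y.
  transitivity (cob (cob (x i)) (torb i (tact y t))); last by rewrite cob_cob.
  rewrite crd_cob; apply: eq_bigr => j _; congr (_ *: _).
  have sf := spx_face j st; rewrite dE// cobZ_torb ?(spx_tact act_deck)//.
  by rewrite -torb_face tact_face.
have [|b bc db] := closed dc dcob.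
  move=> ts e e0.
  have e20 : 0 < (e / 2) ^+ 2 by rewrite exprn_gt0// divr_gt0.
  have [|J JP] := bounded_sums_tail _ xB e20; first by move=> i; exact: nsq_ge0.
  (* Truncation to a finite set of indices is square-summable, and the coboundary changes only by a
     tail of the sum, at most (e / 2)^2. *)
  pose xJ i := if i \in J then x i else 0.
  have xJc i : cochain i (xJ i) by rewrite /xJ; case: ifP => _ //; exact: cochain0.
  have [|b bc bE] := mk_ecochain xJc.
    exists (\sum_(i <- J) nsq (xJ i)) => s us; apply: ler_sum_sub => // [i|i _].
      exact: nsq_ge0.
    by rewrite /xJ; case: ifP => // _; rewrite nsq0 eqxx.
  exists b => // t tts st.
  have dbE i y : crd (d t - cob b t) (tco i y) = (cobZ i (x i) - cobZ i (xJ i)) (torb i (tact y t)).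
    transitivity (crd (d t) (tco i y) - crd (cob b t) (tco i y)) => //.
    by rewrite dE// (mk_ecochain_cob ln xJc bE).
  have dbi i : rnorm ((d t - cob b t) i) ^+ 2 <= if i \in J then 0 else nsq (cobZ i (x i)).
    apply: le_trans (nsq_ge st (fun y => esym (dbE i y))) _.
    by rewrite /xJ; case: ifP => _; rewrite ?subrr ?nsq0// cobZ0 subr0.
  apply: (@le_lt_trans _ _ (e / 2)); last by rewrite ltr_pdivrMr// ltr_pMr// ltr1n.
  rewrite -(@ler_pXn2r _ 2)// ?nnegrE ?rnorm_ge0 ?divr_ge0 ?(ltW e0)//.
  rewrite rnorm_sq; apply: hs_sq_le => s us.
  apply: le_trans (ler_sum _ (fun i _ => dbi i)) _.
  apply: (@le_trans _ _ (\sum_(i <- [seq i <- s | i \notin J]) nsq (cobZ i (x i)))).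
    rewrite big_filter [leRHS]big_mkcond /=; apply: ler_sum => i _.
    by case: (i \in J).
  apply: JP; first by rewrite filter_uniq.
  by move=> i; rewrite mem_filter => /andP[].
have [B bB] := desc_bounded (ltnW ln) bc.
exists B => s us; apply: le_trans (bB s us); apply: ler_sum => i _.
have [z zc yp] := cochain_proj (@Zfin i) (desc_cochain i bc).
have yx : desc i b - cobZ i z = x i.
  apply/eqP; rewrite -subr_eq0; apply/eqP/inj; first exact: perp_imB.
  rewrite !cobZB cobZ_cobZ subr0 -(desc_eq_cob i ln dc bc db).
  by rewrite (mk_desc i (x := fun i => cobZ i (x i)) _ dc dE) ?subrr// => j; exact: cobZ_cochain.
have -> : desc i b = x i + cobZ i z by rewrite -yx subrK.
exact: perp_nsq_le.
Qed.

(** Failure of the estimate for e = 4^-m gives a cochain, which is then rescaled to squared norm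
    2^m. *)
Lemma small_ratio (dP : ~ exists2 e, 0 < e & forall i (c : L i l.+1), perp_im i c -> e * nsq c <= nsq (cobZ i c)) m :
  exists ic : {i : I & L i l.+1},
    [/\ perp_im (projT1 ic) (projT2 ic), nsq (projT2 ic) = 2 ^+ m &
        nsq (cobZ (projT1 ic) (projT2 ic)) <= (2 ^+ m)^-1].
Proof.
apply: contrapT => nH; apply: dP; exists ((2 ^+ m * 2 ^+ m)^-1).
  by rewrite invr_gt0 mulr_gt0// exprn_gt0.
move=> i c cp; rewrite leNgt; apply/negP => lt; apply: nH.
have c0 : 0 < nsq c.
  rewrite lt_neqAle nsq_ge0 andbT; apply/eqP => c0.
  by move: lt; rewrite -c0 mulr0 ltNge nsq_ge0.
pose a := Num.sqrt (2 ^+ m / nsq c).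
have a0 : 0 <= a by exact: sqrtr_ge0.
have a2 : a ^+ 2 = 2 ^+ m / nsq c by rewrite sqr_sqrtr// divr_ge0 ?exprn_ge0// ltW.
exists (existT _ i (a%:C%C *: c)); split => /=.
- by rewrite -[_ *: _]addr0; apply: perp_im_lin => //; exact: perp_im0.
- by rewrite nsqZ// a2 divfK// gt_eqF.
- rewrite cobZZ nsqZ//; apply: le_trans (ler_wpM2l (sqr_ge0 a) (ltW lt)) _.
  rewrite a2 le_eqVlt; apply/orP; left; apply/eqP.
  by field; rewrite !gt_eqF// exprn_gt0.
Qed.

(* The cochain kept on Z i is the one with the largest m among those with i_m = i; *)
(* this makes the sum over i of the nsq (cobZ i _) at most the sum of the 2^-m.    *)
Lemma closed_gap : exists2 e, 0 < e & forall i (c : L i l.+1), perp_im i c -> e * nsq c <= nsq (cobZ i c).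
Proof.
apply: contrapT => dP; have /choice[im imP] := small_ratio dP.
pose f m := projT1 (im m).
have m_le m : m%:R <= 2 ^+ m :> R by rewrite -natrX ler_nat ltnW// ltn_expl.
(* The individual gap e of Z i forces e 2^m <= 2^-m <= 1 whenever the m-th cochain lives on Z i. *)
have fK i : exists K, forall m, f m = i -> (m <= K)%N.
  have [e e0 eP] := perp_pos (@Zfin i) (@inj i).
  exists (Num.bound e^-1) => m fm; subst i; have [xp x2 xm] := imP m.
  have := le_trans (eP _ xp) xm; rewrite x2 => e2.
  have {}e2 : 2 ^+ m <= e^-1.
    rewrite -[leRHS]mul1r ler_pdivlMr// mulrC; apply: le_trans e2 _.
    by rewrite invf_le1 ?exprn_gt0// exprn_ege1// ler1n.
  rewrite -(@ler_nat R); apply: le_trans (m_le m) (le_trans e2 (ltW _)).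
  by apply: archi_boundP; rewrite invr_ge0 ltW.
have /all_sig[x xP] i : {x : L i l.+1 * nat | [/\ perp_im i x.1,
    forall m, f m = i -> 2 ^+ m <= nsq x.1, nsq (cobZ i x.1) <= (2 ^+ x.2)^-1 &
    nsq (cobZ i x.1) != 0 -> f x.2 = i]}.
  apply: cid; have [ex|nex] := pselect (exists m, f m = i); last first.
    exists (0, 0%N); split=> /=; first exact: perp_im0.
    - by move=> m fm; exfalso; apply: nex; exists m.
    - by rewrite cobZ0 nsq0 invr_ge0 expr0.
    - by rewrite cobZ0 nsq0 eqxx.
  have [K KP] := fK i.
  have exP : exists m, `[< f m = i >] by have [m fm] := ex; exists m; apply/asboolP.
  have bP m : `[< f m = i >] -> (m <= K)%N by move=> /asboolP/KP.
  case: (ex_maxnP exP bP) => M /asboolP fM Mmax; subst i.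
  have [xp x2 xm] := imP M; exists (projT2 (im M), M); split=> //= m fm.
  by rewrite x2 ler_weXn2l ?ler1n//; apply: Mmax; exact/asboolP.
have [||B xB] := @cochain_closed_bounded (fun i => (x i).1).
- by move=> i; case: (xP i).
- exists 2 => s us; pose a i := nsq (cobZ i (x i).1).
  pose s' := [seq i <- s | a i != 0].
  apply: (@le_trans _ _ (\sum_(i <- s') a i)).
    apply: ler_sum_sub => // [i|i si ai]; first exact: nsq_ge0.
    by rewrite mem_filter ai.
  apply: (@le_trans _ _ (\sum_(i <- s') (2 ^+ (x i).2)^-1)).
    by apply: ler_sum => i _; case: (xP i).
  rewrite -(big_map (fun i => (x i).2) xpredT (fun m => (2 ^+ m)^-1)).
  (* Where the coboundary is nonzero, the exponent x i recorded with the cochain determines i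
     through [f]; so the exponents are distinct and the powers sum to at most 2. *)
  apply: sum_inv_exp2_le; rewrite map_inj_in_uniq ?filter_uniq//.
  move=> i j; rewrite !mem_filter => /andP[ai _] /andP[aj _] xij.
  have [_ _ _ <-//] := xP i; have [_ _ _ <-//] := xP j.
  by rewrite xij.
(* The bound on the norms given by closedness would exceed every power of 2. *)
have two m : 2 ^+ m <= B.
  have := xB [:: f m] isT; rewrite big_seq1; apply: le_trans.
  by have [_ h _ _] := xP (f m); exact: h.
have B0 : 0 <= B by apply: le_trans (two 0%N).
have := archi_boundP B0; rewrite ltNge => /negP; apply.
exact: le_trans (m_le _) (two _).
Qed.

End Backward.

Lemma exact_closed l : @cochain_exact R Gamma W Yt act U pi l ->
  @cochain_closed R Gamma W Yt act U pi l.
Proof. by move=> ex c cc c0 _; exact: ex. Qed.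

Lemma expanders_cohomology : (1 <= n)%N ->
  spectral_expanders R n (fun i => Z i) <->
  (forall l, (l.+1 < n)%N -> @cochain_exact R Gamma W Yt act U pi l) /\
  @cochain_closed R Gamma W Yt act U pi n.-1.
Proof.
move=> n0; split=> [[_ _ [e [e0 gap]]]|[ex cl]].
  split=> [l ln|]; first exact: (gap_exact e0 ln).
  by apply: (gap_closed e0 _ gap); rewrite prednK.
(* Vanishing below degree n is a stronger form of closedness, so [closed_gap] applies in every
   degree l < n. *)
have cl' l : (l < n)%N -> @cochain_closed R Gamma W Yt act U pi l.
  move=> ln; have : (l <= n.-1)%N by rewrite -ltnS prednK.
  rewrite leq_eqVlt => /orP[/eqP -> //|ln'].
  by apply/exact_closed/ex; rewrite -(prednK n0) ltnS.
have inj l : (l < n)%N -> forall i (c : L i l.+1), perp_im i c -> cobZ i c = 0 -> c = 0.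
  case: l => [|l] ln i c; first exact: perp_inj0.
  exact: exact_inj (ex l ln).
have gap l : (l < n)%N -> exists2 e, 0 < e & forall i, (e%:E <= spectral_gap R (Z i) l)%E.
  move=> ln; have [e e0 eP] := closed_gap ln (inj l ln) (cl' l ln).
  exists (e / l.+2%:R); first by rewrite divr_gt0.
  by move=> i; apply: (ineq_gap (@Zfin i)); exact: eP.
split; first by move=> i; exact: Zfin.
- have /finite_setP[D DP] := Y_fin; exists D => i v.
  have [D' [_ D'le] sub] := quotient_degree cov act_deck Y_fin v.
  apply: card_le_trans (subset_card_le sub) (card_le_trans D'le _).
  by move: DP; rewrite card_eq_le => /andP[].
(* The minimum of the finitely many constants, one for each degree. *)
- have H m : (m <= n)%N -> exists e : R, 0 < e /\
      forall i l, (l < m)%N -> (e%:E <= spectral_gap R (Z i) l)%E.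
    elim: m => [|m IH] mn; first by exists 1.
    have [e [e0 eP]] := IH (ltnW mn); have [e' e'0 e'P] := gap m mn.
    exists (Num.min e e'); split; first by rewrite lt_min e0.
    move=> i l; rewrite ltnS leq_eqVlt => /orP[/eqP ->|lm].
      by apply: le_trans (e'P i); rewrite lee_fin ge_min lexx orbT.
    by apply: le_trans (eP i l lm); rewrite lee_fin ge_min lexx.
  exact: H (leqnn n).
Qed.

End Expanders.

Theorem corollary4p2 (R : realType) (n : nat) (n_ge1 : (1 <= n)%N)
  (Gamma : groupType)
  (V W : choiceType) (Y : scomplex V) (Yt : scomplex W) (p : W -> V)
  (Yt_cover : universal_cover R Y Yt p)
  (Y_KG1 : is_KGamma1 R Gamma Y Yt)
  (Y_fin : finite_set (simplices (skeleton n Y)))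
  (act : Gamma -> W -> W) (act_deck : acts_by_deck act Yt p)
  (I : choiceType) (Lambda : I -> groupClosed Gamma)
  (Lambda_fin : forall i, finite_set [set: rcosets (Lambda i)])
  (F : free_resolution R Gamma) :
  let pi := hs_rep (fun i => coset_rep R (Lambda i)) in
  spectral_expanders R n
    (fun i => quotient_complex act (Lambda i) (skeleton n Yt))
  <->
  (forall j, (1 <= j <= n.-1)%N -> cohomology_eq0 F pi j) /\
  cohomology_reduced F pi n.
Proof.
have [cov _] := Yt_cover; have [_ _ Yt_contr] := Y_KG1.
move=> pi; rewrite (expanders_cohomology cov Yt_contr act_deck Y_fin Lambda_fin n_ge1).
rewrite -[X in cohomology_reduced _ _ X](prednK n_ge1).
rewrite -(cohomology_reduced_cochain cov Yt_contr act_deck pi F).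
have E l : (0 < l.+1 <= n.-1)%N = (l.+1 < n)%N by rewrite /= -[in RHS](prednK n_ge1) ltnS.
split=> -[ex red]; split=> //.
  case=> // l; rewrite E => ln.
  exact/(cohomology_eq0_cochain cov Yt_contr act_deck pi F)/ex.
move=> l ln; apply/(cohomology_eq0_cochain cov Yt_contr act_deck pi F); apply: ex.
by rewrite E.
Qed.
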